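(* Let $f$ be a meromorphic almost periodic function, not identically zero, on a horizontal strip $S$. Then its divisor $d_f$, its divisor of zeros $d_f^{+}$, its divisor of poles $d_f^{-}$, and the divisor $|d_f|$ are all almost periodic.
   Context: A (horizontal) strip is a set $S=\{z\in\mathbb C: a<\operatorname{Im} z<b\}$ with $-\infty\le a<b\le\infty$. For $S'=\{z: \alpha<\operatorname{Im} z<\beta\}$, the notation $S'\subset\subset S$ means $a<\alpha<\beta<b$. $\rho$ denotes the spherical metric on $\overline{\mathbb C}=\mathbb C\cup\{\infty\}$. A set $E\subset\mathbb R$ is relatively dense if there is $L>0$ such that every segment $[t,t+L]$, $t\in\mathbb R$, meets $E$. A continuous function $g$ on $\mathbb R$ is almost periodic if for every $\varepsilon>0$ the set $\{\tau\in\mathbb R:|g(x+\tau)-g(x)|<\varepsilon\ \ \forall x\in\mathbb R\}$ is relatively dense. A meromorphic function $f$ on $S$ is called a meromorphic almost periodic function on $S$ if for every $S'\subset\subset S$ and every $\varepsilon>0$ the set $\{\tau\in\mathbb R:\rho(f(z+\tau),f(z))<\varepsilon\ \ \forall z\in S'\}$ is relatively dense in $\mathbb R$. A divisor in $S$ is a set of pairs $d=\{(a_n,k_n)\}$, where the $a_n$ are distinct points of $S$ forming a set without limit points in $S$ and $k_n\in\mathbb Z\setminus\{0\}$. Set $|d|=\{(a_n,|k_n|)\}$, $d^{+}=\{(a_n,|k_n|): k_n>0\}$, $d^{-}=\{(a_n,|k_n|): k_n<0\}$. The divisor $d_f$ of a meromorphic function $f\not\equiv0$ consists of the pairs $(a_n,k_n)$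 with $a_n$ the zeros and poles of $f$ and $|k_n|$ their multiplicities, $k_n>0$ for zeros and $k_n<0$ for poles. A divisor $d=\{(a_n,k_n)\}$ in $S$ is almost periodic if for every $C^\infty$ function $\chi$ with compact support in $S$ the function $t\mapsto\sum_n k_n\chi(a_n+t)$ is an almost periodic function of $t\in\mathbb R$. *)

(* Defs.v *)
From Stdlib Require Import Reals ZArith List.
From Coquelicot Require Import Coquelicot.
Open Scope R_scope.

(** * Almost periodicity on the real line *)

Definition relatively_dense (E : R -> Prop) : Prop :=
  exists L : R, 0 < L /\ forall t : R, exists x : R, t <= x <= t + L /\ E x.

Definition almost_periodic (g : R -> C) : Prop :=
  (forall x : R, continuous g x) /\
  forall eps : R, 0 < eps ->
    relatively_dense (fun tau => forall x : R, Cmod (g (x + tau)%R - g x)%C < eps).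

(** * The Riemann sphere *)

Inductive Cbar : Type :=
  | Fin : C -> Cbar
  | Inf : Cbar.

Definition finite_part (w : Cbar) : C :=
  match w with Fin z => z | Inf => 0 end.

(** Euclidean distance in [R^3] between the stereographic images on the unit
    sphere. *)
Definition chordal (u v : Cbar) : R :=
  match u, v with
  | Fin z, Fin w =>
      2 * Cmod (z - w)%C / (sqrt (1 + Cmod z ^ 2) * sqrt (1 + Cmod w ^ 2))
  | Fin z, Inf => 2 / sqrt (1 + Cmod z ^ 2)
  | Inf, Fin w => 2 / sqrt (1 + Cmod w ^ 2)
  | Inf, Inf => 0
  end.

(** Great-circle distance: an arc of length [s] of the unit sphere has chord
    [2 * sin (s / 2)]. *)
Definition rho (u v : Cbar) : R := 2 * asin (chordal u v / 2).

(** * Meromorphic functions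

    A function on a set [S] is the restriction of a total function [C -> Cbar]:
    for [S] open, nothing below depends on its values outside [S]. *)

Definition strip (a b : Rbar) (z : C) : Prop :=
  Rbar_lt a (Im z) /\ Rbar_lt (Im z) b.

Definition holomorphic_at (g : C -> C) (z : C) : Prop :=
  locally z (fun w => ex_derive g w).

Definition regular_point (f : C -> Cbar) (z : C) : Prop :=
  locally z (fun w => f w <> Inf) /\
  holomorphic_at (fun w => finite_part (f w)) z.

Definition pole (f : C -> Cbar) (z : C) : Prop :=
  f z = Inf /\
  locally' z (fun w => f w <> Inf /\ ex_derive (fun u => finite_part (f u)) w) /\
  filterlim (fun w => Cmod (finite_part (f w))) (locally' z) (Rbar_locally p_infty).

Definition meromorphic (S : C -> Prop) (f : C -> Cbar) : Prop :=
  forall z : C, S z -> regular_point f z \/ pole f z.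

Definition meromorphic_almost_periodic (a b : Rbar) (f : C -> Cbar) : Prop :=
  meromorphic (strip a b) f /\
  forall alpha beta : R,
    Rbar_lt a alpha -> alpha < beta -> Rbar_lt beta b ->
    forall eps : R, 0 < eps ->
      relatively_dense (fun tau =>
        forall z : C, strip alpha beta z -> rho (f (z + tau)%C) (f z) < eps).

Definition zero_of_multiplicity (f : C -> Cbar) (a : C) (m : nat) : Prop :=
  (0 < m)%nat /\
  exists g : C -> C, holomorphic_at g a /\ g a <> 0 /\
    locally a (fun w => f w = Fin ((w - a) ^ m * g w)%C).

Definition pole_of_multiplicity (f : C -> Cbar) (a : C) (m : nat) : Prop :=
  (0 < m)%nat /\ f a = Inf /\
  exists g : C -> C, holomorphic_at g a /\ g a <> 0 /\
    locally' a (fun w => f w = Fin (g w / (w - a) ^ m)%C).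

(** * Divisors, as sets of pairs (point, multiplicity) *)

Definition is_divisor (S : C -> Prop) (d : C * Z -> Prop) : Prop :=
  (forall a k, d (a, k) -> S a /\ k <> 0%Z) /\
  (forall a k k', d (a, k) -> d (a, k') -> k = k') /\
  (forall z, S z -> locally' z (fun a => forall k, ~ d (a, k))).

Definition div_abs (d : C * Z -> Prop) : C * Z -> Prop :=
  fun p => exists k : Z, d (fst p, k) /\ snd p = Z.abs k.

Definition div_pos (d : C * Z -> Prop) : C * Z -> Prop :=
  fun p => exists k : Z, d (fst p, k) /\ (0 < k)%Z /\ snd p = Z.abs k.

Definition div_neg (d : C * Z -> Prop) : C * Z -> Prop :=
  fun p => exists k : Z, d (fst p, k) /\ (k < 0)%Z /\ snd p = Z.abs k.

Definition div_of (S : C -> Prop) (f : C -> Cbar) : C * Z -> Prop :=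
  fun p => S (fst p) /\
    exists m : nat,
      (zero_of_multiplicity f (fst p) m /\ snd p = Z.of_nat m) \/
      (pole_of_multiplicity f (fst p) m /\ snd p = (- Z.of_nat m)%Z).

(** * Test functions *)

Definition smooth (chi : C -> C) : Prop :=
  forall (n : nat) (x y : R),
    ex_diff_n (fun u v => Re (chi (u, v))) n x y /\
    ex_diff_n (fun u v => Im (chi (u, v))) n x y.

Definition support (chi : C -> C) (z : C) : Prop :=
  ~ locally z (fun w => chi w = 0).

Definition compact_set (K : C -> Prop) : Prop :=
  forall (I : Type) (U : I -> C -> Prop),
    (forall i, open (U i)) ->
    (forall z, K z -> exists i, U i z) ->
    exists l : list I, forall z, K z -> exists i, In i l /\ U i z.

Definition test_function (S : C -> Prop) (chi : C -> C) : Prop :=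
  smooth chi /\ compact_set (support chi) /\ (forall z, support chi z -> S z).

(** * Almost periodic divisors *)

(** [s] is the sum of [F] over [A], where [F] has only finitely many nonzero
    values on [A]. *)
Definition is_finite_sum {T : Type} (A : T -> Prop) (F : T -> C) (s : C) : Prop :=
  exists l : list T,
    NoDup l /\ (forall p, In p l <-> A p /\ F p <> 0) /\
    s = fold_right Cplus 0 (map F l).

Definition almost_periodic_divisor (S : C -> Prop) (d : C * Z -> Prop) : Prop :=
  is_divisor S d /\
  forall chi : C -> C, test_function S chi ->
    exists g : R -> C,
      (forall t : R,
         is_finite_sum d (fun p => IZR (snd p) * chi (fst p + t))%C (g t)) /\
      almost_periodic g.

(* Main.v *)
Require Import Defs.
From Stdlib Require Import Reals ZArith List Lra Lia ClassicalEpsilon Permutation.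
From Coquelicot Require Import Coquelicot.
Import ListNotations.
Open Scope R_scope.

(** Write [f_s] for the translate [z |-> f (z + s)], and fix a test function
    [chi] with support in a narrower strip [S']. The sum of [chi (p + t)] over the
    zeros [p] of [f], counted with multiplicity, is the sum of [chi] over the zeros
    of [f_(- t)]. So it suffices that the zero sum of a translate depends on the
    translate with a modulus of continuity, for uniform distance on [S'], that is
    the same for all translates ([zero_sum_translates]): an almost period of [f]
    on [S'] is then an almost period of the sum, and continuity of the sum follows
    from uniform continuity of [f] on [S']. Poles are the zeros of [1 / f], which is
    almost periodic too because inversion is an isometry of the sphere. All four
    divisors are integer combinations of zeros and poles, and a modulus of
    continuity, unlike almost periodicity itself, is inherited by combinations
    without further work.

    The uniform modulus comes from compactness. The translates of [f] are totally
    bounded for the uniform distance on [S'] ([translates_totally_bounded]); if the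
    modulus failed, there would be translates [f_(s n)] converging uniformly on [S']
    to some [F] ([bochner]), together with translates [f_(s' n)] ever closer to
    [f_(s n)] but with zero sums at a fixed distance. The limit [F] is again a
    holomorphic map to the sphere ([sphol_limit]) and vanishes on no disc: it would
    otherwise vanish on [S'], so that [f] would have translates arbitrarily small
    on [S']; as [S'] is invariant under translation, [f] would be zero there, hence
    everywhere ([limit_of_translates]). By Hurwitz's theorem the zeros of maps near
    [F] converge to those of [F] with multiplicity ([zeros_stable]); a partition of
    unity turns this local statement into continuity of zero sums at [F]
    ([stable_sum_global]), a contradiction.

    The function theory needed is derived from Goursat's lemma. In logarithmic
    polar coordinates it gives the mean value property on circles, even for
    functions that are only continuous at the centre ([mean_value]). Applied to
    difference quotients it expresses the derivative as an average of translates of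
    the function, whence the derivative is itself differentiable and difference
    quotients are holomorphic ([holo_slope]). Removable singularities, factorization
    at zeros, limits of holomorphic functions and Hurwitz's theorem follow, the
    mean value property on well chosen circles replacing the maximum principle
    throughout. Hurwitz's theorem is obtained by splitting off one root after the
    other ([hurwitz_power]).

    The spherical metric enters through the coordinates [z / (1 + |z|^2)] and
    [1 / (1 + |z|^2)], in which inversion is a reflection; the resulting distance
    [sdist] is at most [rho]. *)

(** * Choice *)

Lemma choice_function {A B : Type} (P : A -> B -> Prop) :
  (forall x, exists y, P x y) -> exists f, forall x, P x (f x).
Proof.
  intros H. exists (fun x => proj1_sig (constructive_indefinite_description _ (H x))).
  intros x. apply proj2_sig.
Qed.

Lemma dependent_choice {A : Type} (Inv : nat -> A -> Prop) (Step : nat -> A -> A -> Prop) (x0 : A) :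
  Inv 0%nat x0 ->
  (forall n x, Inv n x -> exists y, Inv (S n) y /\ Step n x y) ->
  exists u, u 0%nat = x0 /\ forall n, Inv n (u n) /\ Step n (u n) (u (S n)).
Proof.
  intros H0 Hstep.
  destruct (choice_function (fun (p : nat * A) y => Inv (fst p) (snd p) ->
    Inv (S (fst p)) y /\ Step (fst p) (snd p) y)) as [f Hf].
  { intros [n x]. destruct (classic (Inv n x)) as [H|N].
    - destruct (Hstep n x H) as [y Hy]. eauto.
    - exists x. intros H. contradiction. }
  set (u := fix u n := match n with O => x0 | S m => f (m, u m) end).
  assert (Hu : forall n, Inv n (u n)).
  { induction n as [|n IH]; [exact H0|]. apply (Hf (n, u n)), IH. }
  exists u. split; [reflexivity|]. intros n. split; [apply Hu|]. apply (Hf (n, u n)), Hu.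
Qed.

(** * Complex differentiation *)

Ltac rmin_bounds a b := pose proof (Rmin_l a b); pose proof (Rmin_r a b).

Ltac exists_rmin a b :=
  exists (Rmin a b); rmin_bounds a b; split; [apply Rmin_pos; first [assumption | lra]|].

Lemma Cmod_minus_sym (z w : C) : Cmod (z - w) = Cmod (w - z).
Proof. rewrite <- Cmod_opp. f_equal. ring. Qed.

Lemma Cmod_triangle_minus (x y z : C) : Cmod (x - z) <= Cmod (x - y) + Cmod (y - z).
Proof. replace (x - z)%C with ((x - y) + (y - z))%C by ring. apply Cmod_triangle. Qed.

Lemma Cmod_triangle_rev (x y : C) : Cmod x - Cmod y <= Cmod (x - y).
Proof.
  assert (H := Cmod_triangle (x - y) y).
  replace (x - y + y)%C with x in H by ring. lra.
Qed.

Lemma Cmod_self_minus (z : C) : Cmod (z - z) = 0.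
Proof. replace (z - z)%C with (RtoC 0) by ring. apply Cmod_0. Qed.

Lemma Cminus_neq_0 (w z : C) : w <> z -> (w - z)%C <> 0.
Proof. intros H E. apply H. replace w with (w - z + z)%C by ring. rewrite E. ring. Qed.

Lemma Cmod_minus_pos (w z : C) : w <> z -> 0 < Cmod (w - z).
Proof. intros H. apply Cmod_gt_0, Cminus_neq_0, H. Qed.

Lemma Cmod_minus_eq_0 (w z : C) : Cmod (w - z) = 0 -> w = z.
Proof.
  intros H. apply Cmod_eq_0 in H. replace w with (w - z + z)%C by ring.
  rewrite H. ring.
Qed.

Lemma Cneq_of_pos (w z : C) : 0 < Cmod (w - z) -> w <> z.
Proof. intros H ->. rewrite Cmod_self_minus in H. lra. Qed.

Lemma locally_Cmod (z : C) (P : C -> Prop) :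
  locally z P <-> exists d, 0 < d /\ forall w, Cmod (w - z) < d -> P w.
Proof.
  split.
  - intros H. apply locally_C in H. destruct H as [d H].
    exists d. split; [apply cond_pos|]. intros w Hw. apply H. exact Hw.
  - intros [d [Hd H]]. apply locally_C. exists (mkposreal d Hd). intros w Hw. apply H. exact Hw.
Qed.

Lemma locally'_Cmod (z : C) (P : C -> Prop) :
  locally' z P <-> exists d, 0 < d /\ forall w, 0 < Cmod (w - z) < d -> P w.
Proof.
  unfold locally', within. rewrite locally_Cmod. split; intros [d [Hd H]]; exists d; split; auto.
  - intros w [H0 H1]. apply H; auto. apply Cneq_of_pos, H0.
  - intros w H1 H2. apply H. split; auto. apply Cmod_minus_pos, H2.
Qed.

Definition Ccont (g : C -> C) (z : C) : Prop :=
  forall eps, 0 < eps -> exists d, 0 < d /\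
    forall w, Cmod (w - z) < d -> Cmod (g w - g z) < eps.

Definition cderiv (g : C -> C) (z D : C) : Prop :=
  forall eps, 0 < eps -> exists d, 0 < d /\
    forall w, Cmod (w - z) < d -> Cmod (g w - g z - D * (w - z)) <= eps * Cmod (w - z).

(** Both normed-module structures of the complex numbers over themselves occur:
    the first has the sum rule, the second the product and chain rules. *)
Lemma cderiv_is_derive (g : C -> C) (z D : C) :
  cderiv g z D <-> is_derive (V := C_NormedModule) g z D.
Proof.
  split.
  - intros H. split; [apply is_linear_scal_l|].
    intros x Hx eps.
    apply (@is_filter_lim_locally_unique C_AbsRing (AbsRing_NormedModule C_AbsRing)) in Hx.
    subst x. destruct (H eps (cond_pos eps)) as [d [Hd Hw]].
    exists (mkposreal d Hd). intros w Hb. specialize (Hw w Hb).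
    change (Cmod (g w - g z - (w - z) * D) <= eps * Cmod (w - z)).
    rewrite (Cmult_comm (w - z)). exact Hw.
  - intros [_ H] eps He.
    destruct (H z (fun P HP => HP) (mkposreal eps He)) as [d Hd].
    exists d. split; [apply cond_pos|]. intros w Hw. specialize (Hd w Hw).
    change (Cmod (g w - g z - (w - z) * D) <= eps * Cmod (w - z)) in Hd.
    rewrite (Cmult_comm D). exact Hd.
Qed.

Lemma cderiv_is_derive_ring (g : C -> C) (z D : C) :
  cderiv g z D <-> is_derive (K := C_AbsRing) (V := AbsRing_NormedModule C_AbsRing) g z D.
Proof.
  rewrite cderiv_is_derive. split; intros [_ H]; (split; [apply is_linear_scal_l|exact H]).
Qed.

Lemma ex_derive_cderiv (g : C -> C) (z : C) :
  ex_derive (V := C_NormedModule) g z <-> exists D, cderiv g z D.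
Proof. split; intros [D H]; exists D; apply cderiv_is_derive; exact H. Qed.

Lemma Ccont_continuous (g : C -> C) (z : C) :
  Ccont g z <->
  continuous (U := AbsRing_UniformSpace C_AbsRing) (T := AbsRing_UniformSpace C_AbsRing) g z.
Proof.
  split.
  - intros H P [e HP]. destruct (H e (cond_pos e)) as [d [Hd H1]].
    exists (mkposreal d Hd). intros w Hw. apply HP, H1, Hw.
  - intros H e He. destruct (H (fun v => Cmod (v - g z) < e)) as [d Hd].
    + exists (mkposreal e He). intros v Hv. exact Hv.
    + exists d. split; [apply cond_pos|]. intros w Hw. apply Hd, Hw.
Qed.

Lemma Ccont_const (c z : C) : Ccont (fun _ => c) z.
Proof. intros e He. exists 1. split; [lra|]. intros w _. rewrite Cmod_self_minus. exact He. Qed.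

Lemma Ccont_id (z : C) : Ccont (fun w => w) z.
Proof. intros e He. exists e. auto. Qed.

Lemma Ccont_plus (f g : C -> C) (z : C) :
  Ccont f z -> Ccont g z -> Ccont (fun w => f w + g w)%C z.
Proof.
  rewrite !Ccont_continuous.
  apply (@continuous_plus (AbsRing_UniformSpace C_AbsRing) _ (AbsRing_NormedModule C_AbsRing)).
Qed.

Lemma Ccont_mult (f g : C -> C) (z : C) :
  Ccont f z -> Ccont g z -> Ccont (fun w => f w * g w)%C z.
Proof.
  rewrite !Ccont_continuous.
  apply (@continuous_mult (AbsRing_UniformSpace C_AbsRing) C_AbsRing).
Qed.

Lemma Ccont_nonzero (f : C -> C) (z : C) :
  Ccont f z -> f z <> 0 -> exists d, 0 < d /\
    forall w, Cmod (w - z) < d -> Cmod (f z) / 2 < Cmod (f w) < 2 * Cmod (f z).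
Proof.
  intros Hf Hz. apply Cmod_gt_0 in Hz.
  destruct (Hf (Cmod (f z) / 2)) as [d [Hd H]]; [lra|].
  exists d. split; [auto|]. intros w Hw. specialize (H w Hw).
  assert (T := Cmod_triangle_rev (f w) (f z)).
  assert (T' := Cmod_triangle_rev (f z) (f w)).
  rewrite Cmod_minus_sym in T'. lra.
Qed.

Lemma Ccont_inv (f : C -> C) (z : C) :
  Ccont f z -> f z <> 0 -> Ccont (fun w => / f w)%C z.
Proof.
  intros Hf Hz. destruct (Ccont_nonzero f z Hf Hz) as [d1 [Hd1 H1]].
  apply Cmod_gt_0 in Hz. intros e He. set (m := Cmod (f z)) in *.
  destruct (Hf (e * (m * m / 2))) as [d2 [Hd2 H2]].
  { apply Rmult_lt_0_compat; [auto|]. apply Rdiv_lt_0_compat; [nra|lra]. }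
  exists_rmin d1 d2.
  intros w Hw. specialize (H1 w ltac:(lra)).
  specialize (H2 w ltac:(lra)).
  assert (Hfw : f w <> 0) by (apply Cmod_gt_0; lra).
  assert (Hfz : f z <> 0) by (apply Cmod_gt_0; auto).
  replace (/ f w - / f z)%C with (- (f w - f z) * (/ f w * / f z))%C by (field; auto).
  rewrite !Cmod_mult, Cmod_opp, !Cmod_inv by auto. fold m.
  apply Rlt_le_trans with (e * (m * m / 2) * (/ Cmod (f w) * / m)).
  { apply Rmult_lt_compat_r; [|auto].
    apply Rmult_lt_0_compat; apply Rinv_0_lt_compat; lra. }
  replace (e * (m * m / 2) * (/ Cmod (f w) * / m)) with (e * ((m / 2) * / Cmod (f w)))
    by (field; lra).
  rewrite <- (Rmult_1_r e) at 2. apply Rmult_le_compat_l; [lra|].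
  apply Rmult_le_reg_r with (Cmod (f w)); [lra|]. rewrite Rmult_assoc, Rinv_l by lra. lra.
Qed.

Lemma Ccont_near (f g : C -> C) (z : C) (d : R) :
  0 < d -> (forall w, Cmod (w - z) < d -> f w = g w) -> Ccont f z -> Ccont g z.
Proof.
  intros Hd E Hf e He. destruct (Hf e He) as [d1 [Hd1 H1]].
  exists_rmin d d1. intros w Hw.
  rewrite <- !E.
  - apply H1. lra.
  - rewrite Cmod_self_minus. exact Hd.
  - lra.
Qed.

Lemma Ccont_comp (f g : C -> C) (z : C) :
  Ccont g z -> Ccont f (g z) -> Ccont (fun w => f (g w)) z.
Proof.
  intros Hg Hf e He. destruct (Hf e He) as [d1 [Hd1 H1]].
  destruct (Hg d1 Hd1) as [d2 [Hd2 H2]]. exists d2. auto.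
Qed.

Lemma cderiv_near (f g : C -> C) (z D : C) (d : R) :
  0 < d -> (forall w, Cmod (w - z) < d -> f w = g w) -> cderiv f z D -> cderiv g z D.
Proof.
  intros Hd E Hf e He. destruct (Hf e He) as [d1 [Hd1 H1]].
  exists_rmin d d1. intros w Hw.
  rewrite <- !E.
  - apply H1. lra.
  - rewrite Cmod_self_minus. exact Hd.
  - lra.
Qed.

(** When [D] is the derivative at [z], this is continuous there; it serves both
    as a substitute for the derivative and as the cofactor of [w - z] in [g]. *)
Definition slope (g : C -> C) (z D w : C) : C :=
  if Ceq_dec w z then D else ((g w - g z) / (w - z))%C.

Lemma slope_spec (g : C -> C) (z D w : C) : g w = (g z + slope g z D w * (w - z))%C.
Proof.
  unfold slope. destruct (Ceq_dec w z) as [->|H]; [ring|].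
  field. apply Cminus_neq_0, H.
Qed.

Lemma slope_center (g : C -> C) (z D : C) : slope g z D z = D.
Proof. unfold slope. destruct (Ceq_dec z z); congruence. Qed.

Lemma slope_off (g : C -> C) (z D w : C) : w <> z -> slope g z D w = ((g w - g z) / (w - z))%C.
Proof. unfold slope. destruct (Ceq_dec w z); congruence. Qed.

(** Caratheodory's form of the derivative. Continuity of the difference quotient
    at its base point is what the mean value property will require. *)
Lemma cderiv_slope (g : C -> C) (z D : C) : cderiv g z D -> Ccont (slope g z D) z.
Proof.
  intros H e He. destruct (H (e / 2)) as [d [Hd Hw]]; [lra|].
  exists d. split; [auto|]. intros w Hwd. specialize (Hw w Hwd).
  rewrite slope_center. destruct (Ceq_dec w z) as [->|N].
  { rewrite slope_center, Cmod_self_minus. exact He. }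
  assert (P := Cmod_minus_pos w z N).
  assert (E : (g w - g z - D * (w - z) = (slope g z D w - D) * (w - z))%C)
    by (rewrite (slope_spec g z D w) at 1; ring).
  rewrite E, Cmod_mult in Hw. apply Rmult_le_reg_r in Hw; lra.
Qed.

Lemma cderiv_of_slope (g phi : C -> C) (z : C) :
  Ccont phi z -> (forall w, g w = g z + phi w * (w - z))%C -> cderiv g z (phi z).
Proof.
  intros Hc E e He. destruct (Hc e He) as [d [Hd H]]. exists d. split; [auto|].
  intros w Hw. rewrite (E w).
  replace (g z + phi w * (w - z) - g z - phi z * (w - z))%C
    with ((phi w - phi z) * (w - z))%C by ring.
  rewrite Cmod_mult. apply Rmult_le_compat_r; [apply Cmod_ge_0|]. left. auto.
Qed.

Lemma cderiv_cont (g : C -> C) (z D : C) : cderiv g z D -> Ccont g z.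
Proof.
  intros H. apply cderiv_slope in H.
  apply (Ccont_near (fun w => g z + slope g z D w * (w - z))%C g z 1); [lra| |].
  { intros w _. symmetry. apply slope_spec. }
  apply (Ccont_plus (fun _ => g z)); [apply Ccont_const|].
  apply Ccont_mult; [exact H|].
  apply (Ccont_plus (fun w => w) (fun _ => - z)%C); [apply Ccont_id|apply Ccont_const].
Qed.

Lemma cderiv_const (c z : C) : cderiv (fun _ => c) z 0.
Proof. apply cderiv_is_derive, (is_derive_const (V := C_NormedModule)). Qed.

Lemma cderiv_id (z : C) : cderiv (fun w => w) z 1.
Proof. apply cderiv_is_derive_ring, (is_derive_id (K := C_AbsRing)). Qed.

Lemma cderiv_plus (f g : C -> C) (z a b : C) :
  cderiv f z a -> cderiv g z b -> cderiv (fun w => f w + g w)%C z (a + b).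
Proof.
  rewrite !cderiv_is_derive. apply (is_derive_plus (V := C_NormedModule)).
Qed.

Lemma cderiv_mult (f g : C -> C) (z a b : C) :
  cderiv f z a -> cderiv g z b ->
  cderiv (fun w => f w * g w)%C z (a * g z + f z * b).
Proof.
  rewrite !cderiv_is_derive_ring. intros Hf Hg.
  apply (is_derive_mult (K := C_AbsRing) f g z a b Hf Hg). intros n m. apply Cmult_comm.
Qed.

Lemma cderiv_inv (f : C -> C) (z a : C) :
  cderiv f z a -> f z <> 0 -> cderiv (fun w => / f w)%C z (- a / (f z * f z)).
Proof.
  intros Hf Hz. assert (Cf := cderiv_cont _ _ _ Hf).
  destruct (Ccont_nonzero f z Cf Hz) as [d [Hd Hn]].
  apply cderiv_slope in Hf. intros e He.
  set (phi := fun w => (- slope f z a w * (/ f w * / f z))%C).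
  assert (Hc : Ccont phi z).
  { unfold phi. apply Ccont_mult.
    - apply (Ccont_near (fun w => (- (1)) * slope f z a w)%C _ z 1); [lra|intros; ring|].
      apply Ccont_mult; auto using Ccont_const.
    - apply Ccont_mult; [apply Ccont_inv; auto|apply Ccont_const]. }
  destruct (Hc e He) as [d1 [Hd1 H1]].
  exists_rmin d d1. intros w Hw.
  specialize (H1 w ltac:(lra)).
  specialize (Hn w ltac:(lra)).
  assert (Hfw : f w <> 0) by (apply Cmod_gt_0; apply Cmod_gt_0 in Hz; lra).
  replace (/ f w - / f z - - a / (f z * f z) * (w - z))%C with ((phi w - phi z) * (w - z))%C.
  { rewrite Cmod_mult. apply Rmult_le_compat_r; [apply Cmod_ge_0|]. left. auto. }
  unfold phi. rewrite slope_center.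
  replace (/ f w - / f z)%C with (- (slope f z a w * (w - z)) * (/ f w * / f z))%C.
  { field. auto. }
  transitivity (- (f w - f z) * (/ f w * / f z))%C.
  { rewrite (slope_spec f z a w) at 2. ring. }
  field. auto.
Qed.

Lemma cderiv_comp (f g : C -> C) (z a b : C) :
  cderiv g z b -> cderiv f (g z) a -> cderiv (fun w => f (g w)) z (a * b).
Proof.
  rewrite !cderiv_is_derive_ring. intros Hg Hf. rewrite Cmult_comm.
  exact (@is_derive_comp C_AbsRing (AbsRing_NormedModule C_AbsRing) f g z a b Hf Hg).
Qed.

Lemma cderiv_slope_off (g : C -> C) (z D w d : C) :
  w <> z -> cderiv g w d -> exists d', cderiv (slope g z D) w d'.
Proof.
  intros N H.
  eexists. apply (cderiv_near (fun u => (g u + (- g z)) * / (u + (- z)))%C _ w _ (Cmod (w - z))).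
  - apply Cmod_minus_pos, N.
  - intros u Hu. rewrite slope_off; [reflexivity|].
    intros ->. rewrite Cmod_minus_sym in Hu. lra.
  - apply cderiv_mult; [apply cderiv_plus; [exact H|apply cderiv_const]|].
    apply cderiv_inv; [apply cderiv_plus; [apply cderiv_id|apply cderiv_const]|].
    apply (Cminus_neq_0 w z N).
Qed.

Definition holo (g : C -> C) (a : C) (r : R) : Prop :=
  forall z, Cmod (z - a) < r -> exists D, cderiv g z D.

Lemma holomorphic_at_holo (g : C -> C) (z : C) :
  holomorphic_at g z <-> exists r, 0 < r /\ holo g z r.
Proof.
  unfold holomorphic_at, holo. rewrite locally_Cmod.
  split; intros [d [Hd H]]; exists d; split; auto; intros w Hw; apply ex_derive_cderiv; auto.
Qed.

(** * Integration of complex-valued functions along segments *)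

Definition is_Cint (f : R -> C) (a b : R) (l : C) : Prop :=
  is_RInt (V := C_R_NormedModule) f a b l.

Definition Cint (f : R -> C) (a b : R) : C :=
  RInt (V := C_R_CompleteNormedModule) f a b.

Definition Rcont (f : R -> C) (t : R) : Prop :=
  forall eps, 0 < eps -> exists d, 0 < d /\
    forall s, Rabs (s - t) < d -> Cmod (f s - f t) < eps.

Lemma Rcont_continuous (f : R -> C) (t : R) : Rcont f t <-> continuous (U := C_UniformSpace) f t.
Proof.
  split.
  - intros H P HP. apply locally_Cmod in HP. destruct HP as [e [He HP]].
    destruct (H e He) as [d [Hd Hs]]. exists (mkposreal d Hd). intros s Hb. apply HP, Hs, Hb.
  - intros H e He.
    assert (HP : locally (f t) (fun w => Cmod (w - f t) < e)).
    { apply locally_Cmod. exists e. auto. }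
    destruct (H _ HP) as [d Hd]. exists d. split; [apply cond_pos|]. intros s Hs. apply Hd, Hs.
Qed.

Lemma Cint_correct (f : R -> C) (a b : R) :
  a <= b -> (forall t, a <= t <= b -> Rcont f t) -> is_Cint f a b (Cint f a b).
Proof.
  intros Hab H. apply (RInt_correct (V := C_R_CompleteNormedModule)).
  apply (ex_RInt_continuous (V := C_R_CompleteNormedModule)).
  intros t. rewrite Rmin_left, Rmax_right by auto. intros Ht.
  apply Rcont_continuous, H, Ht.
Qed.

Lemma is_Cint_unique (f : R -> C) (a b : R) (l : C) : is_Cint f a b l -> Cint f a b = l.
Proof. apply (is_RInt_unique (V := C_R_CompleteNormedModule)). Qed.

Lemma is_Cint_ext (f g : R -> C) (a b : R) (l : C) :
  a <= b -> (forall t, a <= t <= b -> f t = g t) -> is_Cint f a b l -> is_Cint g a b l.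
Proof.
  intros Hab E. apply is_RInt_ext. intros t. rewrite Rmin_left, Rmax_right by auto.
  intros Ht. apply E. lra.
Qed.

Lemma Cint_ext (f g : R -> C) (a b : R) :
  a <= b -> (forall t, a <= t <= b -> f t = g t) -> Cint f a b = Cint g a b.
Proof.
  intros Hab E. apply (RInt_ext (V := C_R_CompleteNormedModule)).
  intros t. rewrite Rmin_left, Rmax_right by auto. intros Ht. apply E. lra.
Qed.

Lemma is_Cint_plus (f g : R -> C) (a b : R) (lf lg : C) :
  is_Cint f a b lf -> is_Cint g a b lg -> is_Cint (fun t => f t + g t)%C a b (lf + lg).
Proof. apply (is_RInt_plus (V := C_R_NormedModule)). Qed.

Lemma is_Cint_components (f : R -> C) (a b : R) (l : C) :
  is_Cint f a b l <->
  is_RInt (fun t => fst (f t)) a b (fst l) /\ is_RInt (fun t => snd (f t)) a b (snd l).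
Proof.
  split.
  - intros H. split.
    + apply (is_RInt_fct_extend_fst (U := R_NormedModule) (V := R_NormedModule) f a b l H).
    + apply (is_RInt_fct_extend_snd (U := R_NormedModule) (V := R_NormedModule) f a b l H).
  - intros [H1 H2]. rewrite (surjective_pairing l).
    apply (is_RInt_fct_extend_pair (U := R_NormedModule) (V := R_NormedModule) f a b _ _ H1 H2).
Qed.

Lemma is_Cint_scal (c : C) (f : R -> C) (a b : R) (l : C) :
  is_Cint f a b l -> is_Cint (fun t => c * f t)%C a b (c * l).
Proof.
  intros H. apply is_Cint_components in H. destruct H as [H1 H2].
  apply is_Cint_components. destruct c as [c1 c2]. simpl. split.
  - apply (is_RInt_minus (V := R_NormedModule)).
    + apply (is_RInt_scal (V := R_NormedModule)), H1.
    + apply (is_RInt_scal (V := R_NormedModule)), H2.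
  - apply (is_RInt_plus (V := R_NormedModule)).
    + apply (is_RInt_scal (V := R_NormedModule)), H2.
    + apply (is_RInt_scal (V := R_NormedModule)), H1.
Qed.

Lemma is_Cint_minus (f g : R -> C) (a b : R) (lf lg : C) :
  is_Cint f a b lf -> is_Cint g a b lg -> is_Cint (fun t => f t - g t)%C a b (lf - lg).
Proof. apply (is_RInt_minus (V := C_R_NormedModule)). Qed.

Lemma is_Cint_const (c : C) (a b : R) : is_Cint (fun _ => c) a b (RtoC (b - a) * c).
Proof.
  apply is_Cint_components. destruct c as [c1 c2]. simpl.
  replace ((b - a) * c1 - 0 * c2) with ((b - a) * c1) by ring.
  replace ((b - a) * c2 + 0 * c1) with ((b - a) * c2) by ring.
  split; apply (is_RInt_const (V := R_NormedModule)).
Qed.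

Lemma is_Cint_Chasles (f : R -> C) (a b c : R) (l1 l2 : C) :
  is_Cint f a b l1 -> is_Cint f b c l2 -> is_Cint f a c (l1 + l2).
Proof. apply (is_RInt_Chasles (V := C_R_NormedModule)). Qed.

Lemma is_Cint_bound (f : R -> C) (a b M : R) (l : C) :
  a <= b -> (forall t, a <= t <= b -> Cmod (f t) <= M) -> is_Cint f a b l ->
  Cmod l <= (b - a) * M.
Proof.
  intros Hab H Hl. rewrite Cmod_norm.
  apply (norm_RInt_le_const (V := C_R_NormedModule) f a b l M Hab); [|exact Hl].
  intros t Ht. specialize (H t Ht). rewrite Cmod_norm in H. exact H.
Qed.

Lemma is_RInt_affine (p q a b : R) :
  is_RInt (fun t => p + q * t) a b (p * (b - a) + q * (b * b - a * a) / 2).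
Proof.
  replace (p * (b - a) + q * (b * b - a * a) / 2)
    with (minus (p * b + q * (b * b) / 2) (p * a + q * (a * a) / 2))
    by (unfold minus, plus, opp; simpl; field).
  apply (is_RInt_derive (V := R_CompleteNormedModule) (fun t => p * t + q * (t * t) / 2)).
  - intros t _. auto_derive; [auto|]. field.
  - intros t _. apply (ex_derive_continuous (V := R_NormedModule)). auto_derive. auto.
Qed.

(** * Goursat's lemma on rectangles *)

(** A property that passes from the quarters to the whole, and holds for all
    small rectangles around each point, holds for the whole: failing quarters
    would shrink to a point. Here [P n x y] speaks of the rectangle with lower left
    corner [(x, y)] and sides [w / 2 ^ n] and [h / 2 ^ n]. The shrinking rectangles
    contain the limit point, which is what lets Goursat's error term be measured
    by their size. *)
Lemma rectangle_subdivision (x0 y0 w h : R) (P : nat -> R -> R -> Prop) :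
  0 < w -> 0 < h ->
  (forall n x y, let w' := w / 2 ^ S n in let h' := h / 2 ^ S n in
    P (S n) x y -> P (S n) (x + w') y -> P (S n) x (y + h') -> P (S n) (x + w') (y + h') ->
    P n x y) ->
  (forall p q, x0 <= p <= x0 + w -> y0 <= q <= y0 + h -> exists d, 0 < d /\
    forall n x y, x <= p <= x + w / 2 ^ n -> y <= q <= y + h / 2 ^ n ->
      w / 2 ^ n + h / 2 ^ n < d -> P n x y) ->
  P 0%nat x0 y0.
Proof.
  intros Hw Hh Hsub Hloc. apply NNPP. intros Hbad.
  assert (step : forall n (c : R * R), ~ P n (fst c) (snd c) ->
    exists c' : R * R, ~ P (S n) (fst c') (snd c') /\
      (fst c' = fst c \/ fst c' = fst c + w / 2 ^ S n) /\
      (snd c' = snd c \/ snd c' = snd c + h / 2 ^ S n)).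
  { intros n [x y] Hn; simpl fst in *; simpl snd in *. apply NNPP. intros Hno. apply Hn.
    apply Hsub; apply NNPP; intros Hq; apply Hno.
    - exists (x, y). auto.
    - exists (x + w / 2 ^ S n, y). auto.
    - exists (x, y + h / 2 ^ S n). auto.
    - exists (x + w / 2 ^ S n, y + h / 2 ^ S n). auto. }
  destruct (dependent_choice (fun n c => ~ P n (fst c) (snd c)) _ (x0, y0) Hbad step)
    as [c [Hc0 Hc]].
  pose (X := fun n => fst (c n)). pose (Y := fun n => snd (c n)).
  assert (nested : forall (Z : nat -> R) (l : R), 0 < l ->
    (forall n, Z (S n) = Z n \/ Z (S n) = Z n + l / 2 ^ S n) ->
    exists p, forall n, Z n <= p <= Z n + l / 2 ^ n).
  { intros Z l Hl HZ.
    assert (pw : forall n, 0 < 2 ^ n) by (intros; apply pow_lt; lra).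
    assert (half : forall n, l / 2 ^ n = 2 * (l / 2 ^ S n)).
    { intros n. simpl. field. apply Rgt_not_eq, pw. }
    assert (pos : forall n, 0 < l / 2 ^ n) by (intros; apply Rdiv_lt_0_compat; auto).
    assert (mono : forall n k, Z n <= Z (n + k)%nat /\
      Z (n + k)%nat + l / 2 ^ (n + k) <= Z n + l / 2 ^ n).
    { intros n k. induction k as [|k IH].
      - rewrite Nat.add_0_r. lra.
      - rewrite Nat.add_succ_r. specialize (half (n + k)%nat). specialize (pos (S (n + k))).
        destruct (HZ (n + k)%nat) as [E|E]; rewrite E; lra. }
    assert (bnd : forall n m, Z m <= Z n + l / 2 ^ n).
    { intros n m. destruct (Nat.le_ge_cases n m) as [L|L].
      - replace m with (n + (m - n))%nat by lia. destruct (mono n (m - n)%nat) as [_ H].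
        specialize (pos (n + (m - n))%nat). lra.
      - replace n with (m + (n - m))%nat at 1 by lia.
        destruct (mono m (n - m)%nat) as [H _]. specialize (pos n). lra. }
    destruct (completeness (fun x => exists n, x = Z n)) as [p [Hp1 Hp2]].
    - exists (Z 0%nat + l / 2 ^ 0). intros x [n ->]. apply bnd.
    - exists (Z 0%nat). exists 0%nat. reflexivity.
    - exists p. intros n. split; [apply Hp1; exists n; reflexivity|].
      apply Hp2. intros x [m ->]. apply bnd. }
  destruct (nested X w Hw (fun n => proj1 (proj2 (Hc n)))) as [p Hp].
  destruct (nested Y h Hh (fun n => proj2 (proj2 (Hc n)))) as [q Hq].
  destruct (Hloc p q) as [d [Hd Hdd]].
  { specialize (Hp 0%nat). simpl in Hp. unfold X in Hp. rewrite Hc0 in Hp. simpl in Hp. lra. }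
  { specialize (Hq 0%nat). simpl in Hq. unfold Y in Hq. rewrite Hc0 in Hq. simpl in Hq. lra. }
  destruct (pow_lt_1_zero (1 / 2)) with (y := d / (w + h)) as [N HN].
  { rewrite Rabs_pos_eq; lra. }
  { apply Rdiv_lt_0_compat; lra. }
  apply (proj1 (Hc N)). apply Hdd; [apply Hp|apply Hq|].
  specialize (HN N (Nat.le_refl N)). rewrite Rabs_pos_eq in HN by (apply pow_le; lra).
  replace (w / 2 ^ N + h / 2 ^ N) with ((w + h) * (1 / 2) ^ N).
  - replace d with ((w + h) * (d / (w + h))) by (field; lra).
    apply Rmult_lt_compat_l; lra.
  - unfold Rdiv at 1. rewrite Rmult_1_l, pow_inv. field. apply pow_nonzero. lra.
Qed.

Definition boundary_integral (H : C -> C) (x y w h : R) : C :=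
  (Cint (fun t => H (t, y)) x (x + w) + Ci * Cint (fun t => H (x + w, t)%R) y (y + h)
   - Cint (fun t => H (t, y + h)%R) x (x + w) - Ci * Cint (fun t => H (x, t)) y (y + h))%C.

Lemma Cmod_le_abs (x y : R) : Cmod (x, y) <= Rabs x + Rabs y.
Proof.
  replace (x, y) with (RtoC x + Ci * RtoC y)%C by (apply injective_projections; simpl; ring).
  eapply Rle_trans; [apply Cmod_triangle|]. rewrite Cmod_mult, Cmod_Ci, !Cmod_R. lra.
Qed.

Lemma Rcont_horizontal (H : C -> C) (x y : R) : Ccont H (x, y) -> Rcont (fun t => H (t, y)) x.
Proof.
  intros Hc e He. destruct (Hc e He) as [d [Hd H1]]. exists d. split; [auto|].
  intros s Hs. apply H1. unfold Cminus, Cplus, Copp; simpl.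
  eapply Rle_lt_trans; [apply Cmod_le_abs|].
  replace (y + - y) with 0 by ring. rewrite Rabs_R0. unfold Rminus in Hs. lra.
Qed.

Lemma Rcont_vertical (H : C -> C) (x y : R) : Ccont H (x, y) -> Rcont (fun t => H (x, t)) y.
Proof.
  intros Hc e He. destruct (Hc e He) as [d [Hd H1]]. exists d. split; [auto|].
  intros s Hs. apply H1. unfold Cminus, Cplus, Copp; simpl.
  eapply Rle_lt_trans; [apply Cmod_le_abs|].
  replace (x + - x) with 0 by ring. rewrite Rabs_R0. unfold Rminus in Hs. lra.
Qed.

Definition Ccont_rectangle (H : C -> C) (x0 y0 w h : R) : Prop :=
  forall x y, x0 <= x <= x0 + w -> y0 <= y <= y0 + h -> Ccont H (x, y).

Lemma is_Cint_horizontal (H : C -> C) (x0 y0 w0 h0 x y w : R) :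
  Ccont_rectangle H x0 y0 w0 h0 ->
  0 <= w -> x0 <= x -> x + w <= x0 + w0 -> y0 <= y <= y0 + h0 ->
  is_Cint (fun t => H (t, y)) x (x + w) (Cint (fun t => H (t, y)) x (x + w)).
Proof.
  intros Hc ? ? ? ?. apply Cint_correct; [lra|]. intros t Ht.
  apply Rcont_horizontal, Hc; lra.
Qed.

Lemma is_Cint_vertical (H : C -> C) (x0 y0 w0 h0 x y h : R) :
  Ccont_rectangle H x0 y0 w0 h0 ->
  0 <= h -> y0 <= y -> y + h <= y0 + h0 -> x0 <= x <= x0 + w0 ->
  is_Cint (fun t => H (x, t)) y (y + h) (Cint (fun t => H (x, t)) y (y + h)).
Proof.
  intros Hc ? ? ? ?. apply Cint_correct; [lra|]. intros t Ht.
  apply Rcont_vertical, Hc; lra.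
Qed.

Lemma boundary_integral_quarters (H : C -> C) (x0 y0 w0 h0 x y w h : R) :
  Ccont_rectangle H x0 y0 w0 h0 ->
  0 <= w -> 0 <= h -> x0 <= x -> x + 2 * w <= x0 + w0 -> y0 <= y -> y + 2 * h <= y0 + h0 ->
  boundary_integral H x y (2 * w) (2 * h) =
  (boundary_integral H x y w h + boundary_integral H (x + w) y w h
   + boundary_integral H x (y + h) w h + boundary_integral H (x + w) (y + h) w h)%C.
Proof.
  intros Hc Hw Hh Hx Hx' Hy Hy'.
  assert (EH : forall v, y0 <= v <= y0 + h0 -> Cint (fun t => H (t, v)) x (x + 2 * w) =
    (Cint (fun t => H (t, v)) x (x + w) + Cint (fun t => H (t, v)) (x + w) (x + w + w))%C).
  { intros v Hv. apply is_Cint_unique. replace (x + 2 * w) with (x + w + w) by ring.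
    apply is_Cint_Chasles with (x + w); apply (is_Cint_horizontal H x0 y0 w0 h0); auto; lra. }
  assert (EV : forall v, x0 <= v <= x0 + w0 -> Cint (fun t => H (v, t)) y (y + 2 * h) =
    (Cint (fun t => H (v, t)) y (y + h) + Cint (fun t => H (v, t)) (y + h) (y + h + h))%C).
  { intros v Hv. apply is_Cint_unique. replace (y + 2 * h) with (y + h + h) by ring.
    apply is_Cint_Chasles with (y + h); apply (is_Cint_vertical H x0 y0 w0 h0); auto; lra. }
  unfold boundary_integral.
  rewrite (EH y), (EH (y + 2 * h)), (EV x), (EV (x + 2 * w)) by lra.
  replace (x + w + w) with (x + 2 * w) by ring. replace (y + h + h) with (y + 2 * h) by ring.
  ring.
Qed.

(** An affine function has no boundary integral, so only the error of the
    affine approximation matters. *)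
Lemma boundary_integral_affine_bound (H : C -> C) (x0 y0 w0 h0 x y w h e : R) (A B : C) :
  Ccont_rectangle H x0 y0 w0 h0 ->
  0 <= w -> 0 <= h -> x0 <= x -> x + w <= x0 + w0 -> y0 <= y -> y + h <= y0 + h0 ->
  (forall u v, x <= u <= x + w -> y <= v <= y + h -> Cmod (H (u, v) - (A + B * (u, v))) <= e) ->
  Cmod (boundary_integral H x y w h) <= 2 * (w + h) * e.
Proof.
  intros Hc Hw Hh Hx Hx' Hy Hy' He.
  set (LH := fun v : R => (RtoC w * A + B * (w * (2 * x + w) / 2, w * v)%R)%C).
  set (LV := fun u : R => (RtoC h * A + B * (h * u, h * (2 * y + h) / 2)%R)%C).
  assert (IH : forall v, is_Cint (fun t => A + B * (t, v))%C x (x + w) (LH v)).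
  { intros v. unfold LH. apply is_Cint_plus.
    - replace w with (x + w - x) at 2 by ring. apply is_Cint_const.
    - apply is_Cint_scal. apply is_Cint_components. simpl. split.
      + apply (is_RInt_ext (V := R_NormedModule) (fun t => 0 + 1 * t)); [intros; simpl; ring|].
        replace (w * (2 * x + w) / 2) with
          (0 * (x + w - x) + 1 * ((x + w) * (x + w) - x * x) / 2) by field.
        apply is_RInt_affine.
      + replace (w * v) with (scal (x + w - x) v).
        * apply (is_RInt_const (V := R_NormedModule)).
        * unfold scal; simpl. unfold mult; simpl. ring. }
  assert (IV : forall u, is_Cint (fun t => A + B * (u, t))%C y (y + h) (LV u)).
  { intros u. unfold LV. apply is_Cint_plus.
    - replace h with (y + h - y) at 2 by ring. apply is_Cint_const.
    - apply is_Cint_scal. apply is_Cint_components. simpl. split.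
      + replace (h * u) with (scal (y + h - y) u).
        * apply (is_RInt_const (V := R_NormedModule)).
        * unfold scal; simpl. unfold mult; simpl. ring.
      + apply (is_RInt_ext (V := R_NormedModule) (fun t => 0 + 1 * t)); [intros; simpl; ring|].
        replace (h * (2 * y + h) / 2) with
          (0 * (y + h - y) + 1 * ((y + h) * (y + h) - y * y) / 2) by field.
        apply is_RInt_affine. }
  assert (BH : forall v, y <= v <= y + h ->
    Cmod (Cint (fun t => H (t, v)) x (x + w) - LH v) <= w * e).
  { intros v Hv. replace w with (x + w - x) at 2 by ring.
    apply (is_Cint_bound (fun t => H (t, v) - (A + B * (t, v)))%C); [lra| |].
    - intros t Ht. apply He; lra.
    - apply is_Cint_minus; [apply (is_Cint_horizontal H x0 y0 w0 h0); auto; lra|apply IH]. }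
  assert (BV : forall u, x <= u <= x + w ->
    Cmod (Cint (fun t => H (u, t)) y (y + h) - LV u) <= h * e).
  { intros u Hu. replace h with (y + h - y) at 2 by ring.
    apply (is_Cint_bound (fun t => H (u, t) - (A + B * (u, t)))%C); [lra| |].
    - intros t Ht. apply He; lra.
    - apply is_Cint_minus; [apply (is_Cint_vertical H x0 y0 w0 h0); auto; lra|apply IV]. }
  assert (E0 : (LH y + Ci * LV (x + w)%R - LH (y + h)%R - Ci * LV x = 0)%C).
  { unfold LH, LV. apply injective_projections; simpl; field. }
  replace (boundary_integral H x y w h) with
    ((Cint (fun t => H (t, y)) x (x + w) - LH y)
     + Ci * (Cint (fun t => H (x + w, t)%R) y (y + h) - LV (x + w)%R)
     + - (Cint (fun t => H (t, y + h)%R) x (x + w) - LH (y + h)%R)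
     + - (Ci * (Cint (fun t => H (x, t)) y (y + h) - LV x)))%C.
  2:{ apply (f_equal Copp) in E0. rewrite Copp_0 in E0. unfold boundary_integral.
      rewrite <- (Cplus_0_r (_ - Ci * Cint (fun t => H (x, t)) _ _)), <- E0. ring. }
  eapply Rle_trans; [apply Cmod_triangle|].
  eapply Rle_trans; [apply Rplus_le_compat_r, Cmod_triangle|].
  eapply Rle_trans; [apply Rplus_le_compat_r, Rplus_le_compat_r, Cmod_triangle|].
  rewrite !Cmod_opp, !Cmod_mult, Cmod_Ci.
  assert (B1 := BH y ltac:(lra)). assert (B2 := BH (y + h) ltac:(lra)).
  assert (B3 := BV x ltac:(lra)). assert (B4 := BV (x + w) ltac:(lra)). lra.
Qed.

(** Differentiability at a point [z] makes the boundary integral of a small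
    rectangle around [z] at most [e] times its squared size; such a bound is
    additive under subdivision into quarters. *)
Lemma goursat (H : C -> C) (x0 y0 w h : R) :
  0 < w -> 0 < h ->
  (forall x y, x0 <= x <= x0 + w -> y0 <= y <= y0 + h -> exists D, cderiv H (x, y) D) ->
  boundary_integral H x0 y0 w h = 0.
Proof.
  intros Hw Hh HD.
  assert (Hc : Ccont_rectangle H x0 y0 w h).
  { intros x y Hx Hy. destruct (HD x y Hx Hy) as [D H1]. apply (cderiv_cont _ _ _ H1). }
  assert (pw : forall n, 0 < 2 ^ n) by (intros; apply pow_lt; lra).
  apply Cmod_eq_0. apply Rle_antisym; [|apply Cmod_ge_0].
  apply Rnot_lt_le. intros Hpos.
  set (K := 2 * (w + h) * (w + h)). assert (HK : 0 < K) by (unfold K; nra).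
  set (e := Cmod (boundary_integral H x0 y0 w h) / (2 * K)).
  assert (He : 0 < e) by (apply Rdiv_lt_0_compat; lra).
  assert (HH : Cmod (boundary_integral H x0 y0 w h) <= e * K).
  2:{ unfold e in HH. replace (Cmod (boundary_integral H x0 y0 w h) / (2 * K) * K)
        with (Cmod (boundary_integral H x0 y0 w h) / 2) in HH by (field; lra). lra. }
  set (P := fun n x y => x0 <= x -> x + w / 2 ^ n <= x0 + w -> y0 <= y ->
    y + h / 2 ^ n <= y0 + h ->
    Cmod (boundary_integral H x y (w / 2 ^ n) (h / 2 ^ n)) <= e * K / (2 ^ n * 2 ^ n)).
  assert (P0 : P 0%nat x0 y0).
  2:{ unfold P in P0. simpl in P0. replace (w / 1) with w in P0 by field.
      replace (h / 1) with h in P0 by field. replace (e * K / (1 * 1)) with (e * K) in P0 by field.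
      apply P0; lra. }
  apply (rectangle_subdivision x0 y0 w h P Hw Hh).
  - intros n x y w' h' P1 P2 P3 P4 Hx Hx' Hy Hy'.
    assert (Ew : w / 2 ^ n = 2 * w') by (unfold w'; simpl; field; apply Rgt_not_eq, pw).
    assert (Eh : h / 2 ^ n = 2 * h') by (unfold h'; simpl; field; apply Rgt_not_eq, pw).
    assert (Hw' : 0 < w') by (apply Rdiv_lt_0_compat; auto).
    assert (Hh' : 0 < h') by (apply Rdiv_lt_0_compat; auto).
    unfold P in P1, P2, P3, P4. fold w' h' in P1, P2, P3, P4.
    rewrite Ew in *. rewrite Eh in *.
    rewrite (boundary_integral_quarters H x0 y0 w h) by (auto; lra).
    replace (e * K / (2 ^ n * 2 ^ n)) with
      (e * K / (2 ^ S n * 2 ^ S n) + e * K / (2 ^ S n * 2 ^ S n)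
       + e * K / (2 ^ S n * 2 ^ S n) + e * K / (2 ^ S n * 2 ^ S n))
      by (simpl; field; apply Rgt_not_eq, pw).
    eapply Rle_trans; [apply Cmod_triangle|]. apply Rplus_le_compat; [|apply P4; lra].
    eapply Rle_trans; [apply Cmod_triangle|]. apply Rplus_le_compat; [|apply P3; lra].
    eapply Rle_trans; [apply Cmod_triangle|]. apply Rplus_le_compat; [apply P1; lra|apply P2; lra].
  - intros p q Hp Hq. destruct (HD p q Hp Hq) as [D HDpq].
    destruct (HDpq e He) as [d [Hd Hd1]]. exists d. split; [auto|].
    intros n x y Hxp Hyq Hlt Hx Hx' Hy Hy'.
    set (w' := w / 2 ^ n) in *. set (h' := h / 2 ^ n) in *.
    assert (Hw' : 0 < w') by (apply Rdiv_lt_0_compat; auto).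
    assert (Hh' : 0 < h') by (apply Rdiv_lt_0_compat; auto).
    replace (e * K / (2 ^ n * 2 ^ n)) with (2 * (w' + h') * (e * (w' + h')))
      by (unfold w', h', K; field; apply Rgt_not_eq, pw).
    apply (boundary_integral_affine_bound H x0 y0 w h x y w' h' (e * (w' + h'))
             (H (p, q) - D * (p, q))%C D); auto; try lra.
    intros u v Hu Hv.
    assert (Hdist : Cmod ((u, v) - (p, q))%C <= w' + h').
    { eapply Rle_trans; [apply Cmod_le_abs|]. simpl.
      apply Rplus_le_compat; apply Rabs_le; lra. }
    replace (H (u, v) - (H (p, q) - D * (p, q) + D * (u, v)))%C
      with (H (u, v) - H (p, q) - D * ((u, v) - (p, q)))%C by ring.
    eapply Rle_trans; [apply Hd1; lra|]. apply Rmult_le_compat_l; lra.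
Qed.

(** * The mean value property *)

Definition cis (t : R) : C := (cos t, sin t).

Definition cexp (u : C) : C := (exp (fst u) * cis (snd u))%C.

Lemma Cmod_cis (t : R) : Cmod (cis t) = 1.
Proof.
  unfold Cmod, cis; simpl. rewrite !Rmult_1_r.
  assert (E := sin2_cos2 t). unfold Rsqr in E.
  replace (cos t * cos t + sin t * sin t) with 1 by lra. apply sqrt_1.
Qed.

Lemma Cmod_cexp (u : C) : Cmod (cexp u) = exp (fst u).
Proof.
  unfold cexp. rewrite Cmod_mult, Cmod_cis, Cmod_R, Rabs_pos_eq, Rmult_1_r; auto.
  left. apply exp_pos.
Qed.

Lemma cexp_plus (u v : C) : cexp (u + v) = (cexp u * cexp v)%C.
Proof.
  destruct u as [x y], v as [x' y']. unfold cexp, cis; simpl. rewrite exp_plus, cos_plus, sin_plus.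
  apply injective_projections; simpl; ring.
Qed.

Lemma derivable_pt_lim_0 (f : R -> R) (l : R) :
  derivable_pt_lim f 0 l -> forall e, 0 < e -> exists d, 0 < d /\
    forall x, Rabs x < d -> Rabs (f x - f 0 - l * x) <= e * Rabs x.
Proof.
  intros H e He. destruct (H e He) as [d Hd]. exists d. split; [apply cond_pos|].
  intros x Hx. destruct (Req_dec x 0) as [->|N].
  - replace (f 0 - f 0 - l * 0) with 0 by ring. rewrite Rabs_R0. lra.
  - specialize (Hd x N Hx). rewrite Rplus_0_l in Hd.
    replace (f x - f 0 - l * x) with (((f x - f 0) / x - l) * x) by (field; auto).
    rewrite Rabs_mult. apply Rmult_le_compat_r; [apply Rabs_pos|lra].
Qed.

Lemma cderiv_cexp_0 : cderiv cexp 0 1.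
Proof.
  intros e He. set (e' := Rmin 1 (e / 8)).
  assert (He' : 0 < e') by (apply Rmin_pos; lra).
  assert (e' <= 1) by apply Rmin_l. assert (e' <= e / 8) by apply Rmin_r.
  assert (De : derivable_pt_lim exp 0 1).
  { rewrite <- exp_0. apply derivable_pt_lim_exp. }
  assert (Ds : derivable_pt_lim sin 0 1).
  { rewrite <- cos_0. apply derivable_pt_lim_sin. }
  assert (Dc : derivable_pt_lim cos 0 0).
  { rewrite <- Ropp_0, <- sin_0 at 2. apply derivable_pt_lim_cos. }
  destruct (derivable_pt_lim_0 _ _ De e' He') as [d1 [Hd1 H1]].
  destruct (derivable_pt_lim_0 _ _ Ds e' He') as [d2 [Hd2 H2]].
  destruct (derivable_pt_lim_0 _ _ Dc e' He') as [d3 [Hd3 H3]].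
  rewrite exp_0 in H1. rewrite sin_0 in H2. rewrite cos_0 in H3.
  exists (Rmin (Rmin 1 (e' / 2)) (Rmin d1 (Rmin d2 d3))). split.
  { repeat apply Rmin_pos; lra. }
  intros [x y] Hw.
  replace ((x, y) - 0)%C with ((x, y) : C) in *
    by (apply injective_projections; simpl; ring).
  replace (cexp 0) with (RtoC 1).
  2:{ unfold cexp, cis; simpl. rewrite exp_0, cos_0, sin_0.
      apply injective_projections; simpl; ring. }
  set (m := Cmod (x, y)) in *.
  assert (Hx : Rabs x <= m) by apply (re_le_Cmod (x, y)).
  assert (Hy : Rabs y <= m).
  { eapply Rle_trans; [|apply Rmax_Cmod]. apply Rmax_r. }
  rmin_bounds (Rmin 1 (e' / 2)) (Rmin d1 (Rmin d2 d3)).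
  rmin_bounds 1 (e' / 2).
  rmin_bounds d1 (Rmin d2 d3).
  rmin_bounds d2 d3.
  specialize (H1 x ltac:(lra)). specialize (H2 y ltac:(lra)). specialize (H3 y ltac:(lra)).
  assert (Hexp : Rabs (exp x - 1) <= e').
  { replace (exp x - 1) with ((exp x - 1 - 1 * x) + x) by ring.
    eapply Rle_trans; [apply Rabs_triang|].
    assert (e' * Rabs x <= 1 * Rabs x) by (apply Rmult_le_compat_r; [apply Rabs_pos|lra]). lra. }
  assert (Hexp' : Rabs (exp x) <= 2).
  { replace (exp x) with ((exp x - 1) + 1) by ring.
    eapply Rle_trans; [apply Rabs_triang|]. rewrite Rabs_R1. lra. }
  replace (cexp (x, y) - 1 - 1 * (x, y))%C with
    (RtoC (exp x) * ((cos y - 1 - 0 * y)%R, (sin y - 0 - 1 * y)%R)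
     + RtoC (exp x - 1) * (Ci * RtoC y) + RtoC (exp x - 1 - 1 * x))%C.
  2:{ unfold cexp, cis. apply injective_projections; simpl; ring. }
  eapply Rle_trans; [apply Cmod_triangle|].
  eapply Rle_trans; [apply Rplus_le_compat_r, Cmod_triangle|].
  rewrite !Cmod_mult, Cmod_Ci, !Cmod_R.
  assert (B := Cmod_le_abs (cos y - 1 - 0 * y) (sin y - 0 - 1 * y)).
  assert (B1 : Cmod ((cos y - 1 - 0 * y)%R, (sin y - 0 - 1 * y)%R) <= 2 * e' * m).
  { eapply Rle_trans; [exact B|]. assert (e' * Rabs y <= e' * m) by nra. lra. }
  assert (B2 : Rabs (exp x) * Cmod ((cos y - 1 - 0 * y)%R, (sin y - 0 - 1 * y)%R)
    <= 2 * (2 * e' * m)).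
  { apply Rmult_le_compat; auto using Rabs_pos, Cmod_ge_0. }
  assert (B3 : Rabs (exp x - 1) * (1 * Rabs y) <= e' * (1 * m)).
  { apply Rmult_le_compat; auto using Rabs_pos; generalize (Rabs_pos y); lra. }
  assert (B4 : e' * Rabs x <= e' * m) by nra.
  assert (B5 : e' * m <= e / 8 * m) by (apply Rmult_le_compat_r; [apply Cmod_ge_0|auto]).
  assert (0 <= e * m) by (apply Rmult_le_pos; [lra|apply Cmod_ge_0]). nra.
Qed.

Lemma cderiv_cexp (u : C) : cderiv cexp u (cexp u).
Proof.
  assert (D : cderiv (fun w => cexp u * cexp (w + - u))%C u
    (0 * cexp (u + - u) + cexp u * (1 * (1 + 0)))%C).
  { apply (cderiv_mult (fun _ => cexp u) (fun w => cexp (w + - u))%C);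
      [apply cderiv_const|].
    apply (cderiv_comp cexp (fun w => w + - u)%C).
    - apply cderiv_plus; [apply cderiv_id|apply cderiv_const].
    - replace (u + - u)%C with (RtoC 0) by ring. apply cderiv_cexp_0. }
  replace (0 * cexp (u + - u) + cexp u * (1 * (1 + 0)))%C with (cexp u) in D by ring.
  refine (cderiv_near _ _ _ _ 1 Rlt_0_1 _ D).
  intros w _. rewrite <- cexp_plus. f_equal. ring.
Qed.

Lemma Rcont_circle (g : C -> C) (a : C) (r t : R) :
  Ccont g (a + r * cis t) -> Rcont (fun s => g (a + r * cis s)%C) t.
Proof.
  intros Hc. assert (E : forall s, cexp (0, s) = cis s).
  { intros s. unfold cexp. simpl fst. simpl snd. rewrite exp_0. ring. }
  assert (H : Rcont (fun s => g (a + r * cexp (0, s))%C) t).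
  { apply (Rcont_vertical (fun u => g (a + r * cexp u)%C)).
    apply (Ccont_comp g (fun u => a + r * cexp u)%C); [|rewrite E; exact Hc].
    apply Ccont_plus; [apply Ccont_const|]. apply Ccont_mult; [apply Ccont_const|].
    apply (cderiv_cont _ _ _ (cderiv_cexp (0, t))). }
  intros e He. destruct (H e He) as [d [Hd Hs]]. exists d. split; [exact Hd|].
  intros s Hst. rewrite <- !E. apply Hs, Hst.
Qed.

Definition circle_integral (g : C -> C) (a : C) (r : R) : C :=
  Cint (fun t => g (a + r * cis t)%C) 0 (2 * PI).

Definition holo_punctured (g : C -> C) (a : C) (r : R) : Prop :=
  forall z, 0 < Cmod (z - a) < r -> exists D, cderiv g z D.

Lemma Cmod_circle (a : C) (r t : R) : 0 <= r -> Cmod (a + r * cis t - a) = r.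
Proof.
  intros Hr. replace (a + r * cis t - a)%C with (RtoC r * cis t)%C by ring.
  rewrite Cmod_mult, Cmod_cis, Cmod_R, Rabs_pos_eq by auto. ring.
Qed.

(** In the coordinate [w = a + exp u] concentric circles become parallel sides
    of a rectangle, whose two other sides cancel by periodicity. *)
Lemma circle_integral_radius (g : C -> C) (a : C) (Rd r1 r2 : R) :
  holo_punctured g a Rd -> 0 < r1 < r2 -> r2 < Rd ->
  circle_integral g a r1 = circle_integral g a r2.
Proof.
  intros Hg Hr H2.
  assert (Hl : ln r1 < ln r2) by (apply ln_increasing; lra).
  assert (G := goursat (fun u => g (a + cexp u)%C) (ln r1) 0 (ln r2 - ln r1) (2 * PI)).
  assert (Hpi := PI_RGT_0).
  assert (E : boundary_integral (fun u => g (a + cexp u)%C) (ln r1) 0 (ln r2 - ln r1) (2 * PI) = 0).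
  { apply G; [lra|lra|]. intros x y Hx Hy.
    assert (Hxx : x <= ln r2) by lra.
    assert (ex : exp x <= r2).
    { rewrite <- (exp_ln r2) by lra. destruct Hxx as [L|L].
      - left. apply exp_increasing, L.
      - right. f_equal. exact L. }
    destruct (Hg (a + cexp (x, y))%C) as [D HD].
    { replace (a + cexp (x, y) - a)%C with (cexp (x, y)) by ring. rewrite Cmod_cexp. simpl.
      split; [apply exp_pos|lra]. }
    eexists. apply (cderiv_comp g); [|exact HD].
    apply cderiv_plus; [apply cderiv_const|apply cderiv_cexp]. }
  unfold boundary_integral in E.
  replace (ln r1 + (ln r2 - ln r1)) with (ln r2) in E by ring. rewrite Rplus_0_l in E.
  assert (Eside : forall t, (cexp (t, 2 * PI) = cexp (t, 0))%R).
  { intros t. unfold cexp, cis; simpl. rewrite cos_2PI, sin_2PI, cos_0, sin_0. reflexivity. }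
  rewrite (Cint_ext (fun t => g (a + cexp (t, (2 * PI)%R))%C) (fun t => g (a + cexp (t, 0))%C))
    in E by (try lra; intros; rewrite Eside; reflexivity).
  assert (Ecirc : forall r, 0 < r ->
    Cint (fun t => g (a + cexp (ln r, t))%C) 0 (2 * PI) = circle_integral g a r).
  { intros r Hr0. apply Cint_ext; [lra|]. intros t _. unfold cexp. simpl.
    rewrite exp_ln by auto. reflexivity. }
  rewrite !Ecirc in E by lra.
  set (B := Cint (fun t => g (a + cexp (t, 0))%C) (ln r1) (ln r2)) in E.
  replace (B + Ci * circle_integral g a r2 - B - Ci * circle_integral g a r1)%C
    with (Ci * (circle_integral g a r2 - circle_integral g a r1))%C in E by ring.
  symmetry. apply Cmod_minus_eq_0. rewrite <- (Rmult_1_l (Cmod _)), <- Cmod_Ci, <- Cmod_mult, E.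
  apply Cmod_0.
Qed.

Lemma holo_punctured_cont (g : C -> C) (a : C) (Rd : R) (z : C) :
  holo_punctured g a Rd -> 0 < Cmod (z - a) < Rd -> Ccont g z.
Proof. intros Hg Hz. destruct (Hg z Hz) as [D HD]. apply (cderiv_cont _ _ _ HD). Qed.

Lemma is_Cint_circle (g : C -> C) (a : C) (r : R) :
  0 < r -> (forall w, Cmod (w - a) = r -> Ccont g w) ->
  is_Cint (fun t => g (a + r * cis t)%C) 0 (2 * PI) (circle_integral g a r).
Proof.
  intros Hr Hc. assert (Hpi := PI_RGT_0). apply Cint_correct; [lra|].
  intros t _. apply Rcont_circle, Hc, Cmod_circle. lra.
Qed.

(** As the radius tends to 0, continuity at the centre gives the value of the
    constant. The form of the hypotheses is dictated by difference quotients,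
    which are only known to be continuous at their base point. *)
Lemma mean_value (g : C -> C) (a : C) (Rd r : R) :
  holo_punctured g a Rd -> Ccont g a -> 0 < r < Rd ->
  circle_integral g a r = (RtoC (2 * PI) * g a)%C.
Proof.
  intros Hg Hc Hr. assert (Hpi := PI_RGT_0).
  apply Cmod_minus_eq_0. apply Rle_antisym; [|apply Cmod_ge_0].
  apply Rnot_lt_le. intros Hpos.
  set (e := Cmod (circle_integral g a r - RtoC (2 * PI) * g a) / (4 * PI)).
  assert (He : 0 < e) by (apply Rdiv_lt_0_compat; lra).
  destruct (Hc e He) as [d [Hd H1]].
  set (s := Rmin (r / 2) (d / 2)).
  assert (Hs : 0 < s) by (apply Rmin_pos; lra).
  assert (s <= r / 2) by apply Rmin_l. assert (s <= d / 2) by apply Rmin_r.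
  assert (B : Cmod (circle_integral g a s - RtoC (2 * PI - 0) * g a) <= (2 * PI - 0) * e).
  { apply (is_Cint_bound (fun t => g (a + s * cis t) - g a)%C); [lra| |].
    - intros t _. left. apply H1. rewrite Cmod_circle; lra.
    - apply is_Cint_minus; [|apply is_Cint_const]. apply is_Cint_circle; [auto|].
      intros w Hw. apply (holo_punctured_cont g a Rd); auto. lra. }
  rewrite (circle_integral_radius g a Rd s r) in B by (auto; lra).
  rewrite Rminus_0_r in B. unfold e in B.
  replace (2 * PI * (Cmod (circle_integral g a r - RtoC (2 * PI) * g a) / (4 * PI)))
    with (Cmod (circle_integral g a r - RtoC (2 * PI) * g a) / 2) in B by (field; lra).
  lra.
Qed.

Lemma mean_bound (g : C -> C) (a : C) (Rd r M : R) :
  holo_punctured g a Rd -> Ccont g a -> 0 < r < Rd ->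
  (forall w, Cmod (w - a) = r -> Cmod (g w) <= M) -> Cmod (g a) <= M.
Proof.
  intros Hg Hc Hr HM. assert (Hpi := PI_RGT_0).
  assert (E := mean_value g a Rd r Hg Hc Hr).
  assert (B : Cmod (circle_integral g a r) <= (2 * PI - 0) * M).
  { apply (is_Cint_bound (fun t => g (a + r * cis t)%C)); [lra| |].
    - intros t _. apply HM, Cmod_circle. lra.
    - apply is_Cint_circle; [lra|]. intros w Hw. apply (holo_punctured_cont g a Rd); auto. lra. }
  rewrite E, Cmod_mult, Cmod_R, Rabs_pos_eq in B by lra.
  apply Rmult_le_reg_l with (2 * PI); lra.
Qed.

(** * Difference quotients of holomorphic functions are holomorphic *)

Lemma Ccont_minus (f g : C -> C) (z : C) :
  Ccont f z -> Ccont g z -> Ccont (fun w => f w - g w)%C z.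
Proof.
  intros Hf Hg. apply (Ccont_near (fun w => f w + (- (1)) * g w)%C _ z 1); [lra|intros; ring|].
  apply Ccont_plus; [auto|]. apply Ccont_mult; auto using Ccont_const.
Qed.

Lemma cderiv_minus (f g : C -> C) (z a b : C) :
  cderiv f z a -> cderiv g z b -> cderiv (fun w => f w - g w)%C z (a - b).
Proof.
  rewrite !cderiv_is_derive. apply (is_derive_minus (V := C_NormedModule)).
Qed.

Lemma cderiv_C_derive (g : C -> C) (z D : C) : cderiv g z D -> cderiv g z (C_derive g z).
Proof.
  intros H. apply cderiv_is_derive in H. rewrite (is_C_derive_unique g z D H).
  apply cderiv_is_derive, H.
Qed.

Lemma disc_convex (a z w : C) (r t : R) :
  0 <= t <= 1 -> Cmod (z - a) < r -> Cmod (w - a) < r -> Cmod (w + t * (z - w) - a) < r.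
Proof.
  intros Ht Hz Hw.
  replace (w + t * (z - w) - a)%C with (RtoC (1 - t) * (w - a) + RtoC t * (z - a))%C
    by (rewrite RtoC_minus; ring).
  eapply Rle_lt_trans; [apply Cmod_triangle|]. rewrite !Cmod_mult, !Cmod_R, !Rabs_pos_eq by lra.
  destruct (Req_dec t 0) as [->|N]; [lra|].
  apply Rle_lt_trans with ((1 - t) * r + t * Cmod (z - a)).
  - apply Rplus_le_compat_r, Rmult_le_compat_l; lra.
  - assert (t * Cmod (z - a) < t * r) by (apply Rmult_lt_compat_l; lra). lra.
Qed.

Lemma derivable_along_segment (g : C -> C) (u w k D : C) (t : R) :
  cderiv g (w + t * k) D ->
  derivable_pt_lim (fun s => Re (u * g (w + s * k)))%C t (Re (u * (D * k)))%C.
Proof.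
  intros H e He. set (p := (w + t * k)%C) in *.
  assert (Hc : Ccont (fun v => u * (slope g p D v * k))%C p).
  { apply Ccont_mult; [apply Ccont_const|].
    apply Ccont_mult; [apply cderiv_slope, H|apply Ccont_const]. }
  destruct (Hc e He) as [d [Hd H1]]. rewrite slope_center in H1.
  assert (Hk := Cmod_ge_0 k).
  assert (Hd' : 0 < d / (Cmod k + 1)) by (apply Rdiv_lt_0_compat; lra).
  exists (mkposreal _ Hd'). intros h Hh Hhd. simpl pos in Hhd. cbv beta.
  assert (Ep : (w + (t + h)%R * k)%C = (p + h * k)%C) by (unfold p; rewrite RtoC_plus; ring).
  rewrite Ep. assert (El : (p + h * k - p)%C = (h * k)%C) by ring.
  assert (Hlt : Cmod (p + h * k - p) < d).
  { rewrite El, Cmod_mult, Cmod_R. assert (Gh := Rabs_pos h).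
    replace d with (d / (Cmod k + 1) * (Cmod k + 1)) by (field; lra).
    apply Rle_lt_trans with (Rabs h * (Cmod k + 1)); [nra|]. apply Rmult_lt_compat_r; lra. }
  specialize (H1 _ Hlt). rewrite (slope_spec g p D (p + h * k)), El.
  set (S := slope g p D (p + h * k)) in *.
  replace ((Re (u * (g p + S * (h * k)))%C - Re (u * g p)%C) / h - Re (u * (D * k))%C)
    with (Re (u * (S * k) - u * (D * k))%C) by (simpl; field; exact Hh).
  eapply Rle_lt_trans; [apply re_le_Cmod|exact H1].
Qed.

(** The mean value inequality. Projecting [g z - g w] on its own direction keeps
    the constant. *)
Lemma Cmean_value_inequality (g d : C -> C) (M : R) (z w : C) :
  (forall t : R, 0 <= t <= 1 ->
    cderiv g (w + t * (z - w)) (d (w + t * (z - w)))%C /\ Cmod (d (w + t * (z - w)))%C <= M) ->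
  Cmod (g z - g w) <= M * Cmod (z - w).
Proof.
  intros H. destruct (Ceq_dec (g z) (g w)) as [E|N].
  { rewrite E, Cmod_self_minus. apply Rmult_le_pos; [|apply Cmod_ge_0].
    eapply Rle_trans; [apply Cmod_ge_0|]. apply (H 0). lra. }
  assert (P := Cmod_minus_pos _ _ N). set (m := Cmod (g z - g w)) in *.
  set (u := (Cconj (g z - g w) / RtoC m)%C).
  assert (Hu : Cmod u = 1).
  { unfold u. rewrite Cmod_div, Cmod_conj, Cmod_R, Rabs_pos_eq by
      (try (intros E; apply (f_equal fst) in E; simpl in E); lra). fold m. field. lra. }
  assert (Eu : (u * (g z - g w))%C = RtoC m).
  { unfold u. transitivity (RtoC (m ^ 2) / RtoC m)%C.
    - unfold m. rewrite Cmod2_conj. unfold Cdiv. ring.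
    - rewrite <- RtoC_div by lra. f_equal. field. lra. }
  destruct (MVT_cor2 (fun s => Re (u * g (w + s * (z - w))))%C
     (fun t => Re (u * (d (w + t * (z - w)) * (z - w))))%C 0 1 Rlt_0_1) as [c [Hc Hc']].
  { intros c Hc. apply derivable_along_segment, H, Hc. }
  replace (w + 1 * (z - w))%C with z in Hc by ring.
  replace (w + 0 * (z - w))%C with w in Hc by ring.
  assert (Em : m = Re (u * g z) - Re (u * g w)).
  { transitivity (Re (u * (g z - g w)))%C; [rewrite Eu; reflexivity|]. simpl. ring. }
  rewrite Em, Hc, Rminus_0_r, Rmult_1_r.
  eapply Rle_trans; [apply Rle_abs|]. eapply Rle_trans; [apply re_le_Cmod|].
  rewrite !Cmod_mult, Hu, Rmult_1_l. apply Rmult_le_compat_r; [apply Cmod_ge_0|]. apply H. lra.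
Qed.

Lemma holo_sub (g : C -> C) (a z : C) (r s : R) :
  holo g a r -> Cmod (z - a) + s <= r -> holo g z s.
Proof.
  intros Hg Hs w Hw. apply Hg. eapply Rle_lt_trans; [apply (Cmod_triangle_minus w z a)|]. lra.
Qed.

Lemma slope_holo_punctured (g : C -> C) (z D : C) (s : R) :
  holo g z s -> holo_punctured (slope g z D) z s.
Proof.
  intros Hg w Hw. destruct (Hg w) as [d Hd]; [lra|].
  apply (cderiv_slope_off g z D w d); [apply Cneq_of_pos; lra|exact Hd].
Qed.

Lemma Cmod_slope_circle (g : C -> C) (z D w : C) (r M : R) :
  0 < r -> Cmod (w - z) = r -> Cmod (g w - g z) <= M -> Cmod (slope g z D w) <= M / r.
Proof.
  intros Hr Hw HM. rewrite slope_off by (apply Cneq_of_pos; lra).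
  rewrite Cmod_div, Hw by (apply Cmod_gt_0; lra).
  apply Rmult_le_compat_r; [left; apply Rinv_0_lt_compat|]; auto.
Qed.

(** The derivative is the value at the centre of the difference quotient, whose
    size on the circle is known. *)
Lemma cauchy_estimate (g : C -> C) (z D : C) (s r M : R) :
  holo g z s -> 0 < r < s -> cderiv g z D ->
  (forall w, Cmod (w - z) = r -> Cmod (g w - g z) <= M) -> Cmod D <= M / r.
Proof.
  intros Hg Hr HD HM. rewrite <- (slope_center g z D).
  apply (mean_bound (slope g z D) z s r).
  - apply slope_holo_punctured, Hg.
  - apply cderiv_slope, HD.
  - exact Hr.
  - intros w Hw. apply Cmod_slope_circle; auto. lra.
Qed.

(** The increments [r * cis t] do not depend on [z]: on the left [z] occurs only
    through values of [g], so that regularity of [g] passes to its derivative. *)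
Lemma derivative_mean (g : C -> C) (z : C) (s r : R) :
  holo g z s -> 0 < r < s ->
  is_Cint (fun t => (g (z + r * cis t) - g z) / (r * cis t))%C 0 (2 * PI)
    (RtoC (2 * PI) * C_derive g z)%C.
Proof.
  intros Hg Hr. assert (Hpi := PI_RGT_0).
  destruct (Hg z) as [D HD]; [rewrite Cmod_self_minus; lra|]. apply cderiv_C_derive in HD.
  set (D' := C_derive g z) in *.
  assert (Hp := slope_holo_punctured g z D' s Hg).
  rewrite <- (slope_center g z D') at 1. rewrite <- (mean_value _ z s r Hp); auto.
  2:{ apply cderiv_slope, HD. }
  apply (is_Cint_ext (fun t => slope g z D' (z + r * cis t)%C)); [lra| |].
  - intros t _. rewrite slope_off.
    + f_equal. ring.
    + apply Cneq_of_pos. rewrite Cmod_circle; lra.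
  - apply is_Cint_circle; [lra|]. intros w Hw. apply (holo_punctured_cont _ z s); auto. lra.
Qed.

Lemma Cmod_2PI_le (z : C) (M : R) : Cmod (RtoC (2 * PI) * z) <= (2 * PI - 0) * M -> Cmod z <= M.
Proof.
  assert (Hpi := PI_RGT_0). rewrite Cmod_mult, Cmod_R, Rabs_pos_eq by lra.
  intros H. apply Rmult_le_reg_l with (2 * PI); lra.
Qed.

Lemma Cmod_rcis (r t : R) : 0 < r -> Cmod (r * cis t)%C = r.
Proof. intros Hr. rewrite Cmod_mult, Cmod_cis, Cmod_R, Rabs_pos_eq; lra. Qed.

Lemma Cdiv_rcis_bound (x : C) (r t M : R) : 0 < r -> Cmod x <= M -> Cmod (x / (r * cis t))%C <= M / r.
Proof.
  intros Hr HM. rewrite Cmod_div, Cmod_rcis; auto.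
  - apply Rmult_le_compat_r; [left; apply Rinv_0_lt_compat; auto|auto].
  - apply Cmod_gt_0. rewrite Cmod_rcis; auto.
Qed.

(** Near [a] the derivative of a holomorphic function is Lipschitz, because it is
    an average of difference quotients with the fixed increments [s * cis t]. *)
Lemma holo_derivative_lipschitz (g : C -> C) (a : C) (r : R) :
  0 < r -> holo g a r -> exists s K, 0 < s /\ 0 <= K /\ 4 * s <= r /\
    forall z w, Cmod (z - a) < 2 * s -> Cmod (w - a) < 2 * s ->
      Cmod (C_derive g z - C_derive g w) <= K * Cmod (z - w).
Proof.
  intros Hr Hg.
  destruct (Hg a) as [D HD]; [rewrite Cmod_self_minus; auto|].
  destruct (cderiv_cont _ _ _ HD 1 Rlt_0_1) as [d [Hd Hd1]].
  set (M := Cmod (g a) + 1). set (s := Rmin (r / 4) (d / 4)).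
  assert (Hs : 0 < s) by (apply Rmin_pos; lra).
  assert (s <= r / 4) by apply Rmin_l. assert (s <= d / 4) by apply Rmin_r.
  assert (HM : forall z, Cmod (z - a) < 4 * s -> Cmod (g z) <= M).
  { intros z Hz. assert (T := Cmod_triangle_rev (g z) (g a)).
    specialize (Hd1 z ltac:(lra)). unfold M. lra. }
  assert (M0 : 0 <= M) by (unfold M; generalize (Cmod_ge_0 (g a)); lra).
  set (L := (2 * M) / s). assert (HL : 0 <= L) by (apply Rdiv_le_0_compat; lra).
  assert (Hder : forall z, Cmod (z - a) < 4 * s -> cderiv g z (C_derive g z)).
  { intros z Hz. destruct (Hg z) as [E HE]; [lra|]. apply (cderiv_C_derive _ _ _ HE). }
  assert (HLb : forall z, Cmod (z - a) < 3 * s -> Cmod (C_derive g z) <= L).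
  { intros z Hz. apply (cauchy_estimate g z _ (4 * s - Cmod (z - a)) s).
    - apply (holo_sub g a z r); auto. lra.
    - lra.
    - apply Hder. lra.
    - intros w Hw.
      assert (T := Cmod_triangle_minus w z a).
      assert (B1 := HM w ltac:(lra)). assert (B2 := HM z ltac:(lra)).
      unfold Cminus. eapply Rle_trans; [apply Cmod_triangle|]. rewrite Cmod_opp. lra. }
  assert (HLip : forall z w, Cmod (z - a) < 3 * s -> Cmod (w - a) < 3 * s ->
    Cmod (g z - g w) <= L * Cmod (z - w)).
  { intros z w Hz Hw. apply (Cmean_value_inequality g (C_derive g)). intros t Ht.
    assert (Hin := disc_convex a z w (3 * s) t Ht Hz Hw). split.
    - apply Hder. lra.
    - apply HLb, Hin. }
  exists s, (2 * L / s). split; [auto|]. split; [apply Rdiv_le_0_compat; lra|]. split; [lra|].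
  intros z w Hz Hw. apply Cmod_2PI_le.
  replace (RtoC (2 * PI) * (C_derive g z - C_derive g w))%C
    with (RtoC (2 * PI) * C_derive g z - RtoC (2 * PI) * C_derive g w)%C by ring.
  eapply is_Cint_bound.
  3:{ apply is_Cint_minus.
      - apply (derivative_mean g z (4 * s - Cmod (z - a)) s); [|lra].
        apply (holo_sub g a z r); auto. lra.
      - apply (derivative_mean g w (4 * s - Cmod (w - a)) s); [|lra].
        apply (holo_sub g a w r); auto. lra. }
  - generalize PI_RGT_0. lra.
  - intros t _. cbv beta.
    replace ((g (z + s * cis t) - g z) / (s * cis t) - (g (w + s * cis t) - g w) / (s * cis t))%C
      with (((g (z + s * cis t) - g (w + s * cis t)) - (g z - g w)) / (s * cis t))%C
      by (unfold Cdiv; ring).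
    replace (2 * L / s * Cmod (z - w)) with (2 * L * Cmod (z - w) / s) by (field; lra).
    apply Cdiv_rcis_bound; [auto|].
    assert (Hcz : Cmod (z + s * cis t - a) < 3 * s).
    { eapply Rle_lt_trans; [apply (Cmod_triangle_minus _ z)|]. rewrite Cmod_circle; lra. }
    assert (Hcw : Cmod (w + s * cis t - a) < 3 * s).
    { eapply Rle_lt_trans; [apply (Cmod_triangle_minus _ w)|]. rewrite Cmod_circle; lra. }
    assert (B1 := HLip _ _ Hcz Hcw).
    assert (B2 := HLip z w ltac:(lra) ltac:(lra)).
    replace (z + s * cis t - (w + s * cis t))%C with (z - w)%C in B1 by ring.
    unfold Cminus at 1. eapply Rle_trans; [apply Cmod_triangle|]. rewrite Cmod_opp. lra.
Qed.

(** Away from [a] this is the quotient rule. At [a] it amounts to a Taylor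
    expansion of order two, hence to differentiability of the derivative; the
    latter follows from [derivative_mean] and the Lipschitz bound. *)
Lemma holo_slope (g : C -> C) (a D : C) (r : R) :
  0 < r -> holo g a r -> cderiv g a D -> holo (slope g a D) a r.
Proof.
  intros Hr Hg HD z Hz. destruct (Ceq_dec z a) as [->|N].
  2:{ destruct (Hg z Hz) as [d Hd]. apply (cderiv_slope_off g a D z d N Hd). }
  assert (Hpi := PI_RGT_0).
  destruct (holo_derivative_lipschitz g a r Hr Hg) as [s [K [Hs [HK [Hsr HLip]]]]].
  assert (HDe : C_derive g a = D).
  { apply (is_C_derive_unique g a D). apply cderiv_is_derive, HD. }
  assert (Hder : forall w, Cmod (w - a) < 4 * s -> cderiv g w (C_derive g w)).
  { intros w Hw. destruct (Hg w) as [E HE]; [lra|]. apply (cderiv_C_derive _ _ _ HE). }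
  (* First order Taylor expansion, uniform in the base point. *)
  assert (HTay : forall w v, Cmod (w - a) < 2 * s -> Cmod (v - a) < 2 * s ->
    Cmod (g v - g w - C_derive g w * (v - w)) <= K * Cmod (v - w) * Cmod (v - w)).
  { intros w v Hw Hv.
    replace (g v - g w - C_derive g w * (v - w))%C
      with ((g v - C_derive g w * v) - (g w - C_derive g w * w))%C by ring.
    apply (Cmean_value_inequality (fun u => g u - C_derive g w * u)%C
      (fun u => C_derive g u - (0 * u + C_derive g w * 1))%C). intros t Ht.
    assert (Hin := disc_convex a v w (2 * s) t Ht Hv Hw). split.
    - apply cderiv_minus; [apply Hder; lra|].
      apply (cderiv_mult (fun _ => C_derive g w) (fun u => u)); [apply cderiv_const|apply cderiv_id].
    - cbv beta. set (u := (w + t * (v - w))%C) in *.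
      replace (C_derive g u - (0 * u + C_derive g w * 1))%C
        with (C_derive g u - C_derive g w)%C by ring.
      eapply Rle_trans; [apply HLip; auto|]. apply Rmult_le_compat_l; [auto|].
      replace (u - w)%C with (RtoC t * (v - w))%C by (unfold u; ring).
      rewrite Cmod_mult, Cmod_R, Rabs_pos_eq by lra.
      rewrite <- (Rmult_1_l (Cmod (v - w))) at 2. apply Rmult_le_compat_r; [apply Cmod_ge_0|lra]. }
  assert (Hdc : forall w, Cmod (w - a) < 2 * s -> Ccont (C_derive g) w).
  { intros w Hw e He. exists (Rmin (2 * s - Cmod (w - a)) (e / (K + 1))). split.
    { apply Rmin_pos; [lra|]. apply Rdiv_lt_0_compat; lra. }
    intros v Hv. assert (V1 := Rlt_le_trans _ _ _ Hv (Rmin_l _ _)).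
    assert (V2 := Rlt_le_trans _ _ _ Hv (Rmin_r _ _)).
    assert (T := Cmod_triangle_minus v w a).
    eapply Rle_lt_trans; [apply HLip; lra|].
    apply Rle_lt_trans with ((K + 1) * Cmod (v - w)); [generalize (Cmod_ge_0 (v - w)); nra|].
    replace e with ((K + 1) * (e / (K + 1))) by (field; lra). apply Rmult_lt_compat_l; lra. }
  (* The second derivative, as the average of the difference quotients of the first. *)
  set (J := circle_integral (fun w => (C_derive g w - C_derive g a) / (w - a))%C a s).
  assert (HJ : is_Cint (fun t => (C_derive g (a + s * cis t) - C_derive g a) / (s * cis t))%C
    0 (2 * PI) J).
  { apply (is_Cint_ext (fun t => (fun w => (C_derive g w - C_derive g a) / (w - a))%C
      (a + s * cis t)%C)); [lra| |].
    - intros t _. cbv beta. f_equal. ring.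
    - apply is_Cint_circle; [auto|]. intros w Hw. unfold Cdiv.
      apply Ccont_mult.
      + apply Ccont_minus; [apply Hdc; lra|apply Ccont_const].
      + apply Ccont_inv; [apply Ccont_minus; [apply Ccont_id|apply Ccont_const]|].
        apply Cmod_gt_0. lra. }
  set (E := (J / RtoC (2 * PI))%C).
  assert (H2pi : RtoC (2 * PI) <> 0).
  { intros H0. apply (f_equal fst) in H0. simpl in H0. lra. }
  assert (HE : forall v, Cmod (v - a) < s ->
    Cmod (C_derive g v - C_derive g a - E * (v - a)) <= (2 * K / s) * Cmod (v - a) * Cmod (v - a)).
  { intros v Hv. apply Cmod_2PI_le.
    replace (RtoC (2 * PI) * (C_derive g v - C_derive g a - E * (v - a)))%C
      with (RtoC (2 * PI) * C_derive g v - RtoC (2 * PI) * C_derive g a - (v - a) * J)%C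
      by (unfold E; field; exact H2pi).
    eapply is_Cint_bound.
    3:{ apply is_Cint_minus; [|apply is_Cint_scal, HJ]. apply is_Cint_minus.
        - apply (derivative_mean g v (4 * s - Cmod (v - a)) s); [|lra].
          apply (holo_sub g a v r); auto. lra.
        - apply (derivative_mean g a (4 * s) s); [|lra].
          apply (holo_sub g a a r); auto. rewrite Cmod_self_minus. lra. }
    { lra. }
    intros t _. cbv beta. set (c := (s * cis t)%C).
    replace ((g (v + c) - g v) / c - (g (a + c) - g a) / c
             - (v - a) * ((C_derive g (a + c) - C_derive g a) / c))%C
      with (((g (v + c) - g (a + c) - C_derive g (a + c) * (v + c - (a + c)))
             + - (g v - g a - C_derive g a * (v - a))) / c)%C by (unfold Cdiv; ring).
    replace (2 * K / s * Cmod (v - a) * Cmod (v - a))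
      with (2 * K * Cmod (v - a) * Cmod (v - a) / s) by (field; lra).
    apply Cdiv_rcis_bound; [auto|].
    eapply Rle_trans; [apply Cmod_triangle|]. rewrite Cmod_opp.
    assert (Hc1 : Cmod (v + c - a) < 2 * s).
    { eapply Rle_lt_trans; [apply (Cmod_triangle_minus _ v)|]. unfold c.
      rewrite Cmod_circle; lra. }
    assert (Hc2 : Cmod (a + c - a) < 2 * s) by (unfold c; rewrite Cmod_circle; lra).
    assert (B1 := HTay (a + c)%C (v + c)%C Hc2 Hc1).
    assert (B2 := HTay a v ltac:(rewrite Cmod_self_minus; lra) ltac:(lra)).
    replace (v + c - (a + c))%C with (v - a)%C in B1 |- * by ring. lra. }
  assert (H2 : RtoC 2 <> 0) by (intros H0; apply (f_equal fst) in H0; simpl in H0; lra).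
  assert (Hrem : forall w, Cmod (w - a) < s ->
    Cmod (g w - g a - D * (w - a) - E / 2 * ((w - a) * (w - a)))
      <= (2 * K / s) * Cmod (w - a) * Cmod (w - a) * Cmod (w - a)).
  { intros w Hw.
    pose (f := fun u => (g u - D * (u - a) - E / 2 * ((u - a) * (u - a)))%C).
    replace (g w - g a - D * (w - a) - E / 2 * ((w - a) * (w - a)))%C with (f w - f a)%C
      by (unfold f; ring).
    apply (Cmean_value_inequality f (fun u => C_derive g u - C_derive g a - E * (u - a))%C).
    intros t Ht. rewrite HDe.
    assert (Ha : Cmod (a - a) < s) by (rewrite Cmod_self_minus; lra).
    assert (Hin := disc_convex a w a s t Ht Hw Ha).
    set (u := (a + t * (w - a))%C) in *. split.
    - unfold f.
      replace (C_derive g u - D - E * (u - a))%C with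
        (C_derive g u - (0 * (u - a) + D * (1 - 0))
         - (0 * ((u - a) * (u - a)) + E / 2 * ((1 - 0) * (u - a) + (u - a) * (1 - 0))))%C
        by (field; exact H2).
      assert (Dl : cderiv (fun v => v - a)%C u (1 - 0)%C).
      { apply cderiv_minus; [apply cderiv_id|apply cderiv_const]. }
      apply cderiv_minus; [apply cderiv_minus; [apply Hder; lra|]|].
      + apply (cderiv_mult (fun _ => D) (fun v => v - a)%C); [apply cderiv_const|exact Dl].
      + apply (cderiv_mult (fun _ => (E / 2)%C) (fun v => (v - a) * (v - a))%C);
          [apply cderiv_const|].
        apply (cderiv_mult (fun v => v - a)%C (fun v => v - a)%C); exact Dl.
    - rewrite <- HDe. eapply Rle_trans; [apply HE, Hin|].
      assert (Hle : Cmod (u - a) <= Cmod (w - a)).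
      { unfold u. replace (a + t * (w - a) - a)%C with (RtoC t * (w - a))%C by ring.
        rewrite Cmod_mult, Cmod_R, Rabs_pos_eq by lra.
        rewrite <- (Rmult_1_l (Cmod (w - a))) at 2.
        apply Rmult_le_compat_r; [apply Cmod_ge_0|lra]. }
      assert (Hks : 0 <= 2 * K / s) by (apply Rdiv_le_0_compat; lra).
      assert (G0 := Cmod_ge_0 (u - a)).
      apply Rmult_le_compat; auto.
      + apply Rmult_le_pos; auto.
      + apply Rmult_le_compat_l; auto. }
  exists (E / 2)%C. intros e He.
  assert (Hks : 0 <= 2 * K / s) by (apply Rdiv_le_0_compat; lra).
  exists (Rmin s (e / (2 * K / s + 1))). split.
  { apply Rmin_pos; [auto|]. apply Rdiv_lt_0_compat; lra. }
  intros w Hw. rewrite slope_center.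
  destruct (Ceq_dec w a) as [->|Nw].
  { rewrite slope_center.
    replace (D - D - E / 2 * (a - a))%C with (RtoC 0) by (unfold Cdiv; ring).
    rewrite Cmod_0, Cmod_self_minus. lra. }
  rewrite slope_off by auto.
  assert (W1 := Rlt_le_trans _ _ _ Hw (Rmin_l _ _)).
  assert (W2 := Rlt_le_trans _ _ _ Hw (Rmin_r _ _)).
  assert (Pw := Cmod_minus_pos w a Nw).
  replace ((g w - g a) / (w - a) - D - E / 2 * (w - a))%C
    with ((g w - g a - D * (w - a) - E / 2 * ((w - a) * (w - a))) / (w - a))%C
    by (field; repeat split; auto using Cminus_neq_0).
  rewrite Cmod_div by (apply Cminus_neq_0, Nw).
  apply Rmult_le_reg_r with (Cmod (w - a)); [auto|]. unfold Rdiv at 1.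
  rewrite Rmult_assoc, Rinv_l, Rmult_1_r by lra.
  eapply Rle_trans; [apply Hrem, W1|].
  apply Rmult_le_compat_r; [lra|]. apply Rmult_le_compat_r; [lra|].
  apply Rle_trans with ((2 * K / s + 1) * Cmod (w - a)); [nra|].
  replace e with ((2 * K / s + 1) * (e / (2 * K / s + 1))) by (field; lra).
  apply Rmult_le_compat_l; lra.
Qed.

(** * Zeros and limits of holomorphic functions *)

Lemma holo_ext (f g : C -> C) (a : C) (r : R) :
  (forall w, Cmod (w - a) < r -> f w = g w) -> holo f a r -> holo g a r.
Proof.
  intros E Hf z Hz. destruct (Hf z Hz) as [D HD]. exists D.
  apply (cderiv_near f g z D (r - Cmod (z - a))); [lra| |exact HD].
  intros w Hw. apply E. assert (T := Cmod_triangle_minus w z a). lra.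
Qed.

Lemma holo_const (c a : C) (r : R) : holo (fun _ => c) a r.
Proof. intros z _. eexists. apply cderiv_const. Qed.

Lemma holo_minus_const (c a : C) (r : R) : holo (fun w => w - c)%C a r.
Proof. intros z _. eexists. apply cderiv_minus; [apply cderiv_id|apply cderiv_const]. Qed.

Lemma holo_minus (f g : C -> C) (a : C) (r : R) :
  holo f a r -> holo g a r -> holo (fun w => f w - g w)%C a r.
Proof.
  intros Hf Hg z Hz. destruct (Hf z Hz) as [D HD], (Hg z Hz) as [D' HD'].
  eexists. apply cderiv_minus; eassumption.
Qed.

Lemma holo_mult (f g : C -> C) (a : C) (r : R) :
  holo f a r -> holo g a r -> holo (fun w => f w * g w)%C a r.
Proof.
  intros Hf Hg z Hz. destruct (Hf z Hz) as [D HD], (Hg z Hz) as [D' HD'].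
  eexists. apply cderiv_mult; eassumption.
Qed.

Lemma holo_pow (f : C -> C) (a : C) (r : R) (n : nat) :
  holo f a r -> holo (fun w => f w ^ n)%C a r.
Proof.
  intros Hf. induction n as [|n IH]; simpl; [apply holo_const|].
  apply (holo_mult f (fun w => f w ^ n)%C); auto.
Qed.

Lemma holo_inv (f : C -> C) (a : C) (r : R) :
  holo f a r -> (forall w, Cmod (w - a) < r -> f w <> 0) -> holo (fun w => / f w)%C a r.
Proof.
  intros Hf Hn z Hz. destruct (Hf z Hz) as [D HD]. eexists. apply cderiv_inv; eauto.
Qed.

Lemma holo_cont (f : C -> C) (a z : C) (r : R) : holo f a r -> Cmod (z - a) < r -> Ccont f z.
Proof. intros Hf Hz. destruct (Hf z Hz) as [D HD]. apply (cderiv_cont _ _ _ HD). Qed.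

Lemma holo_is_punctured (f : C -> C) (a : C) (r : R) : holo f a r -> holo_punctured f a r.
Proof. intros Hf z Hz. apply Hf. lra. Qed.

Lemma holo_le (f : C -> C) (a : C) (r s : R) : holo f a r -> s <= r -> holo f a s.
Proof. intros Hf Hs z Hz. apply Hf. lra. Qed.

Lemma holo_mean_bound (g : C -> C) (a : C) (Rd r M : R) :
  holo g a Rd -> 0 < r < Rd ->
  (forall w, Cmod (w - a) = r -> Cmod (g w) <= M) -> Cmod (g a) <= M.
Proof.
  intros Hg Hr. apply (mean_bound g a Rd r M); auto.
  - apply holo_is_punctured, Hg.
  - apply (holo_cont g a a Rd Hg). rewrite Cmod_self_minus. lra.
Qed.

(** Riemann's theorem on removable singularities: [(w - a) * h w] is
    differentiable at [a], and [h] is its difference quotient. *)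
Lemma removable_singularity (h : C -> C) (a : C) (r : R) :
  0 < r -> holo_punctured h a r -> Ccont h a -> holo h a r.
Proof.
  intros Hr Hh Hc. set (k := fun w => ((w - a) * h w)%C).
  assert (Ek : forall w, (k w = k a + h w * (w - a))%C) by (intros w; unfold k; ring).
  assert (Hk : cderiv k a (h a)) by (apply cderiv_of_slope; auto).
  apply (holo_ext (slope k a (h a))).
  - intros w _. destruct (Ceq_dec w a) as [->|N]; [apply slope_center|].
    rewrite slope_off by auto. rewrite (Ek w). field. apply Cminus_neq_0, N.
  - apply holo_slope; auto. intros z Hz. destruct (Ceq_dec z a) as [->|N]; [eauto|].
    destruct (Hh z) as [D HD]; [split; [apply Cmod_minus_pos, N|auto]|].
    eexists. apply cderiv_mult; [|exact HD].
    apply cderiv_minus; [apply cderiv_id|apply cderiv_const].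
Qed.

Lemma holo_factor (g : C -> C) (a c : C) (r : R) :
  holo g a r -> Cmod (c - a) < r -> g c = 0 ->
  exists g1, holo g1 a r /\ forall w, g w = ((w - c) * g1 w)%C.
Proof.
  intros Hg Hc Hz. destruct (Hg c Hc) as [D HD]. exists (slope g c D). split.
  - intros z Hza. destruct (Ceq_dec z c) as [->|N].
    + apply (holo_slope g c D (r - Cmod (c - a))); auto; try lra.
      * apply (holo_sub g a c r); auto. lra.
      * rewrite Cmod_self_minus. lra.
    + destruct (Hg z Hza) as [d Hd]. apply (cderiv_slope_off g c D z d N Hd).
  - intros w. rewrite (slope_spec g c D w), Hz at 1. ring.
Qed.

(** If [g] is divisible by every power of [w - a], then the cofactors, controlled
    on circles away from [a], bound [g] by a geometric sequence. *)
Lemma vanishing_order (g : C -> C) (a : C) (r : R) :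
  0 < r -> holo g a r ->
  (exists m k, holo k a r /\ k a <> 0 /\ forall w, g w = ((w - a) ^ m * k w)%C) \/
  (exists s, 0 < s /\ forall w, Cmod (w - a) < s -> g w = 0).
Proof.
  intros Hr Hg.
  destruct (classic (exists m k, holo k a r /\ k a <> 0 /\ forall w, g w = ((w - a) ^ m * k w)%C))
    as [Hy|Hn]; [left; exact Hy|right].
  assert (Hall : forall m, exists k, holo k a r /\ forall w, g w = ((w - a) ^ m * k w)%C).
  { induction m as [|m [k [Hk Ek]]].
    - exists g. split; [auto|]. intros w. simpl. ring.
    - destruct (Ceq_dec (k a) 0) as [E0|N0].
      + destruct (holo_factor k a a r Hk) as [k1 [Hk1 Ek1]]; auto.
        { rewrite Cmod_self_minus. auto. }
        exists k1. split; [auto|]. intros w. rewrite Ek, Ek1. simpl. ring.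
      + exfalso. apply Hn. exists m, k. auto. }
  assert (Ha : Ccont g a).
  { apply (holo_cont g a a r Hg). rewrite Cmod_self_minus. auto. }
  destruct (Ha 1 Rlt_0_1) as [d [Hd Hd1]].
  set (s := Rmin (r / 4) (d / 4)). assert (Hs : 0 < s) by (apply Rmin_pos; lra).
  assert (s <= r / 4) by apply Rmin_l. assert (s <= d / 4) by apply Rmin_r.
  set (M := Cmod (g a) + 1).
  assert (HM : forall w, Cmod (w - a) < 4 * s -> Cmod (g w) <= M).
  { intros w Hw. assert (T := Cmod_triangle_rev (g w) (g a)).
    specialize (Hd1 w ltac:(lra)). unfold M. lra. }
  exists s. split; [auto|]. intros z Hz.
  assert (Hb : forall m, Cmod (g z) <= (Cmod (z - a) / s) ^ m * M).
  { intros m. destruct (Hall m) as [k [Hk Ek]]. assert (Hsm : 0 < s ^ m) by (apply pow_lt; auto).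
    assert (Hkz : Cmod (k z) <= M / s ^ m).
    { apply (holo_mean_bound k z (4 * s - Cmod (z - a)) (2 * s)).
      - apply (holo_sub k a z r); auto. lra.
      - lra.
      - intros w Hw. assert (T1 := Cmod_triangle_minus w z a).
        assert (T2 := Cmod_triangle_minus w a z). rewrite (Cmod_minus_sym a z) in T2.
        assert (HMw := HM w ltac:(lra)). rewrite Ek, Cmod_mult, Cmod_pow in HMw.
        assert (Hpw : s ^ m <= Cmod (w - a) ^ m) by (apply pow_incr; lra).
        apply Rmult_le_reg_l with (s ^ m); [auto|].
        replace (s ^ m * (M / s ^ m)) with M by (field; lra).
        eapply Rle_trans; [|exact HMw]. apply Rmult_le_compat_r; [apply Cmod_ge_0|auto]. }
    rewrite Ek, Cmod_mult, Cmod_pow. unfold Rdiv. rewrite Rpow_mult_distr, pow_inv, Rmult_assoc.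
    apply Rmult_le_compat_l; [apply pow_le, Cmod_ge_0|]. unfold Rdiv in Hkz. lra. }
  apply Cmod_eq_0. apply Rle_antisym; [|apply Cmod_ge_0]. apply Rnot_lt_le. intros Hpos.
  assert (HMp : 0 < M) by (unfold M; generalize (Cmod_ge_0 (g a)); lra).
  assert (Hq0 : 0 <= Cmod (z - a) / s) by (apply Rdiv_le_0_compat; [apply Cmod_ge_0|auto]).
  destruct (pow_lt_1_zero (Cmod (z - a) / s)) with (y := Cmod (g z) / M) as [N HN].
  { rewrite Rabs_pos_eq by auto. apply Rmult_lt_reg_r with s; [auto|].
    unfold Rdiv. rewrite Rmult_assoc, Rinv_l; lra. }
  { apply Rdiv_lt_0_compat; auto. }
  specialize (HN N (Nat.le_refl N)). rewrite Rabs_pos_eq in HN by (apply pow_le; auto).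
  specialize (Hb N). apply Rmult_lt_compat_r with (r := M) in HN; [|auto].
  unfold Rdiv in HN at 2. rewrite Rmult_assoc, Rinv_l in HN; lra.
Qed.

Lemma locally'_proper (z : C) : ProperFilter (locally' z).
Proof.
  constructor; [|apply locally'_filter]. intros P HP.
  apply locally'_Cmod in HP. destruct HP as [d [Hd HP]]. exists (z + RtoC (d / 2))%C. apply HP.
  replace (z + RtoC (d / 2) - z)%C with (RtoC (d / 2)) by ring.
  rewrite Cmod_R, Rabs_pos_eq; lra.
Qed.

(** The difference quotients at [z] of the approximating functions differ little
    on circles around [z], hence, by the mean value property, also near [z].
    So the difference quotient of the limit satisfies Cauchy's criterion at [z]. *)
Lemma holo_uniform_limit (F : C -> C) (a : C) (r : R) :
  (forall e, 0 < e -> exists g, holo g a r /\ forall w, Cmod (w - a) < r -> Cmod (F w - g w) <= e) ->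
  holo F a r.
Proof.
  intros H z Hz. set (s := (r - Cmod (z - a)) / 3). assert (Hs : 0 < s) by (unfold s; lra).
  assert (Hin : forall w, Cmod (w - z) < 3 * s -> Cmod (w - a) < r).
  { intros w Hw. assert (T := Cmod_triangle_minus w z a). unfold s in Hw. lra. }
  set (q := fun w => ((F w - F z) / (w - z))%C).
  assert (Hslope : forall g, holo g a r ->
    cderiv g z (C_derive g z) /\ holo (slope g z (C_derive g z)) z (3 * s)).
  { intros g Hg. destruct (Hg z Hz) as [D HD]. apply cderiv_C_derive in HD. split; [exact HD|].
    apply holo_slope; [lra| |exact HD]. apply (holo_sub g a z r); auto. unfold s. lra. }
  assert (key : forall g e, 0 < e -> holo g a r ->
    (forall w, Cmod (w - a) < r -> Cmod (F w - g w) <= e) ->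
    forall w, 0 < Cmod (w - z) < s / 2 -> Cmod (q w - slope g z (C_derive g z) w) <= 6 * e / s).
  { intros g e He Hg Hge w Hw. set (m := Cmod (w - z)) in *.
    assert (Hm : 0 < Rmin e (e * m / s)).
    { apply Rmin_pos; [auto|]. apply Rdiv_lt_0_compat; [apply Rmult_lt_0_compat; lra|auto]. }
    rmin_bounds e (e * m / s).
    destruct (H _ Hm) as [g' [Hg' Hge']]. set (e' := Rmin e (e * m / s)) in *.
    destruct (Hslope g Hg) as [_ HS], (Hslope g' Hg') as [_ HS'].
    set (S := slope g z (C_derive g z)) in *. set (S' := slope g' z (C_derive g' z)) in *.
    assert (HSS : Cmod (S' w - S w) <= 4 * e / s).
    { apply (holo_mean_bound (fun v => S' v - S v)%C w (3 * s - m) (2 * s)).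
      - apply (holo_sub _ z w (3 * s)); [apply holo_minus; auto|fold m; lra].
      - lra.
      - intros v Hv. assert (T1 := Cmod_triangle_minus v w z).
        assert (T2 := Cmod_triangle_minus v z w). rewrite (Cmod_minus_sym z w) in T2.
        fold m in T1, T2. assert (Nv : v <> z) by (apply Cneq_of_pos; lra).
        unfold S, S'. rewrite !slope_off by exact Nv.
        replace ((g' v - g' z) / (v - z) - (g v - g z) / (v - z))%C
          with (((F v - g v) + - (F z - g z) + ((F z - g' z) + - (F v - g' v))) / (v - z))%C
          by (unfold Cdiv; ring).
        rewrite Cmod_div by (apply Cminus_neq_0, Nv).
        apply Rle_trans with (4 * e / Cmod (v - z)).
        + apply Rmult_le_compat_r; [left; apply Rinv_0_lt_compat; lra|].
          assert (Va := Hin v ltac:(lra)). assert (B1 := Hge v Va). assert (B2 := Hge' v Va).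
          assert (B3 := Hge z Hz). assert (B4 := Hge' z Hz).
          eapply Rle_trans; [apply Cmod_triangle|].
          assert (T3 := Cmod_triangle (F v - g v) (- (F z - g z))).
          assert (T4 := Cmod_triangle (F z - g' z) (- (F v - g' v))).
          rewrite Cmod_opp in T3, T4. lra.
        + apply Rmult_le_compat_l; [lra|]. apply Rinv_le_contravar; lra. }
    assert (Nw : w <> z) by (apply Cneq_of_pos; fold m; lra).
    assert (HqS : Cmod (q w - S' w) <= 2 * e / s).
    { unfold q, S'. rewrite slope_off by exact Nw.
      replace ((F w - F z) / (w - z) - (g' w - g' z) / (w - z))%C
        with (((F w - g' w) + - (F z - g' z)) / (w - z))%C by (unfold Cdiv; ring).
      rewrite Cmod_div by (apply Cminus_neq_0, Nw). fold m.
      assert (B1 := Hge' w (Hin w ltac:(fold m; lra))). assert (B2 := Hge' z Hz).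
      assert (T := Cmod_triangle (F w - g' w) (- (F z - g' z))). rewrite Cmod_opp in T.
      apply Rmult_le_reg_r with m; [lra|]. unfold Rdiv at 1.
      rewrite Rmult_assoc, Rinv_l, Rmult_1_r by lra.
      replace (2 * e / s * m) with (2 * (e * m / s)) by (field; lra). lra. }
    replace (q w - S w)%C with ((q w - S' w) + (S' w - S w))%C by ring.
    eapply Rle_trans; [apply Cmod_triangle|].
    replace (6 * e / s) with (2 * e / s + 4 * e / s) by (field; lra). lra. }
  assert (Hlim : exists D : C_CompleteNormedModule, filterlim q (locally' z) (locally D)).
  { apply (filterlim_locally_cauchy (U := C_CompleteNormedModule) (FF := locally'_proper z)).
    intros eps. assert (Heps := cond_pos eps).
    assert (He : 0 < eps * s / 24) by nra.
    destruct (H _ He) as [g [Hg Hge]]. destruct (Hslope g Hg) as [HD _].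
    destruct (cderiv_slope _ _ _ HD (eps / 4)) as [d [Hd Hc]]; [lra|]. rewrite slope_center in Hc.
    exists (fun w => 0 < Cmod (w - z) < Rmin d (s / 2)).
    rmin_bounds d (s / 2). split.
    - apply locally'_Cmod. exists (Rmin d (s / 2)). split; [apply Rmin_pos; lra|auto].
    - intros u v Hu Hv. apply C_NormedModule_mixin_compat1.
      change (Cmod (q v - q u) < eps).
      assert (K1 := key g _ He Hg Hge u ltac:(lra)). assert (K2 := key g _ He Hg Hge v ltac:(lra)).
      replace (6 * (eps * s / 24) / s) with (eps / 4) in K1, K2 by (field; lra).
      assert (C1 := Hc u ltac:(lra)). assert (C2 := Hc v ltac:(lra)).
      set (S := slope g z (C_derive g z)) in *. set (D := C_derive g z) in *.
      replace (q v - q u)%C with (((q v - S v) + (S v - D)) + - ((q u - S u) + (S u - D)))%C by ring.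
      eapply Rle_lt_trans; [apply Cmod_triangle|]. rewrite Cmod_opp.
      assert (T1 := Cmod_triangle (q v - S v) (S v - D)).
      assert (T2 := Cmod_triangle (q u - S u) (S u - D)). lra. }
  destruct Hlim as [D HD]. exists D. intros e He.
  assert (HP : locally' z (fun w => Cmod (q w - D) < e)).
  { apply (HD (fun w => Cmod (w - D) < e)). apply locally_Cmod. eauto. }
  apply locally'_Cmod in HP. destruct HP as [d [Hd HP]]. exists d. split; [auto|].
  intros w Hw. destruct (Ceq_dec w z) as [->|N].
  - replace (F z - F z - D * (z - z))%C with (RtoC 0) by ring. rewrite Cmod_0, Cmod_self_minus. lra.
  - assert (P := Cmod_minus_pos w z N).
    replace (F w - F z - D * (w - z))%C with ((q w - D) * (w - z))%C
      by (unfold q; field; apply Cminus_neq_0, N).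
    rewrite Cmod_mult. apply Rmult_le_compat_r; [lra|]. left. apply HP. lra.
Qed.

(** * Hurwitz's theorem *)

Fixpoint root_product (l : list C) (w : C) : C :=
  match l with
  | nil => 1
  | c :: l' => ((w - c) * root_product l' w)%C
  end.

(** Roots are split off one at a time: while [m > 0], a function close to
    [(w - a) ^ m] has a zero [c] near [a], and its quotient by [w - c] is close to
    [(w - a) ^ (m - 1)]. *)
Lemma hurwitz_power (a : C) (r rho : R) (m : nat) :
  0 < r -> 0 < rho -> exists d, 0 < d /\ forall g, holo g a r ->
    (forall w, Cmod (w - a) < r -> Cmod (g w - (w - a) ^ m) <= d) ->
    exists l u, length l = m /\ (forall c, In c l -> Cmod (c - a) < rho) /\
      holo u a r /\ (forall w, Cmod (w - a) < r -> u w <> 0) /\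
      forall w, g w = (root_product l w * u w)%C.
Proof.
  intros Hr Hrho. induction m as [|m [d' [Hd' IH]]].
  { exists (1 / 2). split; [lra|]. intros g Hg Hclose. exists nil, g.
    split; [reflexivity|]. split; [intros c []|]. split; [auto|]. split.
    - intros w Hw E. specialize (Hclose w Hw). rewrite E in Hclose. simpl in Hclose.
      replace (0 - 1)%C with (- (1))%C in Hclose by ring. rewrite Cmod_opp, Cmod_1 in Hclose. lra.
    - intros w. simpl. ring. }
  assert (Hrm : 0 < r ^ m) by (apply pow_lt; auto).
  set (eta := Rmin (Rmin rho (r / 8)) (d' * r / (16 * r ^ m))).
  assert (He0 : 0 < eta).
  { repeat apply Rmin_pos; try lra. apply Rdiv_lt_0_compat; [apply Rmult_lt_0_compat; auto|lra]. }
  assert (He1 : eta <= rho) by (eapply Rle_trans; [apply Rmin_l|apply Rmin_l]).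
  assert (He2 : eta <= r / 8) by (eapply Rle_trans; [apply Rmin_l|apply Rmin_r]).
  assert (He3 : eta * r ^ m <= d' * r / 16).
  { apply Rmult_le_reg_r with (/ (r ^ m)); [apply Rinv_0_lt_compat; auto|].
    rewrite Rmult_assoc, Rinv_r, Rmult_1_r by lra.
    eapply Rle_trans; [apply Rmin_r|]. right. field. lra. }
  assert (Hem : 0 < (eta / 2) ^ S m) by (apply pow_lt; lra).
  set (d := Rmin (d' * r / 16) ((eta / 2) ^ S m / 4)).
  assert (Hd0 : 0 < d) by (apply Rmin_pos; [|lra]; assert (0 < d' * r) by nra; lra).
  assert (Hd1 : d <= d' * r / 16) by apply Rmin_l.
  assert (Hd2 : d <= (eta / 2) ^ S m / 4) by apply Rmin_r.
  exists d. split; [auto|]. intros g Hg Hclose.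
  assert (Ha0 : Cmod (a - a) = 0) by apply Cmod_self_minus.
  (* Otherwise [1 / g] would be larger at [a] than on the circle of radius [eta / 2]. *)
  assert (Hzero : exists c, Cmod (c - a) < eta /\ g c = 0).
  { apply NNPP. intros Hno.
    assert (Hnz : forall w, Cmod (w - a) < eta -> g w <> 0) by (intros w Hw E; apply Hno; eauto).
    assert (Hga : Cmod (g a) <= d).
    { specialize (Hclose a ltac:(lra)). simpl in Hclose.
      replace (g a - (a - a) * (a - a) ^ m)%C with (g a) in Hclose by ring. exact Hclose. }
    assert (Hpos : 0 < Cmod (g a)) by (apply Cmod_gt_0, Hnz; lra).
    assert (Hb : Cmod (/ g a) <= / (3 * d)).
    { apply (holo_mean_bound (fun w => / g w)%C a eta (eta / 2)).
      - apply holo_inv; [apply (holo_le g a r); auto; lra|exact Hnz].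
      - lra.
      - intros w Hw. rewrite Cmod_inv by (apply Hnz; lra). apply Rinv_le_contravar; [lra|].
        specialize (Hclose w ltac:(lra)). rewrite Cmod_minus_sym in Hclose.
        assert (T := Cmod_triangle_rev ((w - a) ^ S m) (g w)).
        rewrite Cmod_pow, Hw in T. lra. }
    rewrite Cmod_inv in Hb by (apply Hnz; lra).
    apply Rinv_le_contravar in Hga; [|auto].
    assert (/ (3 * d) < / d) by (apply Rinv_lt_contravar; [nra|lra]). lra. }
  destruct Hzero as [c [Hc Egc]].
  destruct (holo_factor g a c r Hg ltac:(lra) Egc) as [g1 [Hg1 Eg1]].
  (* [(w - c) * k w] is small; this bounds [k] away from [c], and the mean value
     property on circles of radius [r / 2] bounds it in the inner disc. *)
  set (k := fun w => (g1 w - (w - a) ^ m)%C).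
  assert (Hk : holo k a r).
  { apply holo_minus; [auto|]. apply (holo_pow (fun w => w - a)%C), holo_minus_const. }
  assert (Hkout : forall w, r / 4 <= Cmod (w - a) < r -> Cmod (k w) <= d').
  { intros w Hw. assert (T := Cmod_triangle_minus w c a).
    assert (Hwc : r / 8 <= Cmod (w - c)) by lra.
    assert (Hmul : ((w - c) * k w = (g w - (w - a) ^ S m) + (c - a) * (w - a) ^ m)%C).
    { unfold k. rewrite (Eg1 w). simpl. ring. }
    apply (f_equal Cmod) in Hmul. rewrite Cmod_mult in Hmul.
    assert (Hn : Cmod ((g w - (w - a) ^ S m) + (c - a) * (w - a) ^ m) <= d' * r / 8).
    { eapply Rle_trans; [apply Cmod_triangle|]. rewrite Cmod_mult, Cmod_pow.
      assert (B1 := Hclose w ltac:(lra)).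
      assert (B2 : Cmod (c - a) * Cmod (w - a) ^ m <= eta * r ^ m).
      { apply Rmult_le_compat; [apply Cmod_ge_0|apply pow_le, Cmod_ge_0|lra|].
        apply pow_incr. split; [apply Cmod_ge_0|lra]. }
      lra. }
    rewrite <- Hmul in Hn.
    assert (Hle : r / 8 * Cmod (k w) <= Cmod (w - c) * Cmod (k w)).
    { apply Rmult_le_compat_r; [apply Cmod_ge_0|auto]. }
    apply Rmult_le_reg_l with (r / 8); lra. }
  destruct (IH g1 Hg1) as [l [u [Hl [Hlin [Hu [Hun Eu]]]]]].
  { intros w Hw. fold (k w). destruct (Rle_dec (r / 4) (Cmod (w - a))) as [L|L].
    - apply Hkout. lra.
    - apply (holo_mean_bound k w (r - Cmod (w - a)) (r / 2)).
      + apply (holo_sub k a w r); auto. lra.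
      + lra.
      + intros v Hv. apply Hkout. assert (T1 := Cmod_triangle_minus v w a).
        assert (T2 := Cmod_triangle_minus v a w). rewrite (Cmod_minus_sym a w) in T2. lra. }
  exists (c :: l), u. split; [simpl; congruence|]. split.
  { intros x [<-|Hx]; [lra|auto]. }
  split; [auto|]. split; [auto|]. intros w. rewrite Eg1, Eu. simpl. ring.
Qed.

(** Dividing by the zero-free factor [k] reduces to a pure power. *)
Lemma hurwitz (a : C) (h k : C -> C) (r rho K : R) (m : nat) :
  0 < r -> 0 < rho -> 0 < K -> holo k a r ->
  (forall w, Cmod (w - a) < r -> K <= Cmod (k w)) ->
  (forall w, Cmod (w - a) < r -> h w = ((w - a) ^ m * k w)%C) ->
  exists d, 0 < d /\ forall g, holo g a r ->
    (forall w, Cmod (w - a) < r -> Cmod (g w - h w) <= d) ->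
    exists l u, length l = m /\ (forall c, In c l -> Cmod (c - a) < rho) /\
      holo u a r /\ (forall w, Cmod (w - a) < r -> u w <> 0) /\
      forall w, Cmod (w - a) < r -> g w = (root_product l w * u w)%C.
Proof.
  intros Hr Hrho HK Hk HKk Eh.
  destruct (hurwitz_power a r rho m Hr Hrho) as [d [Hd H]].
  exists (d * K). split; [apply Rmult_lt_0_compat; auto|]. intros g Hg Hclose.
  assert (Hk0 : forall w, Cmod (w - a) < r -> k w <> 0).
  { intros w Hw. apply Cmod_gt_0. specialize (HKk w Hw). lra. }
  destruct (H (fun w => g w * / k w)%C) as [l [u [Hl [Hlin [Hu [Hun Eu]]]]]].
  - apply holo_mult; [auto|]. apply holo_inv; auto.
  - intros w Hw. specialize (Hclose w Hw). rewrite (Eh w Hw) in Hclose.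
    replace (g w * / k w - (w - a) ^ m)%C with ((g w - (w - a) ^ m * k w) * / k w)%C
      by (field; auto).
    rewrite Cmod_mult, Cmod_inv by auto. specialize (HKk w Hw).
    apply Rle_trans with (d * K * / K).
    + apply Rmult_le_compat; auto using Cmod_ge_0.
      * left. apply Rinv_0_lt_compat. lra.
      * apply Rinv_le_contravar; auto.
    + right. field. lra.
  - exists l, (fun w => u w * k w)%C. split; [auto|]. split; [auto|].
    split; [apply holo_mult; auto|]. split.
    + intros w Hw. apply Cmult_neq_0; auto.
    + intros w Hw. rewrite Cmult_assoc, <- Eu. field. auto.
Qed.

(** * The Riemann sphere in coordinates *)

Definition sphP (u : Cbar) : C :=
  match u with Fin z => (z / RtoC (1 + Cmod z ^ 2))%C | Inf => 0 end.

Definition sphQ (u : Cbar) : R :=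
  match u with Fin z => / (1 + Cmod z ^ 2) | Inf => 0 end.

(** The coordinates identify the Riemann sphere with the sphere
    [|p|^2 = q * (1 - q)] in [C * R]; a distance computed from them has an immediate
    triangle inequality and a complete range. *)
Definition sdist (u v : Cbar) : R := Cmod (sphP u - sphP v) + Rabs (sphQ u - sphQ v).

Lemma one_plus_pos (z : C) : 1 <= 1 + Cmod z ^ 2.
Proof. assert (0 <= Cmod z ^ 2) by (apply pow_le, Cmod_ge_0). lra. Qed.

Lemma RtoC_neq_0 (x : R) : x <> 0 -> RtoC x <> 0.
Proof. intros H E. apply (f_equal fst) in E. simpl in E. auto. Qed.

Lemma Cmod_sqr (z : C) : Cmod z ^ 2 = fst z ^ 2 + snd z ^ 2.
Proof. unfold Cmod. rewrite pow2_sqrt; [reflexivity|]. nra. Qed.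

Lemma sphP_sqr (u : Cbar) : Cmod (sphP u) ^ 2 = sphQ u * (1 - sphQ u).
Proof.
  destruct u as [z|]; cbn [sphP]; cbn [sphQ].
  - assert (H := one_plus_pos z). rewrite Cmod_div, Cmod_R, Rabs_pos_eq by
      (try apply RtoC_neq_0; lra). field. lra.
  - rewrite Cmod_0. ring.
Qed.

Lemma sphQ_bounds (u : Cbar) : 0 <= sphQ u <= 1.
Proof.
  destruct u as [z|]; cbn [sphQ]; [|lra]. assert (H := one_plus_pos z). split.
  - left. apply Rinv_0_lt_compat. simpl in H. lra.
  - rewrite <- Rinv_1 at 2. apply Rinv_le_contravar; simpl in H; lra.
Qed.

Lemma sphQ_eq_0 (u : Cbar) : sphQ u = 0 -> u = Inf.
Proof.
  destruct u as [z|]; [|auto]. cbn [sphQ]. intros H. assert (P := one_plus_pos z).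
  apply Rinv_neq_0_compat in H; [contradiction|lra].
Qed.

Lemma sphQ_Fin_0 : sphQ (Fin 0) = 1.
Proof. cbn [sphQ]. rewrite Cmod_0. field. Qed.

Lemma sphQ_Fin (z : C) : sphQ (Fin z) * (1 + Cmod z ^ 2) = 1.
Proof. cbn [sphQ]. assert (P := one_plus_pos z). field. lra. Qed.

Lemma finite_part_coord (u : Cbar) : finite_part u = (sphP u / RtoC (sphQ u))%C.
Proof.
  destruct u as [z|]; cbn [sphP]; cbn [sphQ]; cbn [finite_part].
  - assert (P := one_plus_pos z). rewrite RtoC_inv by (simpl in *; lra). field. apply RtoC_neq_0. lra.
  - unfold Cdiv; ring.
Qed.

Lemma sphere_coordinates_surj (p : C) (q : R) :
  Cmod p ^ 2 = q * (1 - q) -> exists u, sphP u = p /\ sphQ u = q.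
Proof.
  intros H. destruct (Req_dec q 0) as [->|N].
  - exists Inf. split; [|reflexivity]. simpl. symmetry. apply Cmod_eq_0.
    assert (G := Cmod_ge_0 p). nra.
  - exists (Fin (p / RtoC q)).
    assert (E : 1 + Cmod (p / RtoC q) ^ 2 = / q).
    { rewrite Cmod_div by (apply RtoC_neq_0, N). unfold Rdiv.
      rewrite Rpow_mult_distr, H, pow_inv, Cmod_R, pow2_abs. field. exact N. }
    cbn [sphP]. cbn [sphQ]. rewrite E. split.
    + rewrite RtoC_inv by (simpl in *; lra). field. apply RtoC_neq_0, N.
    + field. exact N.
Qed.

Lemma sdist_nonneg (u v : Cbar) : 0 <= sdist u v.
Proof. unfold sdist. generalize (Cmod_ge_0 (sphP u - sphP v)), (Rabs_pos (sphQ u - sphQ v)). lra. Qed.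

Lemma sdist_self (u : Cbar) : sdist u u = 0.
Proof. unfold sdist. rewrite Cmod_self_minus, Rminus_diag, Rabs_R0. ring. Qed.

Lemma sdist_sym (u v : Cbar) : sdist u v = sdist v u.
Proof. unfold sdist. rewrite Cmod_minus_sym, Rabs_minus_sym. reflexivity. Qed.

Lemma sdist_triangle (u v w : Cbar) : sdist u w <= sdist u v + sdist v w.
Proof.
  unfold sdist. assert (T := Cmod_triangle_minus (sphP u) (sphP v) (sphP w)).
  assert (T' := Rabs_triang (sphQ u - sphQ v) (sphQ v - sphQ w)).
  replace (sphQ u - sphQ v + (sphQ v - sphQ w)) with (sphQ u - sphQ w) in T' by ring. lra.
Qed.

Lemma sdist_eq_0 (u v : Cbar) : sdist u v = 0 -> u = v.
Proof.
  unfold sdist. intros H.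
  assert (G1 := Cmod_ge_0 (sphP u - sphP v)). assert (G2 := Rabs_pos (sphQ u - sphQ v)).
  assert (E1 : sphP u = sphP v) by (apply Cmod_minus_eq_0; lra).
  assert (E2 : sphQ u = sphQ v).
  { apply Rminus_diag_uniq. destruct (Req_dec (sphQ u - sphQ v) 0) as [E|N]; [auto|].
    apply Rabs_pos_lt in N. lra. }
  assert (EF := finite_part_coord u). rewrite E1, E2, <- finite_part_coord in EF.
  destruct u as [z|], v as [w|]; simpl in EF; try congruence.
  - symmetry in E2. apply sphQ_eq_0. rewrite <- E2. reflexivity.
  - symmetry. apply sphQ_eq_0. rewrite <- E2. reflexivity.
Qed.

Lemma sphQ_sdist (u v : Cbar) : sphQ u - sphQ v <= sdist u v.
Proof.
  unfold sdist. generalize (Cmod_ge_0 (sphP u - sphP v)), (Rle_abs (sphQ u - sphQ v)). lra.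
Qed.

(** [(sphP, sphQ)] is the stereographic image rescaled to a sphere of radius 1/2. *)
Lemma chordal_coordinates (u v : Cbar) :
  0 <= chordal u v /\
  (chordal u v / 2) ^ 2 = Cmod (sphP u - sphP v) ^ 2 + (sphQ u - sphQ v) ^ 2.
Proof.
  assert (Hs : forall z, 0 < sqrt (1 + Cmod z ^ 2)).
  { intros z. apply sqrt_lt_R0. generalize (one_plus_pos z). lra. }
  assert (Hq : forall z, sqrt (1 + Cmod z ^ 2) ^ 2 = 1 + Cmod z ^ 2).
  { intros z. apply pow2_sqrt. generalize (one_plus_pos z). lra. }
  assert (HI : forall z, (2 / sqrt (1 + Cmod z ^ 2) / 2) ^ 2
    = Cmod (sphP (Fin z)) ^ 2 + sphQ (Fin z) ^ 2).
  { intros z. rewrite sphP_sqr. cbn [sphQ]. rewrite <- (Hq z) at 2 3 4. field.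
    apply Rgt_not_eq, Hs. }
  destruct u as [z|], v as [w|]; cbn [chordal].
  - split.
    { apply Rdiv_le_0_compat; [|apply Rmult_lt_0_compat; auto]. generalize (Cmod_ge_0 (z - w)). lra. }
    replace ((2 * Cmod (z - w) / (sqrt (1 + Cmod z ^ 2) * sqrt (1 + Cmod w ^ 2)) / 2) ^ 2)
      with (Cmod (z - w) ^ 2 / (sqrt (1 + Cmod z ^ 2) ^ 2 * sqrt (1 + Cmod w ^ 2) ^ 2))
      by (field; split; apply Rgt_not_eq, Hs).
    rewrite !Hq. cbn [sphP]. cbn [sphQ].
    assert (Pz := one_plus_pos z). assert (Pw := one_plus_pos w).
    set (A := 1 + Cmod z ^ 2) in *. set (B := 1 + Cmod w ^ 2) in *.
    assert (EA : A = 1 + fst z ^ 2 + snd z ^ 2) by (unfold A; rewrite Cmod_sqr; ring).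
    assert (EB : B = 1 + fst w ^ 2 + snd w ^ 2) by (unfold B; rewrite Cmod_sqr; ring).
    rewrite !Cmod_sqr.
    replace (z / A - w / B)%C
      with ((fst z / A - fst w / B)%R, (snd z / A - snd w / B)%R).
    2:{ unfold Cdiv. rewrite <- !RtoC_inv by (simpl in *; lra). apply injective_projections; simpl; unfold Rdiv; ring. }
    clearbody A B. simpl fst. simpl snd.
    assert (HA : fst z ^ 2 + snd z ^ 2 = A - 1) by lra.
    assert (HB : fst w ^ 2 + snd w ^ 2 = B - 1) by lra.
    transitivity ((A - 1 + (B - 1) - 2 * (fst z * fst w + snd z * snd w)) / (A * B)).
    { rewrite <- HA, <- HB. f_equal. ring. }
    transitivity ((A - 1) / A ^ 2 + (B - 1) / B ^ 2
      - 2 * (fst z * fst w + snd z * snd w) / (A * B) + (/ A - / B) ^ 2).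
    { field. lra. }
    rewrite <- HA, <- HB. field. lra.
  - split; [apply Rdiv_le_0_compat; [lra|apply Hs]|].
    rewrite HI. change (sphP Inf) with (RtoC 0). change (sphQ Inf) with 0.
    replace (sphP (Fin z) - 0)%C with (sphP (Fin z)) by ring. ring.
  - split; [apply Rdiv_le_0_compat; [lra|apply Hs]|].
    rewrite HI. change (sphP Inf) with (RtoC 0). change (sphQ Inf) with 0.
    rewrite (Cmod_minus_sym 0). replace (sphP (Fin w) - 0)%C with (sphP (Fin w)) by ring. ring.
  - split; [lra|]. rewrite Cmod_self_minus. field.
Qed.

Lemma sdist_le_chordal (u v : Cbar) : sdist u v <= chordal u v.
Proof.
  destruct (chordal_coordinates u v) as [H0 H1]. unfold sdist.
  assert (G := Cmod_ge_0 (sphP u - sphP v)). assert (G' := Rabs_pos (sphQ u - sphQ v)).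
  rewrite <- (pow2_abs (sphQ u - sphQ v)) in H1. apply Rsqr_incr_0_var; [|exact H0].
  rewrite !Rsqr_pow2. assert (G2 := pow2_ge_0 (Cmod (sphP u - sphP v) - Rabs (sphQ u - sphQ v))).
  nra.
Qed.

Lemma Cmod_sphP_le (u : Cbar) : Cmod (sphP u) <= 1 / 2.
Proof.
  assert (E := sphP_sqr u). assert (G := Cmod_ge_0 (sphP u)).
  assert (B := pow2_ge_0 (sphQ u - 1 / 2)). nra.
Qed.

Lemma sdist_le_2 (u v : Cbar) : sdist u v <= 2.
Proof.
  unfold sdist. assert (T := Cmod_triangle (sphP u) (- sphP v)). rewrite Cmod_opp in T.
  fold (sphP u - sphP v)%C in T. assert (B1 := Cmod_sphP_le u). assert (B2 := Cmod_sphP_le v).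
  assert (Q1 := sphQ_bounds u). assert (Q2 := sphQ_bounds v).
  assert (Rabs (sphQ u - sphQ v) <= 1) by (apply Rabs_le; lra). lra.
Qed.

Lemma sdist_le_rho (u v : Cbar) : sdist u v <= rho u v.
Proof.
  destruct (chordal_coordinates u v) as [H0 _]. assert (H1 := sdist_le_chordal u v).
  assert (Hpi := PI2_1). unfold rho. destruct (Rle_lt_dec 1 (chordal u v / 2)) as [L|L].
  - (* [asin] is constant from 1 on, and [rho] then exceeds any value of [sdist]. *)
    assert (E : asin (chordal u v / 2) = PI / 2).
    { unfold asin. destruct (Rle_dec (chordal u v / 2) (-1)); [lra|].
      destruct (Rle_dec 1 (chordal u v / 2)); [reflexivity|contradiction]. }
    rewrite E. assert (H2 := sdist_le_2 u v). lra.
  - destruct (Req_dec (chordal u v) 0) as [E|N].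
    { rewrite E in *. unfold Rdiv. rewrite Rmult_0_l, asin_0. lra. }
    assert (Hs : sin (asin (chordal u v / 2)) = chordal u v / 2) by (apply sin_asin; lra).
    assert (Ha : 0 < asin (chordal u v / 2)).
    { apply Rnot_le_lt. intros Hle. assert (B := asin_bound (chordal u v / 2)).
      assert (S := sin_ge_0 (- asin (chordal u v / 2)) ltac:(lra) ltac:(lra)).
      rewrite sin_neg in S. lra. }
    assert (Hl := sin_lt_x _ Ha). lra.
Qed.

Lemma sdist_Fin_le (z w : C) : sdist (Fin z) (Fin w) <= 2 * Cmod (z - w).
Proof.
  eapply Rle_trans; [apply sdist_le_chordal|]. cbn [chordal].
  assert (H : forall x, 1 <= sqrt (1 + Cmod x ^ 2)).
  { intros x. rewrite <- sqrt_1 at 1. apply sqrt_le_1_alt, one_plus_pos. }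
  assert (Hz := H z). assert (Hw := H w).
  assert (1 <= sqrt (1 + Cmod z ^ 2) * sqrt (1 + Cmod w ^ 2)) by nra.
  apply Rle_trans with (2 * Cmod (z - w) / 1); [|right; field].
  apply Rmult_le_compat_l; [generalize (Cmod_ge_0 (z - w)); lra|].
  apply Rinv_le_contravar; lra.
Qed.

(** On the disc of radius 2, which is [1/5 <= sphQ], both metrics are comparable. *)
Lemma finite_part_sdist (u v : Cbar) :
  1 / 5 <= sphQ u -> 1 / 5 <= sphQ v ->
  Cmod (finite_part u - finite_part v) <= 10 * sdist u v.
Proof.
  intros Hu Hv.
  assert (Bv := sphQ_bounds v).
  assert (Hfv : Cmod (finite_part v) <= 2).
  { destruct v as [z|]; cbn [finite_part]; [|rewrite Cmod_0; lra].
    assert (E := sphQ_Fin z). assert (P := one_plus_pos z). assert (G := Cmod_ge_0 z).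
    apply Rsqr_incr_0_var; [|lra]. rewrite !Rsqr_pow2. nra. }
  replace (finite_part u - finite_part v)%C
    with (((sphP u - sphP v) - finite_part v * RtoC (sphQ u - sphQ v)) / RtoC (sphQ u))%C.
  2:{ rewrite !finite_part_coord, RtoC_minus. field. split; apply RtoC_neq_0; lra. }
  rewrite Cmod_div, Cmod_R, Rabs_pos_eq by (try apply RtoC_neq_0; lra).
  apply Rmult_le_reg_r with (sphQ u); [lra|]. unfold Rdiv at 1.
  rewrite Rmult_assoc, Rinv_l, Rmult_1_r by lra.
  unfold Cminus at 1. eapply Rle_trans; [apply Cmod_triangle|].
  rewrite Cmod_opp, Cmod_mult, Cmod_R. unfold sdist.
  assert (G := Cmod_ge_0 (sphP u - sphP v)). assert (G' := Rabs_pos (sphQ u - sphQ v)).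
  assert (Cmod (finite_part v) * Rabs (sphQ u - sphQ v) <= 2 * Rabs (sphQ u - sphQ v))
    by (apply Rmult_le_compat_r; auto).
  apply Rle_trans with (2 * (Cmod (sphP u - sphP v) + Rabs (sphQ u - sphQ v))); [lra|].
  rewrite (Rmult_assoc 10), (Rmult_comm _ (sphQ u)), <- Rmult_assoc.
  apply Rmult_le_compat_r; lra.
Qed.

Definition cinv (u : Cbar) : Cbar :=
  match u with
  | Fin z => if Ceq_dec z 0 then Inf else Fin (/ z)%C
  | Inf => Fin 0
  end.

Lemma cinv_Fin (z : C) : z <> 0 -> cinv (Fin z) = Fin (/ z)%C.
Proof. intros H. simpl. destruct (Ceq_dec z 0); congruence. Qed.

Lemma cinv_0 : cinv (Fin 0) = Inf.
Proof. simpl. destruct (Ceq_dec 0 0); congruence. Qed.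

Lemma Cinv_neq_0 (z : C) : z <> 0 -> (/ z)%C <> 0.
Proof. intros H E. apply C1_nz. rewrite <- (Cinv_r z H), E. ring. Qed.

Lemma Cinv_involutive (z : C) : z <> 0 -> (/ / z)%C = z.
Proof. intros H. field. repeat split; auto using Cinv_neq_0. Qed.

Lemma cinv_involutive (u : Cbar) : cinv (cinv u) = u.
Proof.
  destruct u as [z|]; [|apply cinv_0]. destruct (Ceq_dec z 0) as [->|N].
  - rewrite cinv_0. reflexivity.
  - rewrite !cinv_Fin; auto using Cinv_neq_0. f_equal. apply Cinv_involutive, N.
Qed.

(** Inversion is a reflection in these coordinates, hence an isometry. *)
Lemma cinv_coordinates (u : Cbar) : sphP (cinv u) = Cconj (sphP u) /\ sphQ (cinv u) = 1 - sphQ u.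
Proof.
  destruct u as [z|].
  - destruct (Ceq_dec z 0) as [->|N].
    + rewrite cinv_0. rewrite sphQ_Fin_0. split; [|simpl; ring].
      cbn [sphP]. unfold Cdiv. apply injective_projections; simpl; ring.
    + rewrite cinv_Fin by auto. cbn [sphP]. cbn [sphQ]. rewrite Cmod_inv by auto.
      assert (P := one_plus_pos z). assert (Pz : 0 < Cmod z) by (apply Cmod_gt_0, N).
      assert (Pz2 : 0 < Cmod z ^ 2) by (apply pow_lt, Pz).
      assert (E2 : (RtoC (Cmod z ^ 2) = z * Cconj z)%C) by apply Cmod2_conj.
      split; [|field; simpl in *; lra].
      assert (Ec : Cconj (z / RtoC (1 + Cmod z ^ 2)) = (Cconj z / RtoC (1 + Cmod z ^ 2))%C).
      { unfold Cdiv. rewrite <- RtoC_inv by (simpl in *; lra). apply injective_projections; simpl; ring. }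
      rewrite Ec.
      replace (1 + (/ Cmod z) ^ 2) with ((1 + Cmod z ^ 2) / Cmod z ^ 2) by (field; simpl in *; lra).
      rewrite RtoC_div, E2 by lra. field.
      repeat split; auto; try (apply RtoC_neq_0; lra).
      intros E. apply N. rewrite E in E2. rewrite Cmult_0_r in E2.
      apply (f_equal fst) in E2. simpl in E2. simpl in Pz2. lra.
  - cbn [cinv]. rewrite sphQ_Fin_0. split; [|simpl; ring].
    cbn [sphP]. unfold Cdiv. apply injective_projections; simpl; ring.
Qed.

Lemma sdist_cinv (u v : Cbar) : sdist (cinv u) (cinv v) = sdist u v.
Proof.
  unfold sdist. destruct (cinv_coordinates u) as [-> ->], (cinv_coordinates v) as [-> ->].
  f_equal.
  - rewrite <- (Cmod_conj (sphP u - sphP v)). f_equal. apply injective_projections; simpl; ring.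
  - rewrite <- Rabs_Ropp. f_equal. ring.
Qed.

(** * Holomorphic maps to the sphere *)

(** Holomorphy with values in the sphere, in one of the two charts. Unlike
    meromorphy it is invariant under inversion and closed under uniform limits,
    because the constants 0 and infinity are not excluded. *)
Definition sphol (F : C -> Cbar) (a : C) : Prop :=
  exists r h, 0 < r /\ holo h a r /\
    ((forall w, Cmod (w - a) < r -> F w = Fin (h w)) \/
     (forall w, Cmod (w - a) < r -> F w = cinv (Fin (h w)))).

Lemma sphol_cinv (F : C -> Cbar) (a : C) : sphol F a -> sphol (fun w => cinv (F w)) a.
Proof.
  intros [r [h [Hr [Hh [E|E]]]]]; exists r, h; split; auto; split; auto.
  - right. intros w Hw. rewrite E; auto.
  - left. intros w Hw. rewrite E, cinv_involutive; auto.
Qed.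

Lemma sphol_near (F G : C -> Cbar) (a : C) (s : R) :
  0 < s -> (forall w, Cmod (w - a) < s -> F w = G w) -> sphol F a -> sphol G a.
Proof.
  intros Hs EG [r [h [Hr [Hh Hor]]]]. exists (Rmin r s), h.
  rmin_bounds r s.
  split; [apply Rmin_pos; auto|]. split; [apply (holo_le h a r); auto|].
  destruct Hor as [E|E]; [left|right]; intros w Hw; rewrite <- EG by lra; apply E; lra.
Qed.

Lemma sphol_of_cinv (F : C -> Cbar) (a : C) : sphol (fun w => cinv (F w)) a -> sphol F a.
Proof.
  intros H. apply (sphol_near (fun w => cinv (cinv (F w))) F a 1); [lra| |apply sphol_cinv, H].
  intros w _. apply cinv_involutive.
Qed.

Lemma sphol_translate (F : C -> Cbar) (a s : C) :
  sphol F (a + s)%C -> sphol (fun w => F (w + s)%C) a.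
Proof.
  intros [r [h [Hr [Hh Hor]]]]. exists r, (fun w => h (w + s)%C).
  assert (T : forall w, (w + s - (a + s))%C = (w - a)%C) by (intros; ring).
  split; [auto|]. split.
  - intros z Hz. destruct (Hh (z + s)%C) as [D HD]; [rewrite T; auto|].
    eexists. apply (cderiv_comp h (fun w => w + s)%C); [|exact HD].
    apply cderiv_plus; [apply cderiv_id|apply cderiv_const].
  - destruct Hor as [E|E]; [left|right]; intros w Hw; apply E; rewrite T; auto.
Qed.

(** At a pole [1 / f] has a removable singularity with value 0. *)
Lemma meromorphic_sphol (S : C -> Prop) (f : C -> Cbar) (z : C) :
  meromorphic S f -> S z -> sphol f z.
Proof.
  intros Hf HS. destruct (Hf z HS) as [[H1 H2]|[H0 [H1 H2]]].
  - apply locally_Cmod in H1. destruct H1 as [d [Hd H1]].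
    apply holomorphic_at_holo in H2. destruct H2 as [r [Hr H2]].
    exists (Rmin d r), (fun w => finite_part (f w)).
    rmin_bounds d r.
    split; [apply Rmin_pos; auto|]. split; [apply (holo_le _ z r); auto|].
    left. intros w Hw. specialize (H1 w ltac:(lra)). destruct (f w); [reflexivity|congruence].
  - apply locally'_Cmod in H1. destruct H1 as [d [Hd H1]].
    assert (Hbig : forall M, exists s, 0 < s /\
      forall w, 0 < Cmod (w - z) < s -> M < Cmod (finite_part (f w))).
    { intros M. apply locally'_Cmod. apply (H2 (fun x => M < x)). exists M. auto. }
    destruct (Hbig 0) as [s [Hs Hs1]].
    set (h := fun w => if Ceq_dec w z then RtoC 0 else (/ finite_part (f w))%C).
    assert (Hz : h z = 0) by (unfold h; destruct (Ceq_dec z z); congruence).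
    assert (Hoff : forall w, w <> z -> h w = (/ finite_part (f w))%C)
      by (intros w N; unfold h; destruct (Ceq_dec w z); congruence).
    rmin_bounds d s.
    exists (Rmin d s), h. split; [apply Rmin_pos; auto|]. split.
    + apply removable_singularity; [apply Rmin_pos; auto| |].
      * intros w Hw. destruct (H1 w ltac:(lra)) as [_ Hd1]. apply ex_derive_cderiv in Hd1.
        destruct Hd1 as [D HD]. eexists.
        apply (cderiv_near (fun u => / finite_part (f u))%C h w _ (Cmod (w - z))); [lra| |].
        -- intros u Hu. symmetry. apply Hoff. intros ->. rewrite Cmod_minus_sym in Hu. lra.
        -- apply cderiv_inv; [exact HD|]. apply Cmod_gt_0, Hs1. lra.
      * intros e He. destruct (Hbig (/ e)) as [t [Ht Ht1]]. exists_rmin s t. intros w Hw. rewrite Hz.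
        replace (h w - 0)%C with (h w) by ring. destruct (Ceq_dec w z) as [->|N].
        -- rewrite Hz, Cmod_0. exact He.
        -- assert (Pw := Cmod_minus_pos w z N). rewrite Hoff by auto.
           rewrite Cmod_inv by (apply Cmod_gt_0, Hs1; lra).
           rewrite <- (Rinv_inv e). apply Rinv_lt_contravar; [|apply Ht1; lra].
           apply Rmult_lt_0_compat; [apply Rinv_0_lt_compat; auto|]. apply Hs1. lra.
    + right. intros w Hw. destruct (Ceq_dec w z) as [->|N].
      * rewrite Hz, cinv_0. exact H0.
      * assert (Pw := Cmod_minus_pos w z N). rewrite Hoff by auto.
        assert (Hn : finite_part (f w) <> 0) by (apply Cmod_gt_0, Hs1; lra).
        rewrite cinv_Fin by (apply Cinv_neq_0, Hn). rewrite Cinv_involutive by auto.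
        destruct (H1 w ltac:(lra)) as [Hfin _]. destruct (f w); [reflexivity|congruence].
Qed.

Definition scont (F : C -> Cbar) (a : C) : Prop :=
  forall e, 0 < e -> exists d, 0 < d /\ forall w, Cmod (w - a) < d -> sdist (F w) (F a) < e.

Lemma sphol_scont (F : C -> Cbar) (a : C) : sphol F a -> scont F a.
Proof.
  intros [r [h [Hr [Hh Hor]]]] e He.
  assert (Ha0 : Cmod (a - a) < r) by (rewrite Cmod_self_minus; auto).
  destruct (holo_cont h a a r Hh Ha0 (e / 2)) as [d [Hd H1]]; [lra|].
  exists_rmin r d. intros w Hw. specialize (H1 w ltac:(lra)).
  assert (B := sdist_Fin_le (h w) (h a)).
  destruct Hor as [E|E]; rewrite !E by lra; [|rewrite sdist_cinv]; lra.
Qed.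

Lemma sphol_finite (F : C -> Cbar) (a : C) (r : R) :
  (forall w, Cmod (w - a) < r -> sphol F w) -> (forall w, Cmod (w - a) < r -> F w <> Inf) ->
  holo (fun w => finite_part (F w)) a r.
Proof.
  intros HF Hfin z Hz. destruct (HF z Hz) as [s [h [Hs [Hh Hor]]]].
  assert (Hz0 : Cmod (z - z) < s) by (rewrite Cmod_self_minus; auto).
  destruct (Hh z Hz0) as [D HD].
  destruct Hor as [E|E].
  - exists D. apply (cderiv_near h _ z D s); auto. intros w Hw. rewrite E by auto. reflexivity.
  - assert (Hn : forall w, Cmod (w - z) < Rmin s (r - Cmod (z - a)) -> h w <> 0).
    { intros w Hw E0. rmin_bounds s (r - Cmod (z - a)). assert (T := Cmod_triangle_minus w z a).
      apply (Hfin w ltac:(lra)). rewrite E, E0 by lra. apply cinv_0. }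
    assert (Hm : 0 < Rmin s (r - Cmod (z - a))) by (apply Rmin_pos; lra).
    eexists. apply (cderiv_near (fun w => / h w)%C _ z _ (Rmin s (r - Cmod (z - a)))); [auto| |].
    + intros w Hw. assert (L1 := Rmin_l s (r - Cmod (z - a))). rewrite E by lra.
      rewrite cinv_Fin by auto. reflexivity.
    + apply cderiv_inv; [exact HD|]. apply Hn. rewrite Cmod_self_minus. exact Hm.
Qed.

Lemma Fin_finite_part (u : Cbar) : 0 < sphQ u -> u = Fin (finite_part u).
Proof. destruct u; simpl; [reflexivity|lra]. Qed.

(** A uniform limit of holomorphic maps to the sphere is one: where the limit
    is at most 1 in modulus the maps are uniformly bounded nearby, elsewhere
    their inverses are. *)
Lemma sphol_limit (F : C -> Cbar) (a : C) (r : R) :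
  0 < r ->
  (forall e, 0 < e -> exists G, forall w, Cmod (w - a) < r -> sphol G w /\ sdist (G w) (F w) < e) ->
  sphol F a.
Proof.
  revert F.
  assert (main : forall F, 0 < r -> 1 / 2 <= sphQ (F a) -> (forall e, 0 < e -> exists G,
    forall w, Cmod (w - a) < r -> sphol G w /\ sdist (G w) (F w) < e) -> sphol F a).
  { intros F Hr HQ HG.
    assert (Ha0 : Cmod (a - a) < r) by (rewrite Cmod_self_minus; auto).
    assert (Hc : exists s, 0 < s <= r /\ forall w, Cmod (w - a) < s -> 2 / 5 <= sphQ (F w)).
    { destruct (HG (1 / 40)) as [G HGw]; [lra|].
      destruct (HGw a Ha0) as [Ga Gd].
      destruct (sphol_scont G a Ga (1 / 40)) as [d [Hd Hd1]]; [lra|].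
      exists (Rmin r d). rmin_bounds r d.
      split; [split; [apply Rmin_pos; auto|auto]|]. intros w Hw.
      destruct (HGw w ltac:(lra)) as [_ Gw]. specialize (Hd1 w ltac:(lra)).
      assert (Q1 := sphQ_sdist (F a) (G a)). rewrite sdist_sym in Q1.
      assert (Q2 := sphQ_sdist (G a) (G w)). rewrite sdist_sym in Q2.
      assert (Q3 := sphQ_sdist (G w) (F w)). lra. }
    destruct Hc as [s [Hs Hs1]].
    exists s, (fun w => finite_part (F w)). split; [lra|]. split.
    - apply holo_uniform_limit. intros e He.
      assert (Hm : 0 < Rmin (1 / 10) (e / 10)) by (apply Rmin_pos; lra).
      rmin_bounds (1 / 10) (e / 10).
      destruct (HG _ Hm) as [G HGw].
      assert (HQG : forall w, Cmod (w - a) < s -> 3 / 10 <= sphQ (G w)).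
      { intros w Hw. destruct (HGw w ltac:(lra)) as [_ Gw].
        assert (Q := sphQ_sdist (F w) (G w)). rewrite sdist_sym in Q. specialize (Hs1 w Hw). lra. }
      exists (fun w => finite_part (G w)). split.
      + apply sphol_finite.
        * intros w Hw. apply HGw. lra.
        * intros w Hw E. specialize (HQG w Hw). rewrite E in HQG. simpl in HQG. lra.
      + intros w Hw. destruct (HGw w ltac:(lra)) as [_ Gw].
        specialize (HQG w Hw). specialize (Hs1 w Hw).
        assert (B := finite_part_sdist (F w) (G w) ltac:(lra) ltac:(lra)).
        rewrite sdist_sym in B. lra.
    - left. intros w Hw. apply Fin_finite_part. specialize (Hs1 w Hw). lra. }
  intros F Hr HG. destruct (Rle_dec (1 / 2) (sphQ (F a))) as [L|L]; [apply main; auto|].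
  apply sphol_of_cinv. apply main; auto.
  - destruct (cinv_coordinates (F a)) as [_ ->]. lra.
  - intros e He. destruct (HG e He) as [G H]. exists (fun w => cinv (G w)). intros w Hw.
    destruct (H w Hw) as [H1 H2]. split; [apply sphol_cinv, H1|]. rewrite sdist_cinv. exact H2.
Qed.

Lemma cinv_Fin_neq_0 (z : C) : cinv (Fin z) <> Fin 0.
Proof.
  simpl. destruct (Ceq_dec z 0) as [E|N]; [discriminate|].
  intros H. injection H as H1 H2. apply (Cinv_neq_0 z N). apply injective_projections; auto.
Qed.

Lemma power_factor_neq_0 (k : C -> C) (a : C) (r : R) (m : nat) :
  0 < r -> holo k a r -> k a <> 0 -> exists s, 0 < s <= r /\
    (forall w, Cmod (w - a) < s -> Cmod (k a) / 2 <= Cmod (k w)) /\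
    forall w, 0 < Cmod (w - a) < s -> ((w - a) ^ m * k w)%C <> 0.
Proof.
  intros Hr Hk Ha.
  assert (Ha0 : Cmod (a - a) < r) by (rewrite Cmod_self_minus; auto).
  destruct (Ccont_nonzero k a (holo_cont k a a r Hk Ha0) Ha) as [d [Hd Hd1]].
  exists (Rmin r d). rmin_bounds r d.
  split; [split; [apply Rmin_pos; auto|auto]|].
  assert (Hb : forall w, Cmod (w - a) < Rmin r d -> Cmod (k a) / 2 <= Cmod (k w)).
  { intros w Hw. specialize (Hd1 w ltac:(lra)). lra. }
  split; [exact Hb|]. intros w Hw. apply Cmod_gt_0 in Ha. apply Cmult_neq_0.
  - apply Cpow_nz, Cmod_gt_0. lra.
  - apply Cmod_gt_0. specialize (Hb w ltac:(lra)). lra.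
Qed.

Lemma sphol_zero_or_isolated (F : C -> Cbar) (a : C) : sphol F a ->
  (exists s, 0 < s /\ forall w, Cmod (w - a) < s -> F w = Fin 0) \/
  (exists s, 0 < s /\ forall w, 0 < Cmod (w - a) < s -> F w <> Fin 0).
Proof.
  intros [r [h [Hr [Hh [E|E]]]]].
  - destruct (vanishing_order h a r Hr Hh) as [[m [k [Hk [Hka Ek]]]]|[s [Hs Hz]]].
    + right. destruct (power_factor_neq_0 k a r m Hr Hk Hka) as [s [Hs [_ Hs1]]].
      exists s. split; [lra|]. intros w Hw. rewrite E, Ek by lra. intros HF.
      apply (Hs1 w Hw). injection HF as H1 H2. apply injective_projections; auto.
    + left. exists_rmin r s. intros w Hw. rewrite E, Hz by lra. reflexivity.
  - right. exists r. split; [auto|]. intros w Hw. rewrite E by lra. apply cinv_Fin_neq_0.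
Qed.

Definition convex (U : C -> Prop) : Prop :=
  forall z w t, U z -> U w -> 0 <= t <= 1 -> U (w + RtoC t * (z - w))%C.

(** The identity theorem: along a segment, vanishing near the current point is
    a locally constant property. *)
Lemma sphol_identity (F : C -> Cbar) (U : C -> Prop) (z0 : C) (s0 : R) :
  convex U -> (forall z, U z -> sphol F z) -> U z0 -> 0 < s0 ->
  (forall w, Cmod (w - z0) < s0 -> F w = Fin 0) -> forall z, U z -> F z = Fin 0.
Proof.
  intros HU HF Hz0 Hs0 Hzero z Hz.
  set (P := fun a => exists s, 0 < s /\ forall w, Cmod (w - a) < s -> F w = Fin 0).
  set (p := fun t : R => (z0 + RtoC t * (z - z0))%C).
  set (phi := fun t => if excluded_middle_informative (P (p t)) then 1 else 0).
  assert (Hloc : forall a, U a -> exists s, 0 < s /\ forall b, Cmod (b - a) < s -> (P b <-> P a)).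
  { intros a Ha. destruct (sphol_zero_or_isolated F a (HF a Ha)) as [[s [Hs H]]|[s [Hs H]]].
    - exists s. split; [auto|]. intros b Hb. split; intros _.
      + exists s. auto.
      + exists (s - Cmod (b - a)). split; [lra|]. intros w Hw. apply H.
        assert (T := Cmod_triangle_minus w b a). lra.
    - exists s. split; [auto|]. intros b Hb. destruct (Ceq_dec b a) as [->|N]; [tauto|].
      assert (Pb := Cmod_minus_pos b a N). split; intros [t [Ht Ht1]]; exfalso.
      + apply (H b); [lra|]. apply Ht1. rewrite Cmod_self_minus. auto.
      + set (u := Rmin s t / 2). rmin_bounds s t.
        assert (Hu : 0 < Rmin s t) by (apply Rmin_pos; auto).
        assert (Ea : Cmod (a + RtoC u - a) = u).
        { replace (a + RtoC u - a)%C with (RtoC u) by ring. rewrite Cmod_R, Rabs_pos_eq; auto.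
          unfold u. lra. }
        apply (H (a + RtoC u)%C); [|apply Ht1]; rewrite Ea; unfold u; lra. }
  assert (Hconst : phi 0 = phi 1).
  { apply (eq_is_derive (V := R_NormedModule)); [|lra]. intros t Ht.
    destruct (Hloc (p t)) as [s [Hs H]]; [apply HU; auto|].
    assert (HK : 0 < s / (Cmod (z - z0) + 1)).
    { apply Rdiv_lt_0_compat; [auto|]. generalize (Cmod_ge_0 (z - z0)). lra. }
    apply (is_derive_ext_loc (fun _ => phi t)); [|apply (is_derive_const (V := R_NormedModule))].
    exists (mkposreal _ HK). intros t' Ht'.
    assert (Hd : Cmod (p t' - p t) < s).
    { replace (p t' - p t)%C with (RtoC (t' - t) * (z - z0))%C
        by (unfold p; rewrite RtoC_minus; ring).
      rewrite Cmod_mult, Cmod_R. assert (G := Cmod_ge_0 (z - z0)).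
      change (Rabs (t' - t) < s / (Cmod (z - z0) + 1)) in Ht'.
      replace s with (s / (Cmod (z - z0) + 1) * (Cmod (z - z0) + 1)) by (field; lra).
      assert (Gr := Rabs_pos (t' - t)).
      apply Rle_lt_trans with (Rabs (t' - t) * (Cmod (z - z0) + 1)); [nra|].
      apply Rmult_lt_compat_r; lra. }
    specialize (H _ Hd). unfold phi.
    destruct (excluded_middle_informative (P (p t)));
      destruct (excluded_middle_informative (P (p t'))); tauto. }
  unfold phi in Hconst.
  assert (Ep0 : p 0 = z0) by (unfold p; ring).
  assert (Ep1 : p 1 = z) by (unfold p; ring).
  rewrite Ep0, Ep1 in Hconst.
  destruct (excluded_middle_informative (P z0)) as [_|N]; [|exfalso; apply N; exists s0; auto].
  destruct (excluded_middle_informative (P z)) as [[s [Hs H]]|N]; [|lra].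
  apply H. rewrite Cmod_self_minus. exact Hs.
Qed.

(** * Multiplicities of zeros *)

Lemma zero_of_multiplicity_intro (F : C -> Cbar) (x : C) (m : nat) (g : C -> C) (s : R) :
  (0 < m)%nat -> 0 < s -> holo g x s -> g x <> 0 ->
  (forall w, Cmod (w - x) < s -> F w = Fin ((w - x) ^ m * g w)%C) -> zero_of_multiplicity F x m.
Proof.
  intros Hm Hs Hg Hx E. split; [auto|]. exists g. split.
  - apply holomorphic_at_holo. eauto.
  - split; [auto|]. apply locally_Cmod. eauto.
Qed.

Lemma zero_of_multiplicity_elim (F : C -> Cbar) (x : C) (m : nat) :
  zero_of_multiplicity F x m -> (0 < m)%nat /\ exists g s, 0 < s /\ holo g x s /\ g x <> 0 /\
    forall w, Cmod (w - x) < s -> F w = Fin ((w - x) ^ m * g w)%C.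
Proof.
  intros [Hm [g [Hg [Hx H]]]]. split; [auto|].
  apply holomorphic_at_holo in Hg. destruct Hg as [r [Hr Hg]].
  apply locally_Cmod in H. destruct H as [d [Hd H]].
  exists g, (Rmin r d). rmin_bounds r d.
  split; [apply Rmin_pos; auto|]. split; [apply (holo_le g x r); auto|].
  split; [auto|]. intros w Hw. apply H. lra.
Qed.

Lemma Ccont_punctured_zero (k : C -> C) (x : C) (s : R) :
  0 < s -> Ccont k x -> (forall w, 0 < Cmod (w - x) < s -> k w = 0) -> k x = 0.
Proof.
  intros Hs Hk H. apply Cmod_eq_0. apply Rle_antisym; [|apply Cmod_ge_0].
  apply Rnot_lt_le. intros Hp. destruct (Hk _ Hp) as [d [Hd Hc]].
  rmin_bounds s d.
  assert (Hm : 0 < Rmin s d) by (apply Rmin_pos; auto).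
  assert (E : Cmod (x + RtoC (Rmin s d / 2) - x) = Rmin s d / 2).
  { replace (x + RtoC (Rmin s d / 2) - x)%C with (RtoC (Rmin s d / 2)) by ring.
    rewrite Cmod_R, Rabs_pos_eq; lra. }
  specialize (Hc (x + RtoC (Rmin s d / 2))%C ltac:(lra)). rewrite H in Hc by lra.
  rewrite Cmod_minus_sym in Hc. replace (k x - 0)%C with (k x) in Hc by ring. lra.
Qed.

Lemma power_factor_unique (g g' : C -> C) (x : C) (s : R) (m m' : nat) :
  0 < s -> holo g x s -> holo g' x s -> g x <> 0 ->
  (forall w, Cmod (w - x) < s -> ((w - x) ^ m * g w = (w - x) ^ m' * g' w)%C) -> (m' <= m)%nat.
Proof.
  intros Hs Hg Hg' Hx E. apply Nat.nlt_ge. intros Hlt. apply Hx.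
  set (n := (m' - m - 1)%nat). set (k := fun w => (g w - (w - x) ^ S n * g' w)%C).
  replace (g x) with (k x) by (unfold k; simpl; ring).
  assert (Hk : holo k x s).
  { apply holo_minus; [exact Hg|]. apply holo_mult; [|exact Hg'].
    apply (holo_pow (fun w => w - x)%C), holo_minus_const. }
  apply (Ccont_punctured_zero k x s Hs).
  { apply (holo_cont k x x s Hk). rewrite Cmod_self_minus. exact Hs. }
  intros w Hw. specialize (E w ltac:(lra)).
  assert (Hp : ((w - x) ^ m)%C <> 0) by (apply Cpow_nz, Cmod_gt_0; lra).
  replace m' with (m + S n)%nat in E by (unfold n; lia).
  rewrite Cpow_add_r in E. unfold k.
  replace (g w) with (/ (w - x) ^ m * ((w - x) ^ m * g w))%C by (field; exact Hp).
  rewrite E. field. exact Hp.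
Qed.

Lemma Fin_inj (z w : C) : Fin z = Fin w -> z = w.
Proof. intros H. apply (f_equal finite_part) in H. exact H. Qed.

Lemma zero_of_multiplicity_le (F : C -> Cbar) (x : C) (m m' : nat) :
  zero_of_multiplicity F x m -> zero_of_multiplicity F x m' -> (m' <= m)%nat.
Proof.
  intros H H'. apply zero_of_multiplicity_elim in H, H'.
  destruct H as [_ [g [s [Hs [Hg [Hx E]]]]]], H' as [_ [g' [s' [Hs' [Hg' [Hx' E']]]]]].
  rmin_bounds s s'.
  apply (power_factor_unique g g' x (Rmin s s')); auto.
  - apply Rmin_pos; auto.
  - apply (holo_le g x s); auto.
  - apply (holo_le g' x s'); auto.
  - intros w Hw. apply Fin_inj. rewrite <- E, <- E' by lra. reflexivity.
Qed.

Lemma zero_of_multiplicity_unique (F : C -> Cbar) (x : C) (m m' : nat) :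
  zero_of_multiplicity F x m -> zero_of_multiplicity F x m' -> m = m'.
Proof. intros H H'. apply Nat.le_antisymm; eapply zero_of_multiplicity_le; eauto. Qed.

Lemma zero_of_multiplicity_value (F : C -> Cbar) (x : C) (m : nat) :
  zero_of_multiplicity F x m -> F x = Fin 0.
Proof.
  intros H. apply zero_of_multiplicity_elim in H. destruct H as [Hm [g [s [Hs [_ [_ E]]]]]].
  rewrite E by (rewrite Cmod_self_minus; auto). f_equal.
  destruct m as [|m]; [lia|]. simpl. ring.
Qed.

(** A total function, so that multiplicities can be summed: 0 stands for the
    absence of a zero, and also for a zero of infinite order. *)
Definition zmult (F : C -> Cbar) (x : C) : nat :=
  match excluded_middle_informative (exists m, zero_of_multiplicity F x m) with
  | left H => proj1_sig (constructive_indefinite_description _ H)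
  | right _ => 0%nat
  end.

Lemma zmult_eq (F : C -> Cbar) (x : C) (m : nat) : zero_of_multiplicity F x m -> zmult F x = m.
Proof.
  intros H. unfold zmult. destruct (excluded_middle_informative _) as [H1|H1].
  - destruct (constructive_indefinite_description _ H1) as [m' H']. simpl.
    apply (zero_of_multiplicity_unique F x); auto.
  - exfalso. eauto.
Qed.

Lemma zmult_pos (F : C -> Cbar) (x : C) : zmult F x <> 0%nat -> zero_of_multiplicity F x (zmult F x).
Proof.
  unfold zmult. destruct (excluded_middle_informative _) as [H1|H1]; [|congruence].
  intros _. apply (proj2_sig (constructive_indefinite_description _ H1)).
Qed.

Lemma zmult_nonzero_value (F : C -> Cbar) (x : C) : F x <> Fin 0 -> zmult F x = 0%nat.
Proof.
  intros H. destruct (Nat.eq_dec (zmult F x) 0) as [E|N]; [auto|].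
  exfalso. apply H. apply (zero_of_multiplicity_value F x (zmult F x)), zmult_pos, N.
Qed.

Lemma holo_root_product (l : list C) (a : C) (r : R) : holo (root_product l) a r.
Proof.
  induction l as [|c l IH]; simpl; [apply holo_const|].
  apply (holo_mult (fun w => w - c)%C (root_product l)); [apply holo_minus_const|exact IH].
Qed.

Lemma root_product_neq_0 (l : list C) (x : C) : ~ In x l -> root_product l x <> 0.
Proof.
  induction l as [|c l IH]; simpl; intros H; [exact C1_nz|].
  apply Cmult_neq_0; [apply Cminus_neq_0; auto|apply IH; auto].
Qed.

Lemma root_product_remove (l : list C) (x w : C) :
  root_product l w = ((w - x) ^ count_occ Ceq_dec l x * root_product (remove Ceq_dec x l) w)%C.
Proof.
  induction l as [|c l IH]; simpl; [ring|]. rewrite IH.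
  destruct (Ceq_dec c x) as [->|N].
  - destruct (Ceq_dec x x); [|congruence]. simpl. ring.
  - destruct (Ceq_dec x c); [congruence|]. simpl. ring.
Qed.

Lemma zmult_root_product (F : C -> Cbar) (a x : C) (r : R) (l : list C) (u : C -> C) :
  holo u a r -> (forall w, Cmod (w - a) < r -> u w <> 0) ->
  (forall w, Cmod (w - a) < r -> F w = Fin (root_product l w * u w)%C) ->
  Cmod (x - a) < r -> zmult F x = count_occ Ceq_dec l x.
Proof.
  intros Hu Hun E Hx. set (n := count_occ Ceq_dec l x).
  set (g := fun w => (root_product (remove Ceq_dec x l) w * u w)%C).
  assert (Hgx : g x <> 0).
  { apply Cmult_neq_0; [apply root_product_neq_0, remove_In|apply Hun, Hx]. }
  assert (Eg : forall w, Cmod (w - a) < r -> F w = Fin ((w - x) ^ n * g w)%C).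
  { intros w Hw. rewrite E by auto. f_equal. unfold g, n.
    rewrite (root_product_remove l x w). ring. }
  destruct (Nat.eq_dec n 0) as [En|Nn].
  - rewrite En. apply zmult_nonzero_value. rewrite Eg, En by auto. intros HF. apply Fin_inj in HF.
    apply Hgx. rewrite <- HF. simpl. ring.
  - apply zmult_eq. apply (zero_of_multiplicity_intro F x n g (r - Cmod (x - a))); auto; [lia|lra| |].
    + apply (holo_sub g a x r); [|lra]. apply holo_mult; [apply holo_root_product|exact Hu].
    + intros w Hw. apply Eg. assert (T := Cmod_triangle_minus w x a). lra.
Qed.

(** Where [|F a| <= 1] this is Hurwitz's theorem in the finite chart; elsewhere
    maps close to [F] stay away from 0, and [m = 0]. The disc is independent of
    the precision [rho] required of the zeros. *)
Lemma zeros_stable (F : C -> Cbar) (a : C) (r0 : R) :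
  0 < r0 -> sphol F a -> ~ (exists s, 0 < s /\ forall w, Cmod (w - a) < s -> F w = Fin 0) ->
  exists r m, 0 < r <= r0 /\ forall rho, 0 < rho -> exists d, 0 < d /\ forall G,
    (forall w, Cmod (w - a) < r -> sphol G w /\ sdist (G w) (F w) < d) ->
    exists l, length l = m /\ (forall c, In c l -> Cmod (c - a) < rho) /\
      forall x, Cmod (x - a) < r -> zmult G x = count_occ Ceq_dec l x.
Proof.
  intros Hr0 HF Hnz. destruct (sphol_scont F a HF (1 / 20)) as [r1' [Hr1' Hc']]; [lra|].
  set (r1 := Rmin r1' r0). assert (Hr1 : 0 < r1) by (apply Rmin_pos; auto).
  assert (Hr10 : r1 <= r0) by apply Rmin_r.
  assert (Hc : forall w, Cmod (w - a) < r1 -> sdist (F w) (F a) < 1 / 20).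
  { intros w Hw. apply Hc'. assert (r1 <= r1') by apply Rmin_l. lra. }
  clearbody r1.
  destruct (Rle_dec (1 / 2) (sphQ (F a))) as [L|L].
  - assert (HQ : forall w, Cmod (w - a) < r1 -> 2 / 5 <= sphQ (F w)).
    { intros w Hw. specialize (Hc w Hw). assert (Q := sphQ_sdist (F a) (F w)).
      rewrite sdist_sym in Q. lra. }
    assert (Hh : exists r2, 0 < r2 <= r1 /\ holo (fun w => finite_part (F w)) a r2).
    { destruct HF as [r [h [Hr [Hh Hor]]]]. exists (Rmin r r1).
      rmin_bounds r r1.
      split; [split; [apply Rmin_pos; auto|auto]|].
      destruct Hor as [E|E].
      - apply (holo_ext h); [|apply (holo_le h a r); auto].
        intros w Hw. rewrite E by lra. reflexivity.
      - assert (Hn : forall w, Cmod (w - a) < Rmin r r1 -> h w <> 0).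
        { intros w Hw E0. specialize (HQ w ltac:(lra)). rewrite E, E0, cinv_0 in HQ by lra.
          simpl in HQ. lra. }
        apply (holo_ext (fun w => / h w)%C).
        + intros w Hw. rewrite E by lra. rewrite cinv_Fin by auto. reflexivity.
        + apply holo_inv; [apply (holo_le h a r); auto|exact Hn]. }
    destruct Hh as [r2 [Hr2 Hh]]. set (h := fun w => finite_part (F w)) in *.
    assert (EF : forall w, Cmod (w - a) < r1 -> F w = Fin (h w)).
    { intros w Hw. apply Fin_finite_part. specialize (HQ w Hw). lra. }
    destruct (vanishing_order h a r2) as [[m [k [Hk [Hka Ek]]]]|[s [Hs Hz]]]; [lra|auto| |].
    2:{ exfalso. apply Hnz. exists_rmin s r1. intros w Hw.
        rewrite EF, Hz by lra. reflexivity. }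
    destruct (power_factor_neq_0 k a r2 m) as [r [Hr [Hkb _]]]; auto; [lra|].
    assert (HK : 0 < Cmod (k a) / 2) by (apply Cmod_gt_0 in Hka; lra).
    exists r, m. split; [lra|]. intros rho Hrho.
    destruct (hurwitz a h k r rho (Cmod (k a) / 2) m) as [d [Hd H]]; auto; [lra| |].
    { apply (holo_le k a r2); auto. lra. }
    assert (Hm : 0 < Rmin (1 / 10) (d / 10)) by (apply Rmin_pos; lra).
    rmin_bounds (1 / 10) (d / 10).
    exists (Rmin (1 / 10) (d / 10)). split; [auto|]. intros G HG.
    assert (HQG : forall w, Cmod (w - a) < r -> 3 / 10 <= sphQ (G w)).
    { intros w Hw. destruct (HG w Hw) as [_ Gw]. assert (Q := sphQ_sdist (F w) (G w)).
      rewrite sdist_sym in Q. specialize (HQ w ltac:(lra)). lra. }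
    assert (EG : forall w, Cmod (w - a) < r -> G w = Fin (finite_part (G w))).
    { intros w Hw. apply Fin_finite_part. specialize (HQG w Hw). lra. }
    destruct (H (fun w => finite_part (G w))) as [l [u [Hl [Hlin [Hu [Hun Eu]]]]]].
    + apply sphol_finite; [intros w Hw; apply HG, Hw|].
      intros w Hw E. rewrite EG in E by auto. discriminate.
    + intros w Hw. destruct (HG w Hw) as [_ Gw]. specialize (HQG w Hw).
      specialize (HQ w ltac:(lra)).
      assert (B := finite_part_sdist (G w) (F w) ltac:(lra) ltac:(lra)). unfold h. lra.
    + exists l. split; [auto|]. split; [auto|]. intros x Hx.
      apply (zmult_root_product G a x r l u); auto.
      intros w Hw. rewrite EG by auto. rewrite <- Eu by auto. reflexivity.
  - exists r1, 0%nat. split; [lra|]. intros rho Hrho. exists (1 / 20). split; [lra|].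
    intros G HG. exists nil. split; [reflexivity|]. split; [intros c []|].
    intros x Hx. simpl. apply zmult_nonzero_value. intros E.
    destruct (HG x Hx) as [_ Gx]. assert (Q := sphQ_sdist (G x) (F x)).
    rewrite E, sphQ_Fin_0 in Q. rewrite E in Gx. specialize (Hc x Hx).
    assert (Q' := sphQ_sdist (F x) (F a)). lra.
Qed.

(** * Translates of an almost periodic map *)

Definition translate (f : C -> Cbar) (s : R) : C -> Cbar := fun z => f (z + RtoC s)%C.

Definition close_on (U : C -> Prop) (F G : C -> Cbar) (e : R) : Prop :=
  forall z, U z -> sdist (F z) (G z) < e.

Lemma strip_convex (a b : Rbar) : convex (strip a b).
Proof.
  intros z w t [Hz1 Hz2] [Hw1 Hw2] Ht.
  assert (E : Im (w + RtoC t * (z - w))%C = (1 - t) * Im w + t * Im z) by (unfold Im; simpl; ring).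
  assert (B : Rmin (Im w) (Im z) <= (1 - t) * Im w + t * Im z <= Rmax (Im w) (Im z)).
  { unfold Rmin, Rmax. destruct (Rle_dec (Im w) (Im z)); nra. }
  unfold strip. rewrite E. split.
  - apply (Rbar_lt_le_trans _ (Rmin (Im w) (Im z))); [|apply B].
    unfold Rmin. destruct (Rle_dec _ _); auto.
  - apply (Rbar_le_lt_trans _ (Rmax (Im w) (Im z))); [apply B|].
    unfold Rmax. destruct (Rle_dec _ _); auto.
Qed.

Lemma strip_open (a b : Rbar) (z : C) : strip a b z -> exists r, 0 < r /\
  forall w, Cmod (w - z) < r -> strip a b w.
Proof.
  intros [H1 H2].
  assert (Him : forall w, Rabs (Im w - Im z) <= Cmod (w - z)).
  { intros w. eapply Rle_trans; [|apply Rmax_Cmod]. apply Rmax_r. }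
  assert (Ha : exists r, 0 < r /\ forall w, Cmod (w - z) < r -> Rbar_lt a (Im w)).
  { destruct a as [a| |]; simpl in *; [|contradiction|exists 1; split; [lra|auto]].
    exists (Im z - a). split; [lra|]. intros w Hw. specialize (Him w).
    apply Rabs_le_between in Him. lra. }
  assert (Hb : exists r, 0 < r /\ forall w, Cmod (w - z) < r -> Rbar_lt (Im w) b).
  { destruct b as [b| |]; simpl in *; [|exists 1; split; [lra|auto]|contradiction].
    exists (b - Im z). split; [lra|]. intros w Hw. specialize (Him w).
    apply Rabs_le_between in Him. lra. }
  destruct Ha as [r1 [Hr1 Ha]], Hb as [r2 [Hr2 Hb]]. exists_rmin r1 r2. intros w Hw. split.
  - apply Ha. apply (Rlt_le_trans _ _ _ Hw), Rmin_l.
  - apply Hb. apply (Rlt_le_trans _ _ _ Hw), Rmin_r.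
Qed.

Lemma strip_translate (a b : Rbar) (z : C) (t : R) : strip a b z -> strip a b (z + RtoC t)%C.
Proof. unfold strip. replace (Im (z + RtoC t)) with (Im z) by (unfold Im; simpl; ring). auto. Qed.

Lemma substrip (a b : Rbar) (alpha beta : R) (z : C) :
  Rbar_lt a alpha -> Rbar_lt beta b -> alpha <= Im z <= beta -> strip a b z.
Proof.
  intros Ha Hb Hz. split.
  - apply (Rbar_lt_le_trans _ _ _ Ha). simpl. lra.
  - apply (fun H => Rbar_le_lt_trans _ _ _ H Hb). simpl. lra.
Qed.

Lemma heine_rectangle (F : C -> Cbar) (x0 x1 y0 y1 : R) :
  (forall x y, x0 <= x <= x1 -> y0 <= y <= y1 -> scont F (x, y)) ->
  forall e, 0 < e -> exists d, 0 < d /\ forall z w, x0 <= Re z <= x1 -> y0 <= Im z <= y1 ->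
    Cmod (w - z) < d -> sdist (F w) (F z) < e.
Proof.
  intros HF e He.
  (* The gauge is a quarter of the radius of continuity: a point [z] within the
     gauge of [p] in both coordinates, and a point within the gauge of [z], are
     both within that radius of [p]. *)
  destruct (choice_function (fun (p : R * R) (d : posreal) =>
    x0 <= fst p <= x1 -> y0 <= snd p <= y1 ->
    forall w, Cmod (w - p) < 4 * d -> sdist (F w) (F p) < e / 2)) as [delta Hdelta].
  { intros [x y]. simpl fst. simpl snd. destruct (classic (x0 <= x <= x1 /\ y0 <= y <= y1)) as [[Hx Hy]|N].
    - destruct (HF x y Hx Hy (e / 2)) as [d [Hd H]]; [lra|].
      assert (Hd4 : 0 < d / 4) by lra. exists (mkposreal _ Hd4). intros _ _ w Hw.
      apply H. simpl in Hw. lra.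
    - exists (mkposreal 1 Rlt_0_1). intros Hx Hy. exfalso. auto. }
  destruct (compactness_value_2d x0 x1 y0 y1 (fun x y => delta (x, y))) as [d Hd].
  exists d. split; [apply cond_pos|]. intros z w Hx Hy Hw.
  specialize (Hd (Re z) (Im z) Hx Hy). apply NNPP in Hd.
  destruct Hd as [u [v [Hu [Hv [Hxu [Hyv Hdd]]]]]].
  assert (Hz : Cmod (z - (u, v)) < 2 * delta (u, v)).
  { destruct z as [x y]. eapply Rle_lt_trans; [apply Cmod_le_abs|]. simpl in *.
    unfold Rminus in *. lra. }
  assert (B1 := Hdelta (u, v) Hu Hv z ltac:(generalize (cond_pos (delta (u, v))); lra)).
  assert (T := Cmod_triangle_minus w z (u, v)).
  assert (B2 := Hdelta (u, v) Hu Hv w ltac:(generalize (cond_pos (delta (u, v))); lra)).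
  assert (T2 := sdist_triangle (F w) (F (u, v)) (F z)). rewrite (sdist_sym (F (u, v))) in T2. lra.
Qed.

Definition strip_almost_periodic (alpha beta : R) (f : C -> Cbar) : Prop :=
  forall e, 0 < e ->
    relatively_dense (fun tau => close_on (strip alpha beta) (translate f tau) f e).

(** Continuity up to the boundary of the strip, where compactness of rectangles
    is used. *)
Definition closed_strip_scont (alpha beta : R) (f : C -> Cbar) : Prop :=
  forall z, alpha <= Im z <= beta -> scont f z.

Lemma translate_close (alpha beta : R) (F G : C -> Cbar) (e t : R) :
  close_on (strip alpha beta) F G e ->
  close_on (strip alpha beta) (translate F t) (translate G t) e.
Proof. intros H z Hz. apply H, strip_translate, Hz. Qed.

Lemma close_on_sym (U : C -> Prop) (F G : C -> Cbar) (e : R) :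
  close_on U F G e -> close_on U G F e.
Proof. intros H z Hz. rewrite sdist_sym. apply H, Hz. Qed.

Lemma close_on_trans (U : C -> Prop) (F G H : C -> Cbar) (e e' : R) :
  close_on U F G e -> close_on U G H e' -> close_on U F H (e + e').
Proof.
  intros H1 H2 z Hz. assert (T := sdist_triangle (F z) (G z) (H z)).
  specialize (H1 z Hz). specialize (H2 z Hz). lra.
Qed.

Lemma close_on_le (U : C -> Prop) (F G : C -> Cbar) (e e' : R) :
  e <= e' -> close_on U F G e -> close_on U F G e'.
Proof. intros He H z Hz. specialize (H z Hz). lra. Qed.

Lemma translate_translate (f : C -> Cbar) (s t : R) (z : C) :
  translate (translate f s) t z = translate f (s + t) z.
Proof. unfold translate. f_equal. rewrite RtoC_plus. ring. Qed.

(** An almost period moves any point into a fixed compact rectangle, where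
    continuity is uniform. *)
Lemma strip_almost_periodic_uniform (alpha beta : R) (f : C -> Cbar) :
  closed_strip_scont alpha beta f -> strip_almost_periodic alpha beta f ->
  forall e, 0 < e -> exists d, 0 < d /\ forall h, Rabs h < d ->
    close_on (strip alpha beta) (translate f h) f e.
Proof.
  intros Hc Hap e He. destruct (Hap (e / 3)) as [L [HL HLt]]; [lra|].
  destruct (heine_rectangle f 0 L alpha beta) with (e := e / 3) as [d [Hd H]]; [|lra|].
  { intros x y _ Hy. apply Hc. exact Hy. }
  exists d. split; [auto|]. intros h Hh z Hz.
  destruct (HLt (- Re z)) as [tau [Ht Htau]].
  assert (B1 := Htau z Hz).
  assert (B2 := Htau (z + RtoC h)%C (strip_translate alpha beta z h Hz)).
  destruct Hz as [Hz1 Hz2]. simpl in Hz1, Hz2.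
  assert (B3 : sdist (translate f tau (z + RtoC h)%C) (translate f tau z) < e / 3).
  { apply H.
    - unfold Re, Im in *. simpl in *. lra.
    - unfold Re, Im in *. simpl in *. lra.
    - replace (z + RtoC h + RtoC tau - (z + RtoC tau))%C with (RtoC h) by ring.
      rewrite Cmod_R. exact Hh. }
  unfold translate at 1.
  assert (T1 := sdist_triangle (f (z + RtoC h)%C) (translate f tau (z + RtoC h)%C) (f z)).
  assert (T2 := sdist_triangle (translate f tau (z + RtoC h)%C) (translate f tau z) (f z)).
  rewrite (sdist_sym (f (z + RtoC h)%C) (translate f tau _)) in T1. lra.
Qed.

Lemma interval_net (L d : R) : 0 < L -> 0 < d -> exists cs : list R,
  forall x, 0 <= x <= L -> exists c, In c cs /\ Rabs (x - c) < d.
Proof.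
  intros HL Hd. destruct (nfloor_ex (L / (d / 2))) as [N HN].
  { apply Rdiv_le_0_compat; lra. }
  exists (map (fun k => INR k * (d / 2)) (seq 0 (S N))). intros x Hx.
  destruct (nfloor_ex (x / (d / 2))) as [k Hk]; [apply Rdiv_le_0_compat; lra|].
  exists (INR k * (d / 2)). split.
  - apply (in_map (fun k => INR k * (d / 2))). apply in_seq. split; [lia|]. simpl.
    apply INR_lt. rewrite S_INR. apply Rle_lt_trans with (x / (d / 2)); [lra|].
    apply Rle_lt_trans with (L / (d / 2)); [|lra].
    apply Rmult_le_compat_r; [left; apply Rinv_0_lt_compat; lra|lra].
  - assert (E : x = x / (d / 2) * (d / 2)) by (field; lra).
    rewrite E at 1. rewrite <- Rmult_minus_distr_r, Rabs_mult, (Rabs_pos_eq (d / 2)) by lra.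
    rewrite Rabs_pos_eq by lra. nra.
Qed.

(** An almost period in [[- s, - s + L]] replaces the translate by [s] with one by
    an amount between 0 and [L]; uniform continuity leaves finitely many. *)
Lemma translates_totally_bounded (alpha beta : R) (f : C -> Cbar) :
  closed_strip_scont alpha beta f -> strip_almost_periodic alpha beta f ->
  forall e, 0 < e -> exists cs : list R, forall s, exists c, In c cs /\
    close_on (strip alpha beta) (translate f s) (translate f c) e.
Proof.
  intros Hc Hap e He. destruct (Hap (e / 2)) as [L [HL HLt]]; [lra|].
  destruct (strip_almost_periodic_uniform alpha beta f Hc Hap (e / 2)) as [d [Hd Hu]]; [lra|].
  destruct (interval_net L d HL Hd) as [cs Hcs]. exists cs. intros s.
  destruct (HLt (- s)) as [tau [Ht Htau]].
  destruct (Hcs (s + tau)) as [c [Hin Hcd]]; [lra|].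
  exists c. split; [auto|]. intros z Hz.
  assert (B1 := translate_close _ _ _ _ _ s Htau z Hz).
  assert (B2 := translate_close _ _ _ _ _ c (Hu _ Hcd) z Hz).
  rewrite translate_translate in B1, B2.
  replace (tau + s) with (s + tau) in B1 by ring.
  replace (s + tau - c + c) with (s + tau) in B2 by ring.
  rewrite sdist_sym in B1.
  assert (T := sdist_triangle (translate f s z) (translate f (s + tau) z) (translate f c z)). lra.
Qed.

Definition unbounded (P : nat -> Prop) : Prop := forall N, exists n, (N <= n)%nat /\ P n.

Lemma unbounded_pigeonhole (P : nat -> Prop) (A : R -> nat -> Prop) (cs : list R) :
  unbounded P -> (forall n, P n -> exists c, In c cs /\ A c n) ->
  exists c, unbounded (fun n => P n /\ A c n).
Proof.
  revert P. induction cs as [|c cs IH]; intros P HP Hcov.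
  - destruct (HP 0%nat) as [n [_ Hn]]. destruct (Hcov n Hn) as [c [[] _]].
  - destruct (classic (unbounded (fun n => P n /\ A c n))) as [Hy|Hn]; [eauto|].
    apply not_all_ex_not in Hn. destruct Hn as [N HN].
    destruct (IH (fun n => P n /\ (N <= n)%nat)) as [c' Hc'].
    + intros M. destruct (HP (Nat.max M N)) as [n [Hn1 Hn2]]. exists n. split; [lia|].
      split; [auto|lia].
    + intros n [Hn1 Hn2]. destruct (Hcov n Hn1) as [x [[<-|Hx] HA]]; [|eauto].
      exfalso. apply HN. exists n. auto.
    + exists c'. intros M. destruct (Hc' M) as [n [Hn [[H1 _] H2]]]. eauto.
Qed.

(** The coordinates converge, and the equation of the sphere is closed. *)
Lemma sdist_complete (u : nat -> Cbar) :
  (forall e, 0 < e -> exists N, forall m n, (N <= m)%nat -> (N <= n)%nat -> sdist (u m) (u n) < e) ->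
  exists v, forall e, 0 < e -> exists N, forall n, (N <= n)%nat -> sdist (u n) v < e.
Proof.
  intros Hu.
  assert (Hlim : forall c : Cbar -> R, (forall x y, Rabs (c x - c y) <= sdist x y) ->
    exists l, Un_cv (fun n => c (u n)) l).
  { intros c Hc. assert (HC : Cauchy_crit (fun n => c (u n))).
    { intros e He. destruct (Hu e He) as [N HN]. exists N. intros m n Hm Hn.
      eapply Rle_lt_trans; [apply Hc|]. apply HN; lia. }
    destruct (Rcomplete.R_complete _ HC) as [l Hl]. eauto. }
  destruct (Hlim (fun x => Re (sphP x))) as [p1 H1].
  { intros x y. unfold sdist. assert (B := re_le_Cmod (sphP x - sphP y)).
    assert (G := Rabs_pos (sphQ x - sphQ y)).
    replace (Re (sphP x) - Re (sphP y)) with (Re (sphP x - sphP y)%C) by (unfold Re; simpl; ring).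
    lra. }
  destruct (Hlim (fun x => Im (sphP x))) as [p2 H2].
  { intros x y. unfold sdist. assert (B := Rle_trans _ _ _ (Rmax_r _ _) (Rmax_Cmod (sphP x - sphP y)%C)).
    assert (G := Rabs_pos (sphQ x - sphQ y)).
    replace (Im (sphP x) - Im (sphP y)) with (snd (sphP x - sphP y)%C) by (unfold Im; simpl; ring).
    lra. }
  destruct (Hlim sphQ) as [q H3].
  { intros x y. unfold sdist. assert (G := Cmod_ge_0 (sphP x - sphP y)). lra. }
  destruct (sphere_coordinates_surj (p1, p2) q) as [v [Ev1 Ev2]].
  { rewrite Cmod_sqr. simpl fst. simpl snd.
    apply (UL_sequence (fun n => sphQ (u n) * (1 - sphQ (u n)))).
    - apply (Un_cv_ext (fun n => Re (sphP (u n)) * Re (sphP (u n))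
                                + Im (sphP (u n)) * Im (sphP (u n)))).
      + intros n. rewrite <- sphP_sqr, Cmod_sqr. unfold Re, Im. ring.
      + replace (p1 ^ 2 + p2 ^ 2) with (p1 * p1 + p2 * p2) by ring.
        apply CV_plus; apply CV_mult; auto.
    - apply CV_mult; [auto|]. apply CV_minus; [|auto].
      intros e He. exists 0%nat. intros n _. unfold Rdist. rewrite Rminus_diag, Rabs_R0. exact He. }
  exists v. intros e He.
  destruct (H1 (e / 3)) as [N1 HN1]; [lra|]. destruct (H2 (e / 3)) as [N2 HN2]; [lra|].
  destruct (H3 (e / 3)) as [N3 HN3]; [lra|].
  exists (Nat.max N1 (Nat.max N2 N3)). intros n Hn.
  specialize (HN1 n ltac:(lia)). specialize (HN2 n ltac:(lia)). specialize (HN3 n ltac:(lia)).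
  unfold Rdist in *. unfold sdist. rewrite Ev1, Ev2.
  assert (B := Cmod_le_abs (Re (sphP (u n)) - p1) (Im (sphP (u n)) - p2)).
  replace (sphP (u n) - (p1, p2))%C
    with ((Re (sphP (u n)) - p1)%R, (Im (sphP (u n)) - p2)%R)
    by (apply injective_projections; simpl; unfold Re, Im; ring). lra.
Qed.

Lemma inv_INR_small (e : R) : 0 < e -> exists N, forall n, (N <= n)%nat -> / (INR n + 1) < e.
Proof.
  intros He. destruct (nfloor_ex (/ e)) as [N HN]; [left; apply Rinv_0_lt_compat; auto|].
  exists N. intros n Hn. apply le_INR in Hn. rewrite <- (Rinv_inv e).
  assert (0 < / e) by (apply Rinv_0_lt_compat; auto).
  apply Rinv_lt_contravar; [nra|lra].
Qed.

(** Bochner's compactness: repeated use of the pigeonhole principle yields a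
    decreasing sequence of index sets on which the translates oscillate less
    and less. *)
Lemma bochner (alpha beta : R) (f : C -> Cbar) (s : nat -> R) :
  closed_strip_scont alpha beta f -> strip_almost_periodic alpha beta f ->
  exists F, forall e, 0 < e -> forall N, exists n, (N <= n)%nat /\
    close_on (strip alpha beta) (translate f (s n)) F e.
Proof.
  intros Hc Hap. set (U := strip alpha beta) in *.
  assert (step : forall (k : nat) (P : nat -> Prop), unbounded P -> exists Q, unbounded Q /\
    (forall n, Q n -> P n) /\ exists c, forall n, Q n ->
      close_on U (translate f (s n)) (translate f c) (/ (INR k + 1))).
  { intros k P HP.
    destruct (translates_totally_bounded alpha beta f Hc Hap (/ (INR k + 1))) as [cs Hcs].
    { apply Rinv_0_lt_compat. generalize (pos_INR k). lra. }
    destruct (unbounded_pigeonhole P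
      (fun c n => close_on U (translate f (s n)) (translate f c) (/ (INR k + 1))) cs HP)
      as [c Hc']; [intros n _; apply Hcs|].
    eexists. split; [exact Hc'|]. split; [tauto|]. exists c. tauto. }
  destruct (dependent_choice (fun _ => unbounded) _ (fun _ => True)
    (fun N => ex_intro _ N (conj (Nat.le_refl N) I)) step) as [Pk [_ HPk]].
  assert (Hdec : forall k j n, Pk (k + j)%nat n -> Pk k n).
  { intros k j n. induction j as [|j IH]; [rewrite Nat.add_0_r; auto|].
    rewrite Nat.add_succ_r. intros H. apply IH, (HPk (k + j)%nat), H. }
  assert (Hosc : forall k n m, Pk (S k) n -> Pk (S k) m ->
    close_on U (translate f (s n)) (translate f (s m)) (2 * / (INR k + 1))).
  { intros k n m Hn Hm. destruct (proj2 (HPk k)) as [_ [c Hc']].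
    replace (2 * / (INR k + 1)) with (/ (INR k + 1) + / (INR k + 1)) by ring.
    eapply close_on_trans; [apply Hc', Hn|apply close_on_sym, Hc', Hm]. }
  destruct (choice_function (fun k n => (k <= n)%nat /\ Pk k n)) as [nk Hnk].
  { intros k. apply (proj1 (HPk k) k). }
  assert (Hosc' : forall K j k, (S K <= j)%nat -> (S K <= k)%nat ->
    close_on U (translate f (s (nk j))) (translate f (s (nk k))) (2 * / (INR K + 1))).
  { intros K j k Hj Hk. apply Hosc.
    - apply (Hdec (S K) (j - S K)%nat). replace (S K + (j - S K))%nat with j by lia. apply Hnk.
    - apply (Hdec (S K) (k - S K)%nat). replace (S K + (k - S K))%nat with k by lia. apply Hnk. }
  destruct (choice_function (fun z v => U z -> forall e, 0 < e -> exists N, forall k,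
    (N <= k)%nat -> sdist (translate f (s (nk k)) z) v < e)) as [F HF].
  { intros z. destruct (classic (U z)) as [Hz|N]; [|exists Inf; intros Hz; contradiction].
    destruct (sdist_complete (fun k => translate f (s (nk k)) z)) as [v Hv]; [|eauto].
    intros e He. destruct (inv_INR_small (e / 2)) as [K HK]; [lra|].
    exists (S K). intros j k Hj Hk. assert (B := Hosc' K j k Hj Hk z Hz).
    specialize (HK K (Nat.le_refl K)). lra. }
  exists F. intros e He N. destruct (inv_INR_small (e / 4)) as [K HK]; [lra|].
  specialize (HK K (Nat.le_refl K)).
  exists (nk (Nat.max N (S K))). split.
  - destruct (Hnk (Nat.max N (S K))) as [H _]. lia.
  - intros z Hz. destruct (HF z Hz (e / 4)) as [M HM]; [lra|].
    specialize (HM (Nat.max M (S K)) ltac:(lia)).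
    assert (B := Hosc' K (Nat.max N (S K)) (Nat.max M (S K)) ltac:(lia) ltac:(lia) z Hz).
    assert (T := sdist_triangle (translate f (s (nk (Nat.max N (S K)))) z)
      (translate f (s (nk (Nat.max M (S K)))) z) (F z)). lra.
Qed.

Definition nowhere_zero_near (U : C -> Prop) (F : C -> Cbar) : Prop :=
  forall a, U a -> ~ (exists s, 0 < s /\ forall w, Cmod (w - a) < s -> F w = Fin 0).

Lemma strip_nonempty (alpha beta : R) : alpha < beta -> strip alpha beta (0, (alpha + beta) / 2).
Proof. intros H. split; simpl; lra. Qed.

(** A limit of translates that vanishes on a disc vanishes on the whole strip, so
    that [f] has translates that are arbitrarily small on the strip, uniformly. The
    strip being invariant under translation, [f] itself is then zero. *)
Lemma limit_of_translates (a b : Rbar) (alpha beta : R) (f F : C -> Cbar) :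
  Rbar_lt a alpha -> alpha < beta -> Rbar_lt beta b ->
  (forall z, strip a b z -> sphol f z) -> ~ (forall z, strip a b z -> f z = Fin 0) ->
  (forall e, 0 < e -> exists s, close_on (strip alpha beta) (translate f s) F e) ->
  (forall z, strip alpha beta z -> sphol F z) /\ nowhere_zero_near (strip alpha beta) F.
Proof.
  intros Ha Hab Hb Hf Hnz HF.
  assert (Hsub : forall z, strip alpha beta z -> strip a b z).
  { intros z [H1 H2]. simpl in *. apply (substrip a b alpha beta); auto. lra. }
  assert (HFs : forall z, strip alpha beta z -> sphol F z).
  { intros z Hz. destruct (strip_open _ _ z Hz) as [r [Hr Hin]].
    apply (sphol_limit F z r Hr). intros e He. destruct (HF e He) as [s Hs].
    exists (translate f s). intros w Hw. split; [|apply Hs, Hin, Hw].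
    apply sphol_translate, Hf, Hsub, strip_translate, Hin, Hw. }
  split; [exact HFs|]. intros z0 Hz0 [s0 [Hs0 Hzero]]. apply Hnz.
  assert (HF0 := sphol_identity F (strip alpha beta) z0 s0 (strip_convex _ _) HFs Hz0 Hs0 Hzero).
  assert (Hf0 : forall z, strip alpha beta z -> f z = Fin 0).
  { intros z Hz. apply sdist_eq_0. apply Rle_antisym; [|apply sdist_nonneg].
    apply Rnot_lt_le. intros Hpos. destruct (HF _ Hpos) as [s Hs].
    assert (Hz' := strip_translate alpha beta z (- s) Hz). specialize (Hs _ Hz').
    rewrite (HF0 _ Hz') in Hs. unfold translate in Hs.
    replace (z + RtoC (- s) + RtoC s)%C with z in Hs by (rewrite RtoC_opp; ring). lra. }
  assert (Hm := strip_nonempty alpha beta Hab).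
  destruct (strip_open _ _ _ Hm) as [r [Hr Hin]].
  apply (sphol_identity f (strip a b) _ r (strip_convex _ _) Hf (Hsub _ Hm) Hr).
  intros w Hw. apply Hf0, Hin, Hw.
Qed.

(** * Sums over zeros *)

Definition csum {T : Type} (l : list T) (F : T -> C) : C := fold_right Cplus 0 (map F l).

(** Any list containing the support of [F] may be used, not only the support
    itself; this makes the notion additive in [F]. *)
Definition fsum (F : C -> C) (s : C) : Prop :=
  exists l, NoDup l /\ (forall x, F x <> 0 -> In x l) /\ s = csum l F.

Definition nonzero_at (F : C -> C) (x : C) : bool := if Ceq_dec (F x) 0 then false else true.

Lemma nonzero_at_spec (F : C -> C) (x : C) : nonzero_at F x = true <-> F x <> 0.
Proof. unfold nonzero_at. destruct (Ceq_dec (F x) 0); split; congruence. Qed.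

Lemma csum_cons {T : Type} (x : T) (l : list T) (F : T -> C) :
  csum (x :: l) F = (F x + csum l F)%C.
Proof. reflexivity. Qed.

Lemma csum_filter (F : C -> C) (l : list C) : csum (filter (nonzero_at F) l) F = csum l F.
Proof.
  induction l as [|x l IH]; [reflexivity|]. simpl filter. unfold nonzero_at at 1.
  destruct (Ceq_dec (F x) 0) as [E|N]; rewrite !csum_cons, IH; [rewrite E; ring|reflexivity].
Qed.

Lemma csum_perm {T : Type} (F : T -> C) (l l' : list T) :
  Permutation l l' -> csum l F = csum l' F.
Proof.
  intros H. induction H; [reflexivity| | |congruence]; rewrite !csum_cons.
  - congruence.
  - ring.
Qed.

Lemma csum_ext {T : Type} (F G : T -> C) (l : list T) :
  (forall x, In x l -> F x = G x) -> csum l F = csum l G.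
Proof.
  induction l as [|x l IH]; intros H; [reflexivity|]. rewrite !csum_cons.
  rewrite H by (left; auto). rewrite IH; [reflexivity|]. intros y Hy. apply H. right. auto.
Qed.

Lemma csum_plus {T : Type} (F G : T -> C) (l : list T) :
  csum l (fun x => F x + G x)%C = (csum l F + csum l G)%C.
Proof. induction l as [|x l IH]; rewrite ?csum_cons, ?IH; unfold csum; simpl; ring. Qed.

Lemma csum_scal {T : Type} (c : C) (F : T -> C) (l : list T) :
  csum l (fun x => c * F x)%C = (c * csum l F)%C.
Proof. induction l as [|x l IH]; rewrite ?csum_cons, ?IH; unfold csum; simpl; ring. Qed.

Lemma csum_covering (F : C -> C) (l l' : list C) :
  NoDup l -> NoDup l' -> (forall x, F x <> 0 -> In x l) -> (forall x, F x <> 0 -> In x l') ->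
  csum l F = csum l' F.
Proof.
  intros N N' H H'. rewrite <- (csum_filter F l), <- (csum_filter F l').
  apply csum_perm, NoDup_Permutation; auto using NoDup_filter.
  intros x. rewrite !filter_In, !nonzero_at_spec. split; intros [_ Hx]; auto.
Qed.

Lemma fsum_unique (F : C -> C) (s s' : C) : fsum F s -> fsum F s' -> s = s'.
Proof.
  intros [l [N [H ->]]] [l' [N' [H' ->]]]. apply csum_covering; auto.
Qed.

Lemma fsum_ext (F G : C -> C) (s : C) : (forall x, F x = G x) -> fsum F s -> fsum G s.
Proof.
  intros E [l [N [H ->]]]. exists l. split; [auto|]. split.
  - intros x Hx. apply H. rewrite E. exact Hx.
  - apply csum_ext. auto.
Qed.

Lemma fsum_plus (F G : C -> C) (s t : C) :
  fsum F s -> fsum G t -> fsum (fun x => F x + G x)%C (s + t).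
Proof.
  intros [l [N [H ->]]] [l' [N' [H' ->]]]. set (u := nodup Ceq_dec (l ++ l')).
  assert (Nu : NoDup u) by apply NoDup_nodup.
  assert (H1 : forall x, F x <> 0 -> In x u).
  { intros x Hx. apply nodup_In, in_or_app. auto. }
  assert (H2 : forall x, G x <> 0 -> In x u).
  { intros x Hx. apply nodup_In, in_or_app. auto. }
  exists u. split; [auto|]. split.
  - intros x Hx. destruct (Ceq_dec (F x) 0) as [E|N1]; [|auto]. apply H2. intros E'.
    apply Hx. rewrite E, E'. ring.
  - rewrite csum_plus, (csum_covering F l u), (csum_covering G l' u); auto.
Qed.

Lemma fsum_scal (c : C) (F : C -> C) (s : C) : fsum F s -> fsum (fun x => c * F x)%C (c * s).
Proof.
  intros [l [N [H ->]]]. exists l. split; [auto|]. split.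
  - intros x Hx. apply H. intros E. apply Hx. rewrite E. ring.
  - symmetry. apply csum_scal.
Qed.

Lemma fsum_zero (F : C -> C) : (forall x, F x = 0) -> fsum F 0.
Proof.
  intros H. exists nil. split; [constructor|]. split; [|reflexivity]. intros x Hx.
  exfalso. auto.
Qed.

Lemma csum_single (u : list C) (c : C) (v : C) :
  NoDup u -> csum u (fun x => if Ceq_dec c x then v else 0) = if in_dec Ceq_dec c u then v else 0.
Proof.
  induction u as [|y u IH]; intros N; [reflexivity|]. inversion N as [|? ? Ny Nu]; subst.
  rewrite csum_cons, IH by auto. simpl.
  destruct (Ceq_dec c y) as [E|E]; destruct (Ceq_dec y c) as [E'|E']; try congruence; subst.
  - destruct (in_dec Ceq_dec y u); [contradiction|]. ring.
  - destruct (in_dec Ceq_dec c u); ring.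
Qed.

(** Hurwitz's theorem yields zeros as lists with repetitions, whereas a divisor
    lists each point once, with its multiplicity. *)
Lemma csum_count_occ (l u : list C) (chi : C -> C) :
  NoDup u -> incl l u ->
  csum u (fun x => RtoC (INR (count_occ Ceq_dec l x)) * chi x)%C = csum l chi.
Proof.
  intros N. induction l as [|c l IH]; intros Hin.
  - transitivity (csum u (fun x => 0 * chi x)%C); [reflexivity|]. rewrite csum_scal.
    change (csum [] chi) with (RtoC 0). ring.
  - rewrite csum_cons, <- IH by (intros x Hx; apply Hin; right; auto).
    rewrite (csum_ext _ (fun x => (if Ceq_dec c x then chi c else 0)
      + RtoC (INR (count_occ Ceq_dec l x)) * chi x)%C).
    + rewrite csum_plus, csum_single by auto.
      destruct (in_dec Ceq_dec c u) as [_|Nn]; [reflexivity|].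
      exfalso. apply Nn, Hin. left. auto.
    + intros x _. simpl. destruct (Ceq_dec c x) as [->|Nx]; [|ring].
      rewrite S_INR, RtoC_plus. ring.
Qed.

Lemma fsum_count_occ (l : list C) (chi : C -> C) :
  fsum (fun x => RtoC (INR (count_occ Ceq_dec l x)) * chi x)%C (csum l chi).
Proof.
  exists (nodup Ceq_dec l). split; [apply NoDup_nodup|]. split.
  - intros x Hx. apply nodup_In. apply (count_occ_In Ceq_dec).
    destruct (count_occ Ceq_dec l x) as [|n]; [|lia]. exfalso. apply Hx. simpl. ring.
  - symmetry. apply csum_count_occ; [apply NoDup_nodup|]. intros x Hx. apply nodup_In, Hx.
Qed.

Lemma csum_near (l : list C) (chi : C -> C) (v : C) (e : R) :
  (forall c, In c l -> Cmod (chi c - v) <= e) ->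
  Cmod (csum l chi - RtoC (INR (length l)) * v) <= INR (length l) * e.
Proof.
  induction l as [|c l IH]; intros H.
  - simpl. replace (csum [] chi - 0 * v)%C with (RtoC 0)
      by (change (csum [] chi) with (RtoC 0); ring). rewrite Cmod_0. lra.
  - simpl length. rewrite csum_cons, S_INR, RtoC_plus.
    replace (chi c + csum l chi - (RtoC (INR (length l)) + RtoC 1) * v)%C
      with ((chi c - v) + (csum l chi - RtoC (INR (length l)) * v))%C by ring.
    eapply Rle_trans; [apply Cmod_triangle|].
    assert (B1 := H c (or_introl eq_refl)).
    assert (B2 := IH (fun x Hx => H x (or_intror Hx))). lra.
Qed.

Definition zero_sum (G : C -> Cbar) (chi : C -> C) : C -> Prop :=
  fsum (fun x => RtoC (INR (zmult G x)) * chi x)%C.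

(** Continuity of the zero sum at [F]. The limit [s0] is left unspecified, and may
    depend on [e], so that the property is additive in [chi] without computing it. *)
Definition stable_sum (U : C -> Prop) (F : C -> Cbar) (chi : C -> C) : Prop :=
  forall e, 0 < e -> exists d s0, 0 < d /\ forall G,
    (forall z, U z -> sphol G z) -> close_on U G F d ->
    exists s, zero_sum G chi s /\ Cmod (s - s0) < e.

Lemma stable_sum_zero (U : C -> Prop) (F : C -> Cbar) (chi : C -> C) :
  (forall x, chi x = 0) -> stable_sum U F chi.
Proof.
  intros H e He. exists 1, (RtoC 0). split; [lra|]. intros G _ _. exists (RtoC 0). split.
  - apply fsum_zero. intros x. rewrite H. ring.
  - rewrite Cmod_self_minus. exact He.
Qed.

Lemma stable_sum_ext (U : C -> Prop) (F : C -> Cbar) (chi psi : C -> C) :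
  (forall x, chi x = psi x) -> stable_sum U F chi -> stable_sum U F psi.
Proof.
  intros E H e He. destruct (H e He) as [d [s0 [Hd HG]]]. exists d, s0. split; [auto|].
  intros G H1 H2. destruct (HG G H1 H2) as [s [Hs Hse]]. exists s. split; [|auto].
  apply (fsum_ext _ _ _ (fun x => f_equal (Cmult (RtoC (INR (zmult G x)))) (E x))), Hs.
Qed.

Lemma stable_sum_plus (U : C -> Prop) (F : C -> Cbar) (chi psi : C -> C) :
  stable_sum U F chi -> stable_sum U F psi -> stable_sum U F (fun x => chi x + psi x)%C.
Proof.
  intros H H' e He.
  destruct (H (e / 2)) as [d [s0 [Hd HG]]]; [lra|].
  destruct (H' (e / 2)) as [d' [s0' [Hd' HG']]]; [lra|].
  exists (Rmin d d'), (s0 + s0')%C. split; [apply Rmin_pos; auto|]. intros G H1 H2.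
  destruct (HG G H1 (close_on_le _ _ _ _ _ (Rmin_l d d') H2)) as [s [Hs Hse]].
  destruct (HG' G H1 (close_on_le _ _ _ _ _ (Rmin_r d d') H2)) as [s' [Hs' Hse']].
  exists (s + s')%C. split.
  - apply (fsum_ext (fun x => RtoC (INR (zmult G x)) * chi x + RtoC (INR (zmult G x)) * psi x)%C).
    + intros x. ring.
    + apply fsum_plus; auto.
  - replace (s + s' - (s0 + s0'))%C with ((s - s0) + (s' - s0'))%C by ring.
    eapply Rle_lt_trans; [apply Cmod_triangle|]. lra.
Qed.

(** A function concentrated where [F] has no zero but [a] sees [m] zeros of each
    nearby map, all of them close to [a]. *)
Lemma stable_sum_local (U : C -> Prop) (F : C -> Cbar) (a : C) (r0 : R) :
  0 < r0 -> (forall w, Cmod (w - a) < r0 -> U w) -> sphol F a ->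
  ~ (exists s, 0 < s /\ forall w, Cmod (w - a) < s -> F w = Fin 0) ->
  exists r, 0 < r /\ forall chi, Ccont chi a ->
    (forall x, chi x <> 0 -> Cmod (x - a) < r) -> stable_sum U F chi.
Proof.
  intros Hr0 HU HF Hnz.
  destruct (zeros_stable F a r0 Hr0 HF Hnz) as [r [m [Hr H]]].
  exists r. split; [lra|]. intros chi Hchi Hsupp e He.
  assert (Hm : 0 < INR m + 1) by (generalize (pos_INR m); lra).
  destruct (Hchi (e / (INR m + 1))) as [rho [Hrho Hc]]; [apply Rdiv_lt_0_compat; auto|].
  destruct (H rho Hrho) as [d [Hd HG]]. exists d, (RtoC (INR m) * chi a)%C.
  split; [auto|]. intros G HGs HGd.
  destruct (HG G) as [l [Hl [Hlin Hlc]]].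
  { intros w Hw. split; [apply HGs|apply HGd]; apply HU; lra. }
  exists (csum l chi). split.
  - apply (fsum_ext (fun x => RtoC (INR (count_occ Ceq_dec l x)) * chi x)%C);
      [|apply fsum_count_occ].
    intros x. destruct (Ceq_dec (chi x) 0) as [E|N]; [rewrite E; ring|].
    rewrite (Hlc x (Hsupp x N)). reflexivity.
  - rewrite <- Hl. apply Rle_lt_trans with (INR (length l) * (e / (INR m + 1))).
    + apply csum_near. intros c Hcin. left. apply Hc, Hlin, Hcin.
    + rewrite Hl. apply Rmult_lt_reg_r with (INR m + 1); [auto|].
      replace (INR m * (e / (INR m + 1)) * (INR m + 1)) with (INR m * e) by (field; lra). nra.
Qed.

Lemma stable_sum_csum (U : C -> Prop) (F : C -> Cbar) (ls : list C) (psi : C -> C -> C) :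
  (forall c, In c ls -> stable_sum U F (psi c)) ->
  stable_sum U F (fun x => csum ls (fun c => psi c x)).
Proof.
  induction ls as [|c ls IH]; intros H.
  - apply stable_sum_zero. reflexivity.
  - apply (stable_sum_ext U F (fun x => psi c x + csum ls (fun c' => psi c' x))%C); [reflexivity|].
    apply stable_sum_plus; [apply H; left; auto|]. apply IH. intros c' Hc'. apply H. right. auto.
Qed.

Lemma support_intro (chi : C -> C) (z : C) : chi z <> 0 -> support chi z.
Proof.
  intros H Hl. apply H. apply locally_Cmod in Hl. destruct Hl as [d [Hd Hl]].
  apply Hl. rewrite Cmod_self_minus. exact Hd.
Qed.

Definition tent (c : C) (r : R) (w : C) : R := Rmax 0 (r - Cmod (w - c)).

Lemma tent_cont (c : C) (r : R) (z : C) : Ccont (fun w => RtoC (tent c r w)) z.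
Proof.
  intros e He. exists e. split; [auto|]. intros w Hw. rewrite <- RtoC_minus, Cmod_R.
  eapply Rle_lt_trans; [|exact Hw].
  assert (T1 := Cmod_triangle_minus w z c). assert (T2 := Cmod_triangle_minus z w c).
  rewrite (Cmod_minus_sym z w) in T2.
  unfold tent, Rmax. apply Rabs_le.
  destruct (Rle_dec 0 (r - Cmod (w - c))); destruct (Rle_dec 0 (r - Cmod (z - c))); lra.
Qed.

Lemma tent_nonneg (c : C) (r : R) (w : C) : 0 <= tent c r w.
Proof. apply Rmax_l. Qed.

Lemma tent_pos (c : C) (r : R) (w : C) : 0 < tent c r w <-> Cmod (w - c) < r.
Proof. unfold tent, Rmax. destruct (Rle_dec 0 (r - Cmod (w - c))); lra. Qed.

Definition tent_total (r : C -> R) (ls : list C) (w : C) : R :=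
  fold_right Rplus 0 (map (fun c => tent c (r c) w) ls).

Lemma tent_total_cont (r : C -> R) (ls : list C) (z : C) :
  Ccont (fun w => RtoC (tent_total r ls w)) z.
Proof.
  induction ls as [|c ls IH]; [exact (Ccont_const (RtoC 0) z)|].
  apply (Ccont_near (fun w => RtoC (tent c (r c) w) + RtoC (tent_total r ls w))%C _ z 1); [lra| |].
  - intros w _. rewrite <- RtoC_plus. reflexivity.
  - apply Ccont_plus; [apply tent_cont|exact IH].
Qed.

Lemma tent_total_nonneg (r : C -> R) (ls : list C) (w : C) : 0 <= tent_total r ls w.
Proof.
  induction ls as [|c ls IH]; [apply Rle_refl|].
  change (0 <= tent c (r c) w + tent_total r ls w). generalize (tent_nonneg c (r c) w). lra.
Qed.

Lemma tent_total_pos (r : C -> R) (ls : list C) (w c : C) :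
  In c ls -> Cmod (w - c) < r c -> 0 < tent_total r ls w.
Proof.
  intros Hin Hw. apply tent_pos in Hw. induction ls as [|c' ls IH]; [contradiction|].
  change (0 < tent c' (r c') w + tent_total r ls w).
  assert (G1 := tent_nonneg c' (r c') w). assert (G2 := tent_total_nonneg r ls w).
  destruct Hin as [->|Hin]; [lra|]. specialize (IH Hin). lra.
Qed.

Lemma tent_total_csum (r : C -> R) (ls : list C) (w : C) :
  RtoC (tent_total r ls w) = csum ls (fun c => RtoC (tent c (r c) w)).
Proof.
  induction ls as [|c ls IH]; [reflexivity|]. rewrite csum_cons, <- IH, <- RtoC_plus. reflexivity.
Qed.

(** The local statements are glued with a partition of unity subordinate to a
    finite cover of the support by discs; continuity of its members is used at the
    centres of the discs. *)
Lemma stable_sum_global (U : C -> Prop) (F : C -> Cbar) (chi : C -> C) :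
  (forall z, U z -> exists r, 0 < r /\ forall w, Cmod (w - z) < r -> U w) ->
  (forall z, U z -> sphol F z) -> nowhere_zero_near U F ->
  (forall z, Ccont chi z) -> compact_set (support chi) -> (forall z, support chi z -> U z) ->
  stable_sum U F chi.
Proof.
  intros HUo HF Hnz Hchi Hcomp Hsupp.
  assert (Hrad : forall a, exists r, (~ U a -> r = 0) /\ (U a -> 0 < r /\
    forall psi, Ccont psi a -> (forall x, psi x <> 0 -> Cmod (x - a) < r) -> stable_sum U F psi)).
  { intros a. destruct (classic (U a)) as [Ha|N].
    - destruct (HUo a Ha) as [r0 [Hr0 Hin]].
      destruct (stable_sum_local U F a r0 Hr0 Hin (HF a Ha) (Hnz a Ha)) as [r Hr].
      exists r. split; [contradiction|auto].
    - exists 0. split; [auto|contradiction]. }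
  destruct (choice_function _ Hrad) as [r Hr].
  destruct (Hcomp C (fun c w => Cmod (w - c) < r c)) as [ls Hls].
  { intros c w Hw. apply locally_Cmod. exists (r c - Cmod (w - c)). split; [lra|].
    intros v Hv. assert (T := Cmod_triangle_minus v w c). lra. }
  { intros z Hz. exists z. rewrite Cmod_self_minus. apply (Hr z), Hsupp, Hz. }
  apply (stable_sum_ext U F (fun x => csum ls (fun c =>
    chi x * (RtoC (tent c (r c) x) * / RtoC (tent_total r ls x))))%C).
  - intros x. rewrite csum_scal.
    rewrite (csum_ext _ (fun c => / RtoC (tent_total r ls x) * RtoC (tent c (r c) x))%C)
      by (intros; ring).
    rewrite csum_scal, <- tent_total_csum.
    destruct (Ceq_dec (chi x) 0) as [E|N]; [rewrite E; ring|].
    destruct (Hls x (support_intro chi x N)) as [c [Hin Hc]].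
    assert (P := tent_total_pos r ls x c Hin Hc). field. apply RtoC_neq_0. lra.
  - apply stable_sum_csum. intros c Hin. destruct (classic (U c)) as [Hc|N].
    + destruct (proj2 (Hr c) Hc) as [Hrc Hloc]. apply Hloc.
      * apply Ccont_mult; [apply Hchi|]. apply Ccont_mult; [apply tent_cont|].
        apply Ccont_inv; [apply tent_total_cont|]. apply RtoC_neq_0, Rgt_not_eq.
        apply (tent_total_pos r ls c c Hin). rewrite Cmod_self_minus. exact Hrc.
      * intros x Hx. apply tent_pos. destruct (tent_nonneg c (r c) x) as [L|E]; [auto|].
        exfalso. apply Hx. rewrite <- E. ring.
    + apply stable_sum_zero. intros x.
      assert (E : tent c (r c) x = 0).
      { rewrite (proj1 (Hr c) N). unfold tent. apply Rmax_left.
        generalize (Cmod_ge_0 (x - c)). lra. }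
      rewrite E. ring.
Qed.

(** If no [d] worked for some [e], the offending translates would accumulate at a
    limit [F], where the zero sum is continuous. *)
Lemma zero_sum_translates (a b : Rbar) (alpha beta : R) (f : C -> Cbar) (chi : C -> C) :
  Rbar_lt a alpha -> alpha < beta -> Rbar_lt beta b ->
  (forall z, strip a b z -> sphol f z) -> ~ (forall z, strip a b z -> f z = Fin 0) ->
  strip_almost_periodic alpha beta f ->
  (forall z, Ccont chi z) -> compact_set (support chi) ->
  (forall z, support chi z -> strip alpha beta z) ->
  (forall s, exists sigma, zero_sum (translate f s) chi sigma) /\
  forall e, 0 < e -> exists d, 0 < d /\ forall s s' sigma sigma',
    close_on (strip alpha beta) (translate f s) (translate f s') d ->
    zero_sum (translate f s) chi sigma -> zero_sum (translate f s') chi sigma' ->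
    Cmod (sigma - sigma') < e.
Proof.
  intros Ha Hab Hb Hf Hnz Hap Hchi Hcomp Hsupp. set (U := strip alpha beta) in *.
  assert (Hstable : forall F, (forall e, 0 < e -> exists s, close_on U (translate f s) F e) ->
    stable_sum U F chi).
  { intros F HF.
    destruct (limit_of_translates a b alpha beta f F Ha Hab Hb Hf Hnz HF) as [HFs HFn].
    apply stable_sum_global; auto. apply strip_open. }
  assert (Htr : forall s z, U z -> sphol (translate f s) z).
  { intros s z Hz. apply sphol_translate, Hf, strip_translate. destruct Hz as [H1 H2].
    simpl in *. apply (substrip a b alpha beta); auto. lra. }
  assert (Hself : forall F e, 0 < e -> close_on U F F e).
  { intros F e He z _. rewrite sdist_self. exact He. }
  split.
  - intros s. destruct (Hstable (translate f s)) with (e := 1) as [d [s0 [Hd H]]]; [eauto|lra|].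
    destruct (H (translate f s)) as [sigma [Hs _]]; eauto.
  - intros e He. apply NNPP. intros Hno.
    assert (Hbad : forall n : nat, exists s s' sigma sigma',
      close_on U (translate f s) (translate f s') (/ (INR n + 1)) /\
      zero_sum (translate f s) chi sigma /\ zero_sum (translate f s') chi sigma' /\
      e <= Cmod (sigma - sigma')).
    { intros n. apply NNPP. intros Hn. apply Hno. exists (/ (INR n + 1)). split.
      - apply Rinv_0_lt_compat. generalize (pos_INR n). lra.
      - intros s s' sigma sigma' H1 H2 H3. apply Rnot_le_lt. intros H4. apply Hn.
        exists s, s', sigma, sigma'. auto. }
    destruct (choice_function _ Hbad) as [s Hs].
    destruct (bochner alpha beta f s) as [F HF]; auto.
    { intros z Hz. apply sphol_scont, Hf, (substrip a b alpha beta); auto. }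
    destruct (Hstable F) with (e := e / 2) as [d [s0 [Hd H]]]; [|lra|].
    { intros e' He'. destruct (HF e' He' 0%nat) as [n [_ Hn]]. eauto. }
    destruct (inv_INR_small (d / 2)) as [N HN]; [lra|].
    destruct (HF (d / 2) ltac:(lra) N) as [n [Hn Hclose]].
    destruct (Hs n) as [s' [sigma [sigma' [H1 [H2 [H3 H4]]]]]].
    destruct (H (translate f (s n)) (Htr _)) as [t [Ht Hte]].
    { apply (close_on_le _ _ _ (d / 2)); [lra|exact Hclose]. }
    destruct (H (translate f s') (Htr _)) as [t' [Ht' Hte']].
    { apply (close_on_le _ _ _ (/ (INR n + 1) + d / 2)); [specialize (HN n Hn); lra|].
      eapply close_on_trans; [apply close_on_sym, H1|exact Hclose]. }
    rewrite (fsum_unique _ _ _ H2 Ht), (fsum_unique _ _ _ H3 Ht') in H4.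
    assert (T := Cmod_triangle_minus t s0 t'). rewrite (Cmod_minus_sym s0 t') in T. lra.
Qed.

(** * Divisors *)

Lemma zero_of_multiplicity_ext (F G : C -> Cbar) (x : C) (m : nat) :
  (forall w, F w = G w) -> zero_of_multiplicity F x m -> zero_of_multiplicity G x m.
Proof.
  intros E H. apply zero_of_multiplicity_elim in H. destruct H as [Hm [g [s [Hs [Hg [Hx H]]]]]].
  apply (zero_of_multiplicity_intro G x m g s); auto. intros w Hw. rewrite <- E. auto.
Qed.

Lemma zero_of_multiplicity_translate (f : C -> Cbar) (x : C) (s : R) (m : nat) :
  zero_of_multiplicity f (x + RtoC s)%C m -> zero_of_multiplicity (translate f s) x m.
Proof.
  intros H. apply zero_of_multiplicity_elim in H. destruct H as [Hm [g [r [Hr [Hg [Hx H]]]]]].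
  assert (T : forall w, (w + RtoC s - (x + RtoC s))%C = (w - x)%C) by (intros; ring).
  apply (zero_of_multiplicity_intro _ x m (fun w => g (w + RtoC s)%C) r); auto.
  - intros z Hz. destruct (Hg (z + RtoC s)%C) as [D HD]; [rewrite T; auto|].
    eexists. apply (cderiv_comp g (fun w => w + RtoC s)%C); [|exact HD].
    apply cderiv_plus; [apply cderiv_id|apply cderiv_const].
  - intros w Hw. unfold translate. rewrite H by (rewrite T; auto). rewrite T. reflexivity.
Qed.

Lemma zmult_translate (f : C -> Cbar) (x : C) (s : R) :
  zmult (translate f s) x = zmult f (x + RtoC s)%C.
Proof.
  destruct (Nat.eq_dec (zmult (translate f s) x) 0) as [E|N].
  - rewrite E. destruct (Nat.eq_dec (zmult f (x + RtoC s)%C) 0) as [E'|N']; [auto|].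
    apply zmult_pos, zero_of_multiplicity_translate, zmult_eq in N'. congruence.
  - symmetry. apply zmult_eq. apply zmult_pos in N.
    apply (zero_of_multiplicity_ext (translate (translate f s) (- s))).
    + intros w. rewrite translate_translate. unfold translate. f_equal.
      rewrite RtoC_plus, RtoC_opp. ring.
    + apply zero_of_multiplicity_translate.
      replace (x + RtoC s + RtoC (- s))%C with x by (rewrite RtoC_opp; ring). exact N.
Qed.

(** [(w - a) ^ m / g w] is the inverse of [g w / (w - a) ^ m], and takes the value 0
    at [a] since [m > 0]. *)
Lemma pole_of_multiplicity_cinv (f : C -> Cbar) (a : C) (m : nat) :
  pole_of_multiplicity f a m <-> zero_of_multiplicity (fun w => cinv (f w)) a m.
Proof.
  split.
  - intros [Hm [Ha [g [Hg [Hga H]]]]].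
    apply holomorphic_at_holo in Hg. destruct Hg as [r [Hr Hg]].
    apply locally'_Cmod in H. destruct H as [d [Hd H]].
    destruct (power_factor_neq_0 g a r 0 Hr Hg Hga) as [s [Hs [Hgs _]]].
    assert (Hg0 : forall w, Cmod (w - a) < s -> g w <> 0).
    { intros w Hw. apply Cmod_gt_0. apply Cmod_gt_0 in Hga. specialize (Hgs w Hw). lra. }
    rmin_bounds s d.
    apply (zero_of_multiplicity_intro _ a m (fun w => / g w)%C (Rmin s d)); auto.
    + apply Rmin_pos; lra.
    + apply holo_inv; [apply (holo_le g a r); auto; lra|]. intros w Hw. apply Hg0. lra.
    + apply Cinv_neq_0, Hga.
    + intros w Hw. destruct (Ceq_dec w a) as [->|N].
      * rewrite Ha. simpl cinv. f_equal. destruct m as [|m]; [lia|]. simpl. ring.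
      * assert (P := Cmod_minus_pos w a N). rewrite H by lra.
        assert (Hp := Cpow_nz (w - a)%C m (Cminus_neq_0 w a N)).
        assert (Hgw := Hg0 w ltac:(lra)).
        rewrite cinv_Fin; [f_equal; field; auto|].
        apply Cmult_neq_0; [auto|apply Cinv_neq_0; auto].
  - intros H. assert (Ha := zero_of_multiplicity_value _ _ _ H). simpl in Ha.
    apply zero_of_multiplicity_elim in H. destruct H as [Hm [g [r [Hr [Hg [Hga H]]]]]].
    destruct (power_factor_neq_0 g a r m Hr Hg Hga) as [s [Hs [Hgs Hpow]]].
    assert (Hg0 : forall w, Cmod (w - a) < s -> g w <> 0).
    { intros w Hw. apply Cmod_gt_0. apply Cmod_gt_0 in Hga. specialize (Hgs w Hw). lra. }
    split; [auto|]. split.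
    { rewrite <- (cinv_involutive (f a)), Ha. apply cinv_0. }
    exists (fun w => / g w)%C. split; [|split].
    + apply holomorphic_at_holo. exists s. split; [lra|].
      apply holo_inv; [apply (holo_le g a r); auto; lra|exact Hg0].
    + apply Cinv_neq_0, Hga.
    + apply locally'_Cmod. exists s. split; [lra|]. intros w Hw.
      rewrite <- (cinv_involutive (f w)), H by lra. rewrite cinv_Fin by (apply Hpow, Hw).
      f_equal. field. split; [apply Hg0; lra|]. apply Cpow_nz, Cmod_gt_0. lra.
Qed.

Lemma zmult_isolated (f : C -> Cbar) (z : C) :
  sphol f z -> ~ (exists s, 0 < s /\ forall w, Cmod (w - z) < s -> f w = Fin 0) ->
  locally' z (fun w => zmult f w = 0%nat).
Proof.
  intros Hf Hn. destruct (sphol_zero_or_isolated f z Hf) as [Hy|[s [Hs H]]]; [contradiction|].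
  apply locally'_Cmod. exists s. split; [auto|]. intros w Hw. apply zmult_nonzero_value, H, Hw.
Qed.

Lemma Rbar_below (a : Rbar) (x : R) : Rbar_lt a x -> exists y : R, Rbar_lt a y /\ y < x.
Proof.
  destruct a as [a| |]; simpl; intros H; [|contradiction|].
  - exists ((a + x) / 2). lra.
  - exists (x - 1). split; [auto|lra].
Qed.

Lemma Rbar_above (b : Rbar) (x : R) : Rbar_lt x b -> exists y : R, Rbar_lt y b /\ x < y.
Proof.
  destruct b as [b| |]; simpl; intros H; [| |contradiction].
  - exists ((b + x) / 2). lra.
  - exists (x + 1). split; [auto|lra].
Qed.

Lemma Rbar_between (a b : Rbar) : Rbar_lt a b -> exists x : R, Rbar_lt a x /\ Rbar_lt x b.
Proof.
  destruct a as [a| |], b as [b| |]; simpl; intros H; try contradiction.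
  - exists ((a + b) / 2). lra.
  - exists (a + 1). split; [lra|auto].
  - exists (b - 1). split; [auto|lra].
  - exists 0. auto.
Qed.

Lemma compact_in_substrip (a b : Rbar) (K : C -> Prop) :
  Rbar_lt a b -> compact_set K -> (forall z, K z -> strip a b z) ->
  exists alpha beta : R, Rbar_lt a alpha /\ alpha < beta /\ Rbar_lt beta b /\
    forall z, K z -> strip alpha beta z.
Proof.
  intros Hab HK Hsub.
  pose (adm := fun i : R * R => Rbar_lt a (fst i) /\ fst i < snd i /\ Rbar_lt (snd i) b).
  destruct (HK (R * R)%type (fun i z => adm i /\ strip (fst i) (snd i) z)) as [l Hl].
  { intros i z [Hi Hz]. apply locally_Cmod. destruct (strip_open _ _ z Hz) as [r [Hr H]].
    exists r. auto. }
  { intros z Hz. destruct (Hsub z Hz) as [H1 H2].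
    destruct (Rbar_below a _ H1) as [x [Hx Hx']]. destruct (Rbar_above b _ H2) as [y [Hy Hy']].
    exists (x, y). unfold adm, strip. simpl. split; [split; [auto|split; [lra|auto]]|lra]. }
  assert (Hcomb : exists i, adm i /\ forall j z, In j l -> adm j ->
    strip (fst j) (snd j) z -> strip (fst i) (snd i) z).
  { clear Hl. induction l as [|j l [i [Hi IH]]].
    - destruct (Rbar_between a b Hab) as [x [Hx Hx']].
      destruct (Rbar_below a x Hx) as [y [Hy Hy']].
      exists (y, x). split; [split; [auto|auto]|]. intros j z [].
    - destruct (classic (adm j)) as [Hj|Nj].
      2:{ exists i. split; [auto|]. intros j' z [<-|Hin] Hadm; [contradiction|eauto]. }
      destruct Hi as [Hi1 [Hi2 Hi3]], Hj as [Hj1 [Hj2 Hj3]].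
      exists (Rmin (fst i) (fst j), Rmax (snd i) (snd j)). simpl.
      rmin_bounds (fst i) (fst j).
      assert (L3 := Rmax_l (snd i) (snd j)). assert (L4 := Rmax_r (snd i) (snd j)).
      split.
      { split; simpl; [unfold Rmin; destruct (Rle_dec _ _); auto|]. split; [lra|].
        unfold Rmax; destruct (Rle_dec _ _); auto. }
      intros j' z [<-|Hin] Hadm Hz.
      + destruct Hz as [Hz1 Hz2]. split; simpl in *; lra.
      + destruct (IH j' z Hin Hadm Hz) as [Hz1 Hz2]. split; simpl in *; lra. }
  destruct Hcomb as [[x y] [[Hi1 [Hi2 Hi3]] Hcomb]]. exists x, y. simpl in *.
  split; [auto|]. split; [auto|]. split; [auto|]. intros z Hz.
  destruct (Hl z Hz) as [j [Hin [Hj Hjz]]]. eauto.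
Qed.

Lemma smooth_cont (chi : C -> C) (z : C) : smooth chi -> Ccont chi z.
Proof.
  intros H e He. destruct z as [x y]. destruct (H 0%nat x y) as [[H1 _] [H2 _]].
  assert (He2 : 0 < e / 2) by lra.
  destruct (H1 (mkposreal _ He2)) as [d1 Hd1]. destruct (H2 (mkposreal _ He2)) as [d2 Hd2].
  exists (Rmin d1 d2). split; [apply Rmin_pos; apply cond_pos|]. intros [u v] Hw.
  rmin_bounds d1 d2.
  assert (B := Rmax_Cmod ((u, v) - (x, y))%C). simpl in B.
  assert (B1 := Rle_trans _ _ _ (Rmax_l _ _) B). assert (B2 := Rle_trans _ _ _ (Rmax_r _ _) B).
  unfold Rminus in Hd1, Hd2.
  specialize (Hd1 u v ltac:(lra) ltac:(lra)). specialize (Hd2 u v ltac:(lra) ltac:(lra)).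
  simpl in Hd1, Hd2.
  assert (T := Cmod_le_abs (fst (chi (u, v)) - fst (chi (x, y))) (snd (chi (u, v)) - snd (chi (x, y)))).
  unfold Re, Im, Rminus in *.
  eapply Rle_lt_trans; [exact T|]. lra.
Qed.

(** The sum [g t] is controlled by the translate of [f] by [- t] alone. This is
    preserved by linear combinations, whereas almost periods of two functions
    need not be common to both. *)
Definition translation_modulus (alpha beta : R) (f : C -> Cbar) (g : R -> C) : Prop :=
  forall e, 0 < e -> exists d, 0 < d /\ forall t t',
    close_on (strip alpha beta) (translate f (- t)) (translate f (- t')) d ->
    Cmod (g t - g t') < e.

Lemma translation_modulus_lincomb (alpha beta : R) (f : C -> Cbar) (g h : R -> C) (c : C) :
  Cmod c <= 1 -> translation_modulus alpha beta f g -> translation_modulus alpha beta f h ->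
  translation_modulus alpha beta f (fun t => g t + c * h t)%C.
Proof.
  intros Hc Hg Hh e He.
  destruct (Hg (e / 2)) as [d [Hd H]]; [lra|]. destruct (Hh (e / 2)) as [d' [Hd' H']]; [lra|].
  exists_rmin d d'. intros t t' Hcl.
  specialize (H t t' (close_on_le _ _ _ _ _ (Rmin_l d d') Hcl)).
  specialize (H' t t' (close_on_le _ _ _ _ _ (Rmin_r d d') Hcl)).
  replace (g t + c * h t - (g t' + c * h t'))%C with ((g t - g t') + c * (h t - h t'))%C by ring.
  eapply Rle_lt_trans; [apply Cmod_triangle|]. rewrite Cmod_mult.
  assert (G := Cmod_ge_0 (h t - h t')). nra.
Qed.

Lemma translation_modulus_cinv (alpha beta : R) (f : C -> Cbar) (g : R -> C) :
  translation_modulus alpha beta (fun w => cinv (f w)) g -> translation_modulus alpha beta f g.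
Proof.
  intros H e He. destruct (H e He) as [d [Hd H1]]. exists d. split; [auto|].
  intros t t' Hcl. apply H1. intros z Hz. unfold translate. rewrite sdist_cinv. apply Hcl, Hz.
Qed.

Lemma translation_modulus_almost_periodic (alpha beta : R) (f : C -> Cbar) (g : R -> C) :
  closed_strip_scont alpha beta f -> strip_almost_periodic alpha beta f ->
  translation_modulus alpha beta f g -> almost_periodic g.
Proof.
  intros Hc Hap Hg. split.
  - intros x. apply Rcont_continuous. intros e He. destruct (Hg e He) as [d [Hd H]].
    destruct (strip_almost_periodic_uniform alpha beta f Hc Hap d Hd) as [h [Hh Hu]].
    exists h. split; [auto|]. intros s Hs. apply H. intros z Hz.
    assert (B := translate_close _ _ _ _ _ (- x) (Hu (x - s) ltac:(rewrite Rabs_minus_sym; auto)) z Hz).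
    rewrite translate_translate in B. replace (x - s + - x) with (- s) in B by ring. exact B.
  - intros e He. destruct (Hg e He) as [d [Hd H]].
    destruct (Hap d Hd) as [L [HL HLt]]. exists L. split; [auto|]. intros t.
    destruct (HLt t) as [tau [Ht Htau]]. exists tau. split; [auto|]. intros x. apply H.
    intros z Hz. assert (B := translate_close _ _ _ _ _ (- (x + tau)) Htau z Hz).
    rewrite translate_translate in B. replace (tau + - (x + tau)) with (- x) in B by ring.
    rewrite sdist_sym. exact B.
Qed.

(** The substitution [x = p + t] moves the translation from the test function to
    the divisor. *)
Definition shifted_sum (mu : C -> Z) (chi : C -> C) (t : R) : C -> Prop :=
  fsum (fun x => RtoC (IZR (mu (x + RtoC (- t))%C)) * chi x)%C.

Lemma zero_sums_modulus (a b : Rbar) (alpha beta : R) (f : C -> Cbar) (chi : C -> C) :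
  Rbar_lt a alpha -> alpha < beta -> Rbar_lt beta b ->
  (forall z, strip a b z -> sphol f z) -> ~ (forall z, strip a b z -> f z = Fin 0) ->
  strip_almost_periodic alpha beta f -> test_function (strip alpha beta) chi ->
  exists g, (forall t, shifted_sum (fun x => Z.of_nat (zmult f x)) chi t (g t)) /\
    translation_modulus alpha beta f g.
Proof.
  intros Ha Hab Hb Hf Hnz Hap [Hs [Hcomp Hsupp]].
  destruct (zero_sum_translates a b alpha beta f chi Ha Hab Hb Hf Hnz Hap
    (fun z => smooth_cont chi z Hs) Hcomp Hsupp) as [Hex Hmod].
  destruct (choice_function _ (fun t => Hex (- t))) as [g Hg].
  exists g. split.
  - intros t. refine (fsum_ext _ _ _ _ (Hg t)). intros x. cbv beta.
    rewrite zmult_translate, INR_IZR_INZ. reflexivity.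
  - intros e He. destruct (Hmod e He) as [d [Hd H]]. exists d. split; [auto|].
    intros t t' Hcl. apply (H (- t) (- t')); auto.
Qed.

Lemma shifted_sum_lincomb (mu nu : C -> Z) (c : Z) (chi : C -> C) (t : R) (s s' : C) :
  shifted_sum mu chi t s -> shifted_sum nu chi t s' ->
  shifted_sum (fun x => mu x + c * nu x)%Z chi t (s + RtoC (IZR c) * s')%C.
Proof.
  intros H H'.
  refine (fsum_ext _ _ _ _ (fsum_plus _ _ _ _ H (fsum_scal (RtoC (IZR c)) _ _ H'))).
  intros x. cbv beta. rewrite plus_IZR, mult_IZR, RtoC_plus, RtoC_mult. ring.
Qed.

Lemma shifted_sum_finite (a b : Rbar) (mu : C -> Z) (d : C * Z -> Prop) (chi : C -> C) (t : R)
  (s : C) :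
  (forall p k, d (p, k) <-> strip a b p /\ k = mu p /\ k <> 0%Z) ->
  (forall z, chi z <> 0 -> strip a b z) -> shifted_sum mu chi t s ->
  is_finite_sum d (fun p => RtoC (IZR (snd p)) * chi (fst p + RtoC t))%C s.
Proof.
  intros Hd Hchi [l [N [H ->]]]. set (F := fun x => (RtoC (IZR (mu (x + RtoC (- t))%C)) * chi x)%C) in *.
  set (pt := fun x => ((x + RtoC (- t))%C, mu (x + RtoC (- t))%C)).
  assert (Eb : forall x : C, (x + RtoC (- t) + RtoC t)%C = x).
  { intros x. rewrite RtoC_opp. ring. }
  assert (Ef : forall x : C, (x + RtoC t + RtoC (- t))%C = x).
  { intros x. rewrite RtoC_opp. ring. }
  exists (map pt (filter (nonzero_at F) l)). split; [|split].
  - apply FinFun.Injective_map_NoDup; [|apply NoDup_filter, N].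
    intros x y E. apply (f_equal fst) in E. simpl in E. rewrite <- (Eb x), E. apply Eb.
  - intros [p k]. simpl. rewrite in_map_iff, Hd. split.
    + intros [x [E Hx]]. injection E as <- <-. apply filter_In in Hx. destruct Hx as [_ Hx].
      apply nonzero_at_spec in Hx. rewrite Eb. split; [|exact Hx].
      assert (Hcx : chi x <> 0) by (intros E; apply Hx; unfold F; rewrite E; ring).
      split; [apply strip_translate, Hchi, Hcx|]. split; [reflexivity|].
      intros E. apply Hx. unfold F. rewrite E. ring.
    + intros [[Hp [-> Hk]] Hne]. exists (p + RtoC t)%C. unfold pt. rewrite Ef.
      split; [reflexivity|]. assert (HF : F (p + RtoC t)%C <> 0) by (unfold F; rewrite Ef; exact Hne).
      apply filter_In. split; [apply H, HF|apply nonzero_at_spec, HF].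
  - rewrite <- csum_filter. unfold csum. rewrite map_map. f_equal. apply map_ext. intros x.
    unfold F, pt. simpl. rewrite Eb. reflexivity.
Qed.

(** The sums over a divisor only depend on its multiplicity function, which makes
    the positive part, the negative part and the modulus accessible to the same
    argument. *)
Lemma almost_periodic_divisor_of_multiplicity (a b : Rbar) (mu : C -> Z) (d : C * Z -> Prop) :
  (forall p k, d (p, k) <-> strip a b p /\ k = mu p /\ k <> 0%Z) ->
  (forall z, strip a b z -> locally' z (fun w => mu w = 0%Z)) ->
  (forall chi, test_function (strip a b) chi ->
    exists g, (forall t, shifted_sum mu chi t (g t)) /\ almost_periodic g) ->
  almost_periodic_divisor (strip a b) d.
Proof.
  intros Hd Hiso Hsum. split.
  - split; [|split].
    + intros p k H. apply Hd in H. tauto.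
    + intros p k k' H H'. apply Hd in H, H'. destruct H as [_ [-> _]], H' as [_ [-> _]]. reflexivity.
    + intros z Hz. apply locally'_Cmod. destruct (proj1 (locally'_Cmod _ _) (Hiso z Hz)) as [r [Hr H]].
      exists r. split; [auto|]. intros w Hw k Hk. apply Hd in Hk. destruct Hk as [_ [-> Hk]].
      apply Hk, H, Hw.
  - intros chi Hchi. destruct (Hsum chi Hchi) as [g [Hg Hap]]. exists g. split; [|exact Hap].
    intros t. apply (shifted_sum_finite a b mu d chi t (g t) Hd); [|apply Hg].
    intros z Hz. apply Hchi, support_intro, Hz.
Qed.

Theorem theorem6 (a b : Rbar) (f : C -> Cbar) :
  Rbar_lt a b ->
  meromorphic_almost_periodic a b f ->
  ~ (forall z : C, strip a b z -> f z = Fin 0) ->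
  almost_periodic_divisor (strip a b) (div_of (strip a b) f) /\
  almost_periodic_divisor (strip a b) (div_pos (div_of (strip a b) f)) /\
  almost_periodic_divisor (strip a b) (div_neg (div_of (strip a b) f)) /\
  almost_periodic_divisor (strip a b) (div_abs (div_of (strip a b) f)).
Proof.
  intros Hab [Hmer Hap] Hnz.
  set (f' := fun w => cinv (f w)).
  assert (Hf : forall z, strip a b z -> sphol f z).
  { intros z Hz. apply (meromorphic_sphol (strip a b)); auto. }
  assert (Hf' : forall z, strip a b z -> sphol f' z).
  { intros z Hz. apply sphol_cinv, Hf, Hz. }
  assert (Hnz' : ~ (forall z, strip a b z -> f' z = Fin 0)).
  { intros H. assert (HI : forall z, strip a b z -> f z = Inf).
    { intros z Hz. rewrite <- (cinv_involutive (f z)). fold (f' z). rewrite H by auto. apply cinv_0. }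
    destruct (Rbar_between a b Hab) as [y [Hy Hy']].
    assert (H0 : strip a b (0, y)) by (split; simpl; auto).
    destruct (Hmer _ H0) as [[Hreg _]|[_ [Hp _]]].
    - apply locally_Cmod in Hreg. destruct Hreg as [r [Hr Hreg]].
      apply (Hreg (0, y)); [rewrite Cmod_self_minus; auto|auto].
    - apply locally'_Cmod in Hp. destruct Hp as [r [Hr Hp]].
      assert (E : Cmod ((0, y) + RtoC (r / 2) - (0, y)) = r / 2).
      { replace ((0, y) + RtoC (r / 2) - (0, y))%C with (RtoC (r / 2))
          by (apply injective_projections; simpl; ring).
        rewrite Cmod_R, Rabs_pos_eq; lra. }
      destruct (Hp ((0, y) + RtoC (r / 2))%C) as [Hfin _]; [rewrite E; lra|].
      apply Hfin, HI, strip_translate, H0. }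
  assert (Hloc : forall h, (forall z, strip a b z -> sphol h z) ->
    ~ (forall z, strip a b z -> h z = Fin 0) ->
    forall z, strip a b z -> exists r, 0 < r /\ forall w, 0 < Cmod (w - z) < r -> zmult h w = 0%nat).
  { intros h Hh Hhn z Hz. apply locally'_Cmod, zmult_isolated; [auto|].
    intros [s [Hs H]]. apply Hhn.
    apply (sphol_identity h (strip a b) z s (strip_convex a b) Hh Hz Hs H). }
  set (Zp := fun x => Z.of_nat (zmult f x)). set (Pp := fun x => Z.of_nat (zmult f' x)).
  assert (Hiso : forall (c1 c2 : Z) z, strip a b z ->
    locally' z (fun w => (c1 * Zp w + c2 * Pp w)%Z = 0%Z)).
  { intros c1 c2 z Hz. apply locally'_Cmod.
    destruct (Hloc f Hf Hnz z Hz) as [r [Hr H]]. destruct (Hloc f' Hf' Hnz' z Hz) as [r' [Hr' H']].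
    exists_rmin r r'. intros w Hw.
    rmin_bounds r r'.
    unfold Zp, Pp. rewrite H, H' by lra. simpl. ring. }
  (* Coefficients in {-1, 0, 1} suffice for the four divisors. *)
  assert (Hsum : forall (c1 c2 : Z), (Z.abs c1 <= 1)%Z -> (Z.abs c2 <= 1)%Z ->
    forall chi, test_function (strip a b) chi ->
    exists g, (forall t, shifted_sum (fun x => c1 * Zp x + c2 * Pp x)%Z chi t (g t)) /\
      almost_periodic g).
  { intros c1 c2 Hc1 Hc2 chi [Hs [Hcomp Hsupp]].
    destruct (compact_in_substrip a b (support chi) Hab Hcomp Hsupp)
      as [alpha [beta [Ha [Hlt [Hb Hin]]]]].
    assert (Hsap : strip_almost_periodic alpha beta f).
    { intros e He. destruct (Hap alpha beta Ha Hlt Hb e He) as [L [HL HLt]].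
      exists L. split; [auto|]. intros t. destruct (HLt t) as [tau [Ht Htau]].
      exists tau. split; [auto|]. intros z Hz.
      eapply Rle_lt_trans; [apply sdist_le_rho|apply Htau, Hz]. }
    assert (Hsap' : strip_almost_periodic alpha beta f').
    { intros e He. destruct (Hsap e He) as [L [HL HLt]].
      exists L. split; [auto|]. intros t. destruct (HLt t) as [tau [Ht Htau]].
      exists tau. split; [auto|]. intros z Hz. unfold translate, f'. rewrite sdist_cinv.
      apply Htau, Hz. }
    assert (Htest : test_function (strip alpha beta) chi) by (split; [auto|split; auto]).
    destruct (zero_sums_modulus a b alpha beta f chi) as [gz [Hgz Hmz]]; auto.
    destruct (zero_sums_modulus a b alpha beta f' chi) as [gp [Hgp Hmp]]; auto.
    apply translation_modulus_cinv in Hmp.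
    assert (HC : forall c : Z, (Z.abs c <= 1)%Z -> Cmod (RtoC (IZR c)) <= 1).
    { intros c Hc. rewrite Cmod_R, <- abs_IZR. apply (IZR_le _ 1), Hc. }
    exists (fun t => (0 + RtoC (IZR c1) * gz t) + RtoC (IZR c2) * gp t)%C. split.
    - intros t. apply (shifted_sum_lincomb (fun x => c1 * Zp x)%Z Pp); [|apply Hgp].
      apply (shifted_sum_lincomb (fun _ => 0%Z) Zp); [|apply Hgz].
      apply fsum_zero. intros x. simpl. ring.
    - apply (translation_modulus_almost_periodic alpha beta f); auto.
      { intros z Hz. apply sphol_scont, Hf, (substrip a b alpha beta); auto. }
      apply translation_modulus_lincomb; auto. apply translation_modulus_lincomb; auto.
      intros e He. exists 1. split; [lra|]. intros t t' _. rewrite Cmod_self_minus. exact He. }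
  assert (Hexcl : forall p, zmult f p = 0%nat \/ zmult f' p = 0%nat).
  { intros p. destruct (Nat.eq_dec (zmult f p) 0) as [E|N]; [auto|]. right.
    apply zmult_nonzero_value. apply zmult_pos, zero_of_multiplicity_value in N.
    unfold f'. rewrite N, cinv_0. discriminate. }
  assert (Hdiv : forall p k, div_of (strip a b) f (p, k) <->
    strip a b p /\ k = (Zp p - Pp p)%Z /\ k <> 0%Z).
  { intros p k. unfold div_of, Zp, Pp. simpl. split.
    - intros [Hp [m [[Hm ->]|[Hm ->]]]].
      + assert (Em := zmult_eq _ _ _ Hm). destruct Hm as [Hm _].
        destruct (Hexcl p) as [E|E]; [lia|]. rewrite Em, E. split; [auto|lia].
      + apply pole_of_multiplicity_cinv in Hm.
        assert (Em := zmult_eq _ _ _ Hm). fold f' in Em. destruct Hm as [Hm _].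
        destruct (Hexcl p) as [E|E]; [|lia]. rewrite Em, E. split; [auto|lia].
    - intros [Hp [-> Hk]]. split; [auto|]. destruct (Hexcl p) as [E|E].
      + exists (zmult f' p). right. split; [|lia].
        apply pole_of_multiplicity_cinv, zmult_pos. fold f'. lia.
      + exists (zmult f p). left. split; [|lia]. apply zmult_pos. lia. }
  assert (Hpos : forall p, (0 <= Zp p)%Z /\ (0 <= Pp p)%Z /\ (Zp p = 0 \/ Pp p = 0)%Z).
  { intros p. unfold Zp, Pp. destruct (Hexcl p); lia. }
  split; [|split; [|split]].
  - apply (almost_periodic_divisor_of_multiplicity a b (fun x => 1 * Zp x + -1 * Pp x)%Z);
      [|apply Hiso|apply Hsum; lia].
    intros p k. rewrite Hdiv. specialize (Hpos p). intuition lia.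
  - apply (almost_periodic_divisor_of_multiplicity a b (fun x => 1 * Zp x + 0 * Pp x)%Z);
      [|apply Hiso|apply Hsum; lia].
    intros p k. unfold div_pos. simpl fst. simpl snd. specialize (Hpos p). split.
    + intros [k' [H [Hk ->]]]. apply Hdiv in H. intuition lia.
    + intros [Hp [-> Hk]]. exists (Zp p). rewrite Hdiv. intuition lia.
  - apply (almost_periodic_divisor_of_multiplicity a b (fun x => 0 * Zp x + 1 * Pp x)%Z);
      [|apply Hiso|apply Hsum; lia].
    intros p k. unfold div_neg. simpl fst. simpl snd. specialize (Hpos p). split.
    + intros [k' [H [Hk ->]]]. apply Hdiv in H. intuition lia.
    + intros [Hp [-> Hk]]. exists (- Pp p)%Z. rewrite Hdiv. intuition lia.
  - apply (almost_periodic_divisor_of_multiplicity a b (fun x => 1 * Zp x + 1 * Pp x)%Z);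
      [|apply Hiso|apply Hsum; lia].
    intros p k. unfold div_abs. simpl fst. simpl snd. specialize (Hpos p). split.
    + intros [k' [H ->]]. apply Hdiv in H. intuition lia.
    + intros [Hp [-> Hk]]. exists (Zp p - Pp p)%Z. rewrite Hdiv. intuition lia.
Qed.
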